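(* Suppose $\mathcal{S} \subset B(H)$ is a separable operator system such that $C^*(\mathcal{S})$ is block diagonal, that is, the identity representation satisfies $\operatorname{id} \cong \bigoplus_{i \in \Lambda} \psi_i$ for finite-dimensional irreducible representations $\psi_i: C^*(\mathcal{S}) \to M_{n_i}(\mathbb{C})$. Then the following are equivalent. \begin{enumerate} \item $\mathcal{S}$ is minimal. \item For each $i \in \Lambda$, the map $s \mapsto \bigoplus_{j \in \Lambda \setminus \{i\}} \psi_j(s)$ is not completely isometric on $\mathcal{S}$. \item The $\psi_i$ are strongly peaking representations for $\mathcal{S}$, enumerated once per unitary equivalence class. \item $\mathcal{S}$ is fully compressed. \end{enumerate} Moreover, in this case $C^*(\mathcal{S}) = C^*_e(\mathcal{S})$.
   Context: An operator system $\mathcal{S} \subset B(H)$ ($H$ a nonzero complex Hilbert space) is a linear subspace of $B(H)$ that contains $I$ and is closed under adjoints; it is separable if it is norm separable. $C^*(\mathcal{S})$ is the $C^*$-algebra it generates in $B(H)$, and $\operatorname{id}$ is the inclusion $C^*(\mathcal{S}) \subset B(H)$. $\cong$ denotes unitary equivalence. Fully compressed: for every proper closed subspace $G \subsetneq H$, with $P_G$ the orthogonal projection onto $G$, the compression map $s \mapsto P_G s|_G$ is not completely isometric on $\mathcal{S}$. Minimal: the same is required only for proper closed subspaces $G$ that are reducing for $\mathcal{S}$. (Compression to $\{0\}$, and likewise an empty direct sum, is never completely isometric.) Strongly peaking representation for $\mathcal{S}$: an irreducible representation $\pi : C^*(\mathcal{S}) \to B(H_\pi)$ for which there exist $n$ and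 $S \in M_n(\mathcal{S})$ with $\|\pi(S)\| > \sup\{\|\sigma(S)\| : \sigma \in \operatorname{Irr}(C^*(\mathcal{S})),\ \sigma \not\cong \pi\}$, where $\operatorname{Irr}$ denotes the irreducible representations, representations are applied entrywise to matrices, and the supremum of the empty set is $0$. $C^*$-envelope: a $C^*$-cover of $\mathcal{S}$ is a pair $(\mathcal{A}, j)$ with $j : \mathcal{S} \to \mathcal{A}$ a unital complete isometry and $\mathcal{A} = C^*(j(\mathcal{S}))$. The $C^*$-envelope $(C^*_e(\mathcal{S}), \iota)$ is the $C^*$-cover such that for every $C^*$-cover $(\mathcal{A}, j)$ there is a unital $*$-homomorphism $\rho : \mathcal{A} \to C^*_e(\mathcal{S})$ with $\rho \circ j = \iota$. ''$C^*(\mathcal{S}) = C^*_e(\mathcal{S})$'' means that the canonical map $C^*(\mathcal{S}) \to C^*_e(\mathcal{S})$ is an isomorphism. *)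

(* Defs.v *)
From HB Require Import structures.
From mathcomp Require Import all_boot all_order all_algebra.
From mathcomp Require Import finmap complex.
From mathcomp Require Import all_classical all_reals.
From mathcomp Require Import topology normedtype sequences.
From mathcomp Require Import ring lra.
Set Implicit Arguments.
Unset Strict Implicit.
Unset Printing Implicit Defensive.
Import Order.TTheory GRing.Theory Num.Theory.
Import numFieldNormedType.Exports.
Local Open Scope classical_set_scope.
Local Open Scope ring_scope.

Section UnorderedSums.
Variables (I : choiceType) (K : numFieldType).
Implicit Types (a b : I -> K) (s t : K).

(* Convergence along the directed set of finite subsets of I. *)
Definition is_usum a s := forall e : K, 0 < e ->
  exists F0 : {fset I}, forall F : {fset I}, (F0 `<=` F)%fset ->
    `|s - \sum_(i <- F) a i| < e.

Lemma is_usum_unique a s t : is_usum a s -> is_usum a t -> s = t.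
Proof.
move=> sa ta; apply/eqP; rewrite -subr_eq0 -normr_eq0.
apply/negPn/negP => nz.
have e0 : 0 < `|s - t| / 2 by rewrite divr_gt0 // lt_def nz normr_ge0.
have [F HF] := sa _ e0; have [G HG] := ta _ e0.
have := HF (F `|` G)%fset (fsubsetUl _ _).
have := HG (F `|` G)%fset (fsubsetUr _ _).
set x := \sum_(_ <- _) _ => h1 h2.
suff : `|s - t| < `|s - t| by rewrite ltxx.
rewrite [ltRHS](splitr `|s - t|).
rewrite (le_lt_trans (ler_distD x s t)) // ltrD // (distrC x) //.
Qed.

Lemma is_usumD a b s t :
  is_usum a s -> is_usum b t -> is_usum (fun i => a i + b i) (s + t).
Proof.
move=> sa tb e e0.
have e2 : 0 < e / 2 by rewrite divr_gt0.
have [F HF] := sa _ e2; have [G HG] := tb _ e2.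
exists (F `|` G)%fset => D; rewrite fsubUset => /andP[/HF h1 /HG h2].
rewrite big_split /= opprD addrACA (splitr e).
by rewrite (le_lt_trans (ler_normD _ _)) // ltrD.
Qed.

Lemma is_usumZ c a s : is_usum a s -> is_usum (fun i => c * a i) (c * s).
Proof.
have [-> _ e e0|c0 sa e e0] := eqVneq c 0.
  exists fset0 => F _; rewrite mul0r big1 ?subr0 ?normr0 // => i _.
  by rewrite mul0r.
have nc : 0 < `|c| by rewrite normr_gt0.
have [F HF] := sa (e / `|c|) (divr_gt0 e0 nc).
by exists F => G /HF; rewrite ltr_pdivlMr // mulrC -normrM mulrBr mulr_sumr.
Qed.

Lemma ler_sum_fset a (F G : {fset I}) : (forall i, 0 <= a i) ->
  (F `<=` G)%fset -> \sum_(i <- F) a i <= \sum_(i <- G) a i.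
Proof.
move=> a0 FG; rewrite [leRHS](bigID (mem F)) /= -[leLHS]addr0.
rewrite lerD ?sumr_ge0 //.
rewrite -[leRHS]big_filter (perm_big [seq i <- G | i \in F]) //=.
apply: uniq_perm => //; first exact: filter_uniq.
move=> i; rewrite mem_filter.
by case: (boolP (i \in F)) => // iF; rewrite (fsubsetP FG).
Qed.

Lemma ge0_is_usum a s : (forall i, 0 <= a i) -> is_usum a s ->
  s \is Num.real -> forall F : {fset I}, \sum_(i <- F) a i <= s.
Proof.
move=> a0 sa sr F; have Fr : \sum_(i <- F) a i \is Num.real.
  by rewrite ger0_real // sumr_ge0.
rewrite real_leNgt //; apply/negP; rewrite -subr_gt0 => /sa[G HG].
have := HG (F `|` G)%fset (fsubsetUr _ _); apply/negP.
rewrite -real_leNgt ?normr_real ?rpredB // distrC.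
apply: le_trans (real_ler_norm _); last first.
  by rewrite rpredB // ger0_real // sumr_ge0.
by rewrite lerB // ler_sum_fset // fsubsetUl.
Qed.

Definition usum a : K := xget 0 [set s | is_usum a s].

Lemma usumE a s : is_usum a s -> usum a = s.
Proof.
by move=> sa; apply: xget_subset1 => // x y /=; apply: is_usum_unique.
Qed.

End UnorderedSums.

Lemma bounded_is_usum (R : realType) (I : choiceType) (a : I -> R) (M : R) :
  (forall i, 0 <= a i) -> (forall F : {fset I}, \sum_(i <- F) a i <= M) ->
  exists s, is_usum a s.
Proof.
move=> a0 aM; pose E := [set x | exists F : {fset I}, x = \sum_(i <- F) a i].
have hE : has_sup E.
  by split; [exists (\sum_(i <- fset0) a i), fset0 | exists M => _ [F ->]].
exists (sup E) => e e0; have [_ [F ->] HF] := sup_adherent e0 hE.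
exists F => G FG; rewrite ger0_norm; last first.
  by rewrite subr_ge0 sup_upper_bound //; exists G.
by rewrite ltrBlDr -ltrBlDl (lt_le_trans HF) // ler_sum_fset.
Qed.

Section SquaredNorm.
Variables (R : realType) (U : lmodType R[i]) (f : {dot U for Num.conj}).
Implicit Types (x y : U) (a : R[i]).

Definition sqn x : R := complex.Re (f x x).

Lemma dot_sqn x : f x x = (sqn x)%:C%C.
Proof. by rewrite /sqn RRe_real // ger0_real // dnorm_ge0. Qed.

Lemma sqn_ge0 x : 0 <= sqn x.
Proof. by have := dnorm_ge0 f x; rewrite dot_sqn lecR. Qed.

Lemma sqn_eq0 x : (sqn x == 0) = (x == 0).
Proof. by rewrite -(dnorm_eq0 f) dot_sqn -(inj_eq (@complexI R)). Qed.

Lemma sqn0 : sqn 0 = 0.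
Proof. by apply/eqP; rewrite sqn_eq0. Qed.

Lemma sqnZ a x : sqn (a *: x) = (complex.Re a ^+ 2 + complex.Im a ^+ 2) * sqn x.
Proof.
apply: (@complexI R); rewrite -dot_sqn dnormZ dot_sqn.
by rewrite -add_Re2_Im2 -rmorphM.
Qed.

Lemma sqnN x : sqn (- x) = sqn x.
Proof. by rewrite -scaleN1r sqnZ /= oppr0 sqrrN expr1n expr0n addr0 mul1r. Qed.

Lemma Re_conjC a : complex.Re (Num.conj a) = complex.Re a.
Proof. by case: a. Qed.

Lemma sqnD x y : sqn (x + y) = sqn x + sqn y + 2 * complex.Re (f x y).
Proof.
by rewrite /sqn dnormD !raddfD /= Re_conjC mulr_natl mulr2n.
Qed.

Lemma sqnD_le x y : sqn (x + y) <= 2 * (sqn x + sqn y).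
Proof.
have := sqn_ge0 (x - y); rewrite !sqnD sqnN linearNr raddfN /=; lra.
Qed.

Lemma Re_dot x y : complex.Re (f x y) = 2^-1 * (sqn (x + y) - sqn x - sqn y).
Proof. by rewrite sqnD; field. Qed.

Lemma Im_dot x y : complex.Im (f x y) = complex.Re (f x ('i%C *: y)).
Proof. by rewrite linearZr_LR /=; case: (f x y) => u v /=; ring. Qed.

Lemma dot_polar x y : f x y =
  Complex (2^-1 * (sqn (x + y) - sqn x - sqn y))
          (2^-1 * (sqn (x + 'i%C *: y) - sqn x - sqn y)).
Proof.
case E : (f x y) => [u v]; congr Complex.
  by rewrite -Re_dot E.
have -> : sqn y = sqn ('i%C *: y) by rewrite sqnZ /= expr0n add0r expr1n mul1r.
by rewrite -Re_dot -Im_dot E.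
Qed.

Definition sqn_complete := forall u : nat -> U,
  (forall e : R, 0 < e -> exists N, forall m n, (N <= m)%N -> (N <= n)%N ->
     Num.sqrt (sqn (u m - u n)) < e) ->
  exists l, forall e : R, 0 < e -> exists N, forall n, (N <= n)%N ->
     Num.sqrt (sqn (u n - l)) < e.

Lemma sqn_completeP : sqn_complete <-> forall u : nat -> U,
  (forall e : R, 0 < e -> exists N, forall m n, (N <= m)%N -> (N <= n)%N ->
     sqn (u m - u n) < e) ->
  exists l, forall e : R, 0 < e -> exists N, forall n, (N <= n)%N ->
     sqn (u n - l) < e.
Proof.
have sq e x : 0 < e -> (Num.sqrt (sqn x) < e) = (sqn x < e ^+ 2).
  by move=> e0; rewrite -[X in _ < X](gtr0_norm e0) -sqrtr_sqr ltr_sqrt ?exprn_gt0.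
have sq' e x : 0 < e -> (Num.sqrt (sqn x) < Num.sqrt e) = (sqn x < e).
  by move=> e0; rewrite ltr_sqrt.
split=> cpl u cu.
- have [e e0|l hl] := cpl u.
    by have [N HN] := cu (e ^+ 2) (exprn_gt0 _ e0); exists N => m n h1 h2;
      rewrite sq // HN.
  exists l => e e0; have [|N HN] := hl (Num.sqrt e); first by rewrite sqrtr_gt0.
  by exists N => n /HN; rewrite sq'.
- have [e e0|l hl] := cpl u.
    have [|N HN] := cu (Num.sqrt e); first by rewrite sqrtr_gt0.
    by exists N => m n h1 h2; rewrite -sq' // HN.
  exists l => e e0; have [N HN] := hl (e ^+ 2) (exprn_gt0 _ e0).
  by exists N => n /HN; rewrite sq.
Qed.

End SquaredNorm.

(* [hdot] is linear in its first argument, conjugate-linear in the second. *)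
Record hilbert (R : realType) := Hilbert {
  hilbert_sort :> lmodType R[i];
  hdot : {dot hilbert_sort for Num.conj};
  hilbert_complete : sqn_complete hdot }.
Arguments hdot {R h}.

Definition hnorm (R : realType) (H : hilbert R) (x : H) : R :=
  Num.sqrt (sqn (@hdot R H) x).

Section ComplexSums.
Variables (R : realType) (I : choiceType).

Lemma is_usum_real (a : I -> R) s :
  is_usum a s -> is_usum (fun i => (a i)%:C%C) (s%:C%C).
Proof.
move=> sa [e e'] /[1!ltcE] /= /andP[/eqP -> e0].
have [F HF] := sa _ e0; exists F => G /HF.
by rewrite -rmorph_sum -rmorphB /= normc_def /= expr0n addr0 sqrtr_sqr ltcR.
Qed.

Lemma is_usum_complex (a b : I -> R) s t : is_usum a s -> is_usum b t ->
  is_usum (fun i => Complex (a i) (b i)) (Complex s t).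
Proof.
move=> /is_usum_real sa /is_usum_real tb.
have E (x y : R) : Complex x y = x%:C%C + 'i%C * y%:C%C by rewrite [LHS]complexE.
rewrite E (_ : (fun _ => _) = fun i => (a i)%:C%C + 'i%C * (b i)%:C%C).
  by apply: is_usumD => //; apply: is_usumZ.
by apply: funext => i; rewrite E.
Qed.

Lemma is_usum_conj (a : I -> R[i]) s :
  is_usum a s -> is_usum (fun i => Num.conj (a i)) (Num.conj s).
Proof.
move=> sa e /sa[F HF]; exists F => G /HF.
by rewrite -rmorph_sum -rmorphB /= norm_conjC.
Qed.

End ComplexSums.

Section Vanishing.
Variable R : realType.

Definition vanishing (u : nat -> R) :=
  forall e : R, 0 < e -> exists N, forall n, (N <= n)%N -> u n < e.

Lemma vanishing_sum (J : Type) (s : seq J) (u : J -> nat -> R) :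
  (forall j, vanishing (u j)) -> vanishing (fun n => \sum_(j <- s) u j n).
Proof.
move=> uv; elim: s => [|j s IH] e e0.
  by exists 0 => n _; rewrite big_nil.
have e2 : 0 < e / 2 by rewrite divr_gt0.
have [N HN] := uv j _ e2; have [M HM] := IH _ e2.
exists (maxn N M) => n; rewrite geq_max big_cons (splitr e) => /andP[h1 h2].
by rewrite ltrD ?HN ?HM.
Qed.

Lemma real_complete_sqr (u : nat -> R) :
  (forall e : R, 0 < e -> exists N, forall m n, (N <= m)%N -> (N <= n)%N ->
     (u m - u n) ^+ 2 < e) ->
  exists l, vanishing (fun n => (u n - l) ^+ 2).
Proof.
move=> cu; have sq (e x : R) : 0 < e -> (x ^+ 2 < e ^+ 2) = (`|x| < e).
  move=> e0.
  by rewrite -real_normK ?num_real // ltr_pXn2r // ?nnegrE ?normr_ge0 ?ltW.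
have : cauchy (u @ \oo).
  apply/cauchy_ballP => e e0; have [N HN] := cu _ (exprn_gt0 2 e0).
  pose A := [set x | exists2 k, (N <= k)%N & x = u k].
  have uA : (u @ \oo) A by exists N => // k /= Nk; exists k.
  exists (A, A) => // -[_ _] [] /= [k Nk ->] [m Nm ->].
  by rewrite /ball /= -sq // HN.
move=> /cauchy_cvg /cvg_ex[l ul]; exists l => e e0.
have s0 : 0 < Num.sqrt e by rewrite sqrtr_gt0.
have /cvgrPdist_lt/(_ _ s0)[N _ HN] := ul.
by exists N => n /HN /=; rewrite distrC -sq // sqr_sqrtr // ltW.
Qed.

End Vanishing.

Section EuclideanSpace.
Variables (R : realType) (n : nat).

Lemma sqn_dotmx (x : 'rV[R[i]]_n) : sqn (@dotmx _ n) x =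
  \sum_j (complex.Re (x 0 j) ^+ 2 + complex.Im (x 0 j) ^+ 2).
Proof.
rewrite /sqn /= dotmxE mxE raddf_sum; apply: eq_bigr => j _.
rewrite !mxE; case: (x 0 j) => a b /=; ring.
Qed.

Lemma dotmx_complete : sqn_complete (@dotmx R[i] n).
Proof.
apply/sqn_completeP => u cu.
have le1 m k j : (complex.Re (u m 0 j) - complex.Re (u k 0 j)) ^+ 2 +
    (complex.Im (u m 0 j) - complex.Im (u k 0 j)) ^+ 2 <=
    sqn (@dotmx _ n) (u m - u k).
  rewrite sqn_dotmx (bigD1 j) //= !mxE !raddfB /= lerDl sumr_ge0 // => i _.
  by rewrite addr_ge0 ?sqr_ge0.
have cRe j : exists l, vanishing (fun k => (complex.Re (u k 0 j) - l) ^+ 2).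
  apply: real_complete_sqr => e /cu[N HN]; exists N => m k h1 h2.
  by rewrite (le_lt_trans _ (HN _ _ h1 h2)) // (le_trans _ (le1 _ _ j)) // lerDl sqr_ge0.
have cIm j : exists l, vanishing (fun k => (complex.Im (u k 0 j) - l) ^+ 2).
  apply: real_complete_sqr => e /cu[N HN]; exists N => m k h1 h2.
  by rewrite (le_lt_trans _ (HN _ _ h1 h2)) // (le_trans _ (le1 _ _ j)) // lerDr sqr_ge0.
have [lR hR] := choice cRe; have [lI hI] := choice cIm.
exists (\row_j Complex (lR j) (lI j)).
have V : vanishing (fun k => \sum_(j <- index_enum 'I_n)
   \sum_(b <- [:: true; false]) if b then (complex.Re (u k 0 j) - lR j) ^+ 2
      else (complex.Im (u k 0 j) - lI j) ^+ 2).
  by apply: vanishing_sum => j; apply: vanishing_sum => -[].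
move=> e /V[N HN]; exists N => k /HN; congr (_ < _).
rewrite sqn_dotmx; apply: eq_bigr => j _.
by rewrite !big_cons big_nil addr0 !mxE !raddfB.
Qed.

(* C^n as row vectors; linear maps on it stand for elements of M_n(C). *)
Definition euclidean : hilbert R := Hilbert dotmx_complete.

End EuclideanSpace.

Section HilbertSum.
Variables (R : realType) (I : choiceType) (K : I -> hilbert R).

Definition square_summable (f : forall i, K i) := exists M : R,
  forall F : {fset I}, \sum_(i <- F) hnorm (f i) ^+ 2 <= M.

Record hsum := Hsum {
  hsum_fun :> forall i, K i;
  hsumP : square_summable hsum_fun }.

Lemma hsum_ext (f g : hsum) : (forall i, f i = g i) -> f = g.
Proof.
case: f g => [f fP] [g gP] /= fg.
have E : f = g by apply: functional_extensionality_dep.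
by subst g; congr Hsum; apply: Prop_irrelevance.
Qed.

Lemma hnorm_sqr (H : hilbert R) (x : H) : hnorm x ^+ 2 = sqn (@hdot R H) x.
Proof. by rewrite sqr_sqrtr // sqn_ge0. Qed.

Lemma square_summable0 : square_summable (fun=> 0).
Proof.
by exists 0 => F; rewrite big1 // => i _; rewrite hnorm_sqr sqn0.
Qed.

Lemma square_summableZD a (f g : hsum) :
  square_summable (fun i => a *: f i + g i).
Proof.
have [M HM] := hsumP f; have [N HN] := hsumP g.
pose c := complex.Re a ^+ 2 + complex.Im a ^+ 2.
have c0 : 0 <= c by rewrite addr_ge0 ?sqr_ge0.
exists (2 * (c * M + N)) => F.
apply: (@le_trans _ _ (2 * (c * (\sum_(i <- F) hnorm (f i) ^+ 2) +
                            \sum_(i <- F) hnorm (g i) ^+ 2))).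
  rewrite mulr_sumr -big_split mulr_sumr; apply: ler_sum => i _.
  by rewrite !hnorm_sqr (le_trans (sqnD_le _ _ _)) // sqnZ.
by rewrite ler_pM2l // lerD // ler_wpM2l.
Qed.

HB.instance Definition _ := gen_eqMixin hsum.
HB.instance Definition _ := gen_choiceMixin hsum.

Definition hsum0 := Hsum square_summable0.
Definition hsumZD a f g := Hsum (square_summableZD a f g).
Definition hsum_opp f := hsumZD (- 1) f hsum0.
Definition hsum_add f g := hsumZD 1 f g.
Definition hsum_scale a f := hsumZD a f hsum0.

Lemma hsum_addA : associative hsum_add.
Proof. by move=> f g h; apply: hsum_ext => i /=; rewrite !scale1r addrA. Qed.
Lemma hsum_addC : commutative hsum_add.
Proof. by move=> f g; apply: hsum_ext => i /=; rewrite !scale1r addrC. Qed.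
Lemma hsum_add0 : left_id hsum0 hsum_add.
Proof. by move=> f; apply: hsum_ext => i /=; rewrite scaler0 add0r. Qed.
Lemma hsum_addN : left_inverse hsum0 hsum_opp hsum_add.
Proof.
by move=> f; apply: hsum_ext => i /=; rewrite scale1r addr0 scaleN1r addNr.
Qed.
HB.instance Definition _ :=
  GRing.isZmodule.Build hsum hsum_addA hsum_addC hsum_add0 hsum_addN.

Lemma hsum_scaleA a b f : hsum_scale a (hsum_scale b f) = hsum_scale (a * b) f.
Proof. by apply: hsum_ext => i /=; rewrite !addr0 scalerA. Qed.
Lemma hsum_scale1 : left_id 1 hsum_scale.
Proof. by move=> f; apply: hsum_ext => i /=; rewrite scale1r addr0. Qed.
Lemma hsum_scaleDr : right_distributive hsum_scale +%R.
Proof.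
by move=> a f g; apply: hsum_ext => i /=; rewrite !addr0 !scale1r scalerDr.
Qed.
Lemma hsum_scaleDl f : {morph hsum_scale^~ f : a b / a + b}.
Proof.
by move=> a b; apply: hsum_ext => i /=; rewrite !addr0 !scale1r scalerDl.
Qed.
HB.instance Definition _ := GRing.Zmodule_isLmodule.Build R[i] hsum
  hsum_scaleA hsum_scale1 hsum_scaleDr hsum_scaleDl.

Lemma hsum_zeroE i : (0 : hsum) i = 0. Proof. by []. Qed.
Lemma hsum_addE (f g : hsum) i : (f + g) i = f i + g i.
Proof. by rewrite /= scale1r. Qed.
Lemma hsum_scaleE a (f : hsum) i : (a *: f) i = a *: f i.
Proof. by rewrite /= addr0. Qed.
Lemma hsum_oppE (f : hsum) i : (- f) i = - f i.
Proof. by rewrite /= addr0 scaleN1r. Qed.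

Definition hsum_dot (f g : hsum) : R[i] := usum (fun i => hdot (f i) (g i)).

Lemma hsum_sqn_usum (f : hsum) :
  exists s, is_usum (fun i => sqn (@hdot R (K i)) (f i)) s.
Proof.
have [M HM] := hsumP f; apply: (@bounded_is_usum _ _ _ M) => [i|F].
  exact: sqn_ge0.
by apply: le_trans (HM F); apply: ler_sum => i _; rewrite hnorm_sqr.
Qed.

Lemma hsum_dotP (f g : hsum) :
  is_usum (fun i => hdot (f i) (g i)) (hsum_dot f g).
Proof.
suff [s sP] : exists s, is_usum (fun i => hdot (f i) (g i)) s.
  by rewrite /hsum_dot (usumE sP).
have [s sP] := hsum_sqn_usum f; have [t tP] := hsum_sqn_usum g.
have [u uP] := hsum_sqn_usum (f + g).
have [v vP] := hsum_sqn_usum (f + 'i%C *: g).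
exists (Complex (2^-1 * (u + (- 1) * s + (- 1) * t))
                (2^-1 * (v + (- 1) * s + (- 1) * t))).
rewrite (_ : (fun _ => _) = fun i =>
    Complex (2^-1 * (sqn (@hdot R (K i)) ((f + g) i) +
                     (- 1) * sqn (@hdot R (K i)) (f i) +
                     (- 1) * sqn (@hdot R (K i)) (g i)))
            (2^-1 * (sqn (@hdot R (K i)) ((f + 'i%C *: g) i) +
                     (- 1) * sqn (@hdot R (K i)) (f i) +
                     (- 1) * sqn (@hdot R (K i)) (g i)))).
  by apply: is_usum_complex; apply: is_usumZ; do 2!
    [apply: is_usumD; last by [apply: is_usumZ]].
by apply: funext => i; rewrite dot_polar !hsum_addE hsum_scaleE !mulN1r.
Qed.

Lemma hsum_dot_bilinear : bilinear_for
  (GRing.Scale.Law.clone _ _ *%R _)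
  (GRing.Scale.Law.clone _ _ (Num.conj \; *%R) _) hsum_dot.
Proof.
split=> [h|h] a f g /=; apply: (is_usum_unique (hsum_dotP _ _)).
  rewrite (_ : (fun _ => _) = fun i =>
      a * hdot (f i) (h i) + hdot (g i) (h i)).
    by apply: is_usumD; [apply: is_usumZ|]; apply: hsum_dotP.
  by apply: funext => i; rewrite hsum_addE hsum_scaleE linearDl linearZl_LR.
rewrite (_ : (fun _ => _) = fun i =>
    Num.conj a * hdot (h i) (f i) + hdot (h i) (g i)).
  by apply: is_usumD; [apply: is_usumZ|]; apply: hsum_dotP.
by apply: funext => i; rewrite hsum_addE hsum_scaleE linearDr linearZr_LR.
Qed.
HB.instance Definition _ := bilinear_isBilinear.Build R[i] hsum hsum _ _ _
  hsum_dot hsum_dot_bilinear.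

Lemma hsum_dotC f g : hsum_dot f g = (-1) ^+ false * Num.conj (hsum_dot g f).
Proof.
rewrite expr0 mul1r; apply: (is_usum_unique (hsum_dotP _ _)).
rewrite (_ : (fun _ => _) = fun i => Num.conj (hdot (g i) (f i))).
  exact/is_usum_conj/hsum_dotP.
by apply: funext => i; rewrite hermC expr0 mul1r.
Qed.
HB.instance Definition _ := isHermitianSesquilinear.Build R[i] hsum
  false Num.conj hsum_dot hsum_dotC.

Lemma hsum_dot_gt0 f : f != 0 -> 0 < hsum_dot f f.
Proof.
move=> f0; have [s sP] := hsum_sqn_usum f.
have E : hsum_dot f f = s%:C%C.
  apply: (is_usum_unique (hsum_dotP _ _)).
  rewrite (_ : (fun _ => _) = fun i => (sqn (@hdot R (K i)) (f i))%:C%C).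
    exact: is_usum_real.
  by apply: funext => i; rewrite dot_sqn.
rewrite E ltcR; apply: contra_notT (elimN eqP f0); rewrite -leNgt => s0.
apply: hsum_ext => i; apply/eqP; rewrite -(sqn_eq0 (@hdot R (K i))).
rewrite eq_le sqn_ge0 andbT (le_trans _ s0) //.
have := ge0_is_usum (fun i => sqn_ge0 _ (f i)) sP (num_real _) [fset i]%fset.
by rewrite big_seq_fset1.
Qed.
HB.instance Definition _ := isDotProduct.Build R[i] hsum hsum_dot hsum_dot_gt0.

Lemma hsum_sqn (f : hsum) :
  is_usum (fun i => sqn (@hdot R (K i)) (f i)) (sqn hsum_dot f).
Proof.
have [s sP] := hsum_sqn_usum f; suff -> : sqn hsum_dot f = s by [].
apply: (@complexI R); rewrite -dot_sqn.
apply: (is_usum_unique (hsum_dotP _ _)).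
rewrite (_ : (fun _ => _) = fun i => (sqn (@hdot R (K i)) (f i))%:C%C).
  exact: is_usum_real.
by apply: funext => i; rewrite dot_sqn.
Qed.

Lemma hsum_sqn_ge (f : hsum) (F : {fset I}) :
  \sum_(i <- F) sqn (@hdot R (K i)) (f i) <= sqn hsum_dot f.
Proof.
exact: ge0_is_usum (fun i => sqn_ge0 _ (f i)) (hsum_sqn f) (num_real _) F.
Qed.

Lemma hsum_sqn_le (f : hsum) (M : R) :
  (forall F : {fset I}, \sum_(i <- F) sqn (@hdot R (K i)) (f i) <= M) ->
  sqn hsum_dot f <= M.
Proof.
move=> fM; rewrite leNgt -subr_gt0; apply/negP => /(hsum_sqn f)[F].
move=> /(_ _ (fsubset_refl F)); rewrite ltr_norml => /andP[_].
by rewrite ltrD2l ltrN2 ltNge fM.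
Qed.

Lemma hsum_complete : sqn_complete hsum_dot.
Proof.
apply/sqn_completeP => u cu.
have subE (f g : hsum) i : (f - g) i = f i - g i.
  by rewrite hsum_addE hsum_oppE.
have [l hl] : exists l : forall i, K i, forall i,
    vanishing (fun n => sqn (@hdot R (K i)) (u n i - l i)).
  suff h i : exists l : K i, vanishing (fun n => sqn (@hdot R (K i)) (u n i - l)).
    by exists (fun i => projT1 (cid (h i))) => i; case: (cid (h i)).
  apply: (sqn_completeP _).1 (@hilbert_complete R (K i)) _ _ => e /cu[N HN].
  exists N => m n h1 h2; apply: le_lt_trans (HN m n h1 h2).
  by have := hsum_sqn_ge (u m - u n) [fset i]%fset; rewrite big_seq_fset1 subE.
have key e : 0 < e -> exists N, forall n (F : {fset I}), (N <= n)%N ->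
    \sum_(i <- F) sqn (@hdot R (K i)) (u n i - l i) <= e.
  move=> e0; have e4 : 0 < e / 4 by rewrite divr_gt0.
  have [N HN] := cu _ e4; exists N => n F Nn.
  have V := @vanishing_sum R I F _ hl.
  have [M HM] := V _ e4; have := HM (maxn N M) (leq_maxr _ _).
  have := HN n (maxn N M) Nn (leq_maxl _ _).
  set m := maxn N M => h1 h2.
  have h3 := hsum_sqn_ge (u n - u m) F.
  apply: (@le_trans _ _ (2 *
    (\sum_(i <- F) sqn (@hdot R (K i)) ((u n - u m) i) +
     \sum_(i <- F) sqn (@hdot R (K i)) (u m i - l i)))).
    rewrite -big_split mulr_sumr; apply: ler_sum => i _.
    by rewrite subE (le_trans _ (sqnD_le _ _ _)) // addrA subrK.
  have -> : e = 2 * (e / 4 + e / 4) by field.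
  by rewrite ler_pM2l // lerD // ltW // (le_lt_trans h3).
have [N HN] := key 1 ltr01.
have dP : square_summable (fun i => u N i - l i).
  exists 1 => F; apply: le_trans (HN N F (leqnn _)).
  by apply: ler_sum => i _; rewrite hnorm_sqr.
exists (u N - Hsum dP) => e e0.
have e2 : 0 < e / 2 by rewrite divr_gt0.
have [M HM] := key _ e2; exists M => n Mn.
apply: (@le_lt_trans _ _ (e / 2)); last by rewrite ltr_pdivrMr // ltr_pMr // ltr1n.
apply: hsum_sqn_le => F; apply: le_trans (HM n F Mn).
by apply: ler_sum => i _; rewrite !subE /= subKr.
Qed.

Definition hilbert_sum : hilbert R := Hilbert hsum_complete.

End HilbertSum.

Section Operators.
Variable R : realType.
Implicit Types H K L E : hilbert R.

(* Elements of B(H, K) are plain functions satisfying [bounded_op]; sums and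
   scalar multiples of operators are those of functions, products are
   compositions. *)
Definition bounded_op H K (T : H -> K) : Prop :=
  linear T /\ exists M : R, forall x, hnorm (T x) <= M * hnorm x.

(* [adjoint T T'] says T' = T^*. *)
Definition adjoint H K (T : H -> K) (T' : K -> H) : Prop :=
  forall x y, hdot (T x) y = hdot x (T' y).

Definition opnorm H K (T : H -> K) : R :=
  sup [set hnorm (T x) | x in [set x | hnorm x <= 1]].

(* Norm of an n x n matrix of operators, acting on H^n = H (+) ... (+) H.
   [mxnorm_on G A] only tests vectors of G^n : it is the norm of A as an
   operator G^n -> K^n. *)
Definition mxapp H K n (A : 'M[H -> K]_n) (x : 'I_n -> H) : 'I_n -> K :=
  fun i => \sum_j A i j (x j).

Definition vnorm H n (x : 'I_n -> H) : R :=
  Num.sqrt (\sum_i hnorm (x i) ^+ 2).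

Definition mxnorm_on H K n (G : set H) (A : 'M[H -> K]_n) : R :=
  sup [set vnorm (mxapp A x) |
       x in [set x | (forall i, G (x i)) /\ vnorm x <= 1]].

Definition mxnorm H K n (A : 'M[H -> K]_n) : R := mxnorm_on setT A.

Definition entries_in H n (S : set (H -> H)) (A : 'M[H -> H]_n) : Prop :=
  forall i j, S (A i j).

(* phi, defined on S, takes values in the operators from G to K. *)
Definition completely_isometric_on H K (S : set (H -> H)) (G : set K)
    (phi : (H -> H) -> (K -> K)) : Prop :=
  forall n (A : 'M[H -> H]_n), entries_in S A ->
    mxnorm_on G (map_mx phi A) = mxnorm A.

Definition completely_isometric H K (S : set (H -> H))
    (phi : (H -> H) -> (K -> K)) : Prop :=
  completely_isometric_on S setT phi.

Definition op_subspace H (S : set (H -> H)) : Prop :=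
  [/\ forall s, S s -> bounded_op s,
      S 0 &
      forall (c : R[i]) s t, S s -> S t -> S (c *: s + t)].

Definition adjoint_closed H (S : set (H -> H)) : Prop :=
  forall s, S s -> exists2 s', S s' & adjoint s s'.

Definition operator_system H (S : set (H -> H)) : Prop :=
  [/\ op_subspace S, adjoint_closed S & S idfun].

Definition norm_separable H (S : set (H -> H)) : Prop :=
  exists D : set (H -> H), [/\ countable D, D `<=` S &
    forall s (e : R), S s -> 0 < e -> exists2 d, D d & opnorm (s - d) < e].

Definition norm_closed H (A : set (H -> H)) : Prop :=
  forall T, bounded_op T ->
    (forall e : R, 0 < e -> exists2 a, A a & opnorm (T - a) < e) -> A T.

Definition cstar_subalgebra H (A : set (H -> H)) : Prop :=
  [/\ op_subspace A,
      forall a b, A a -> A b -> A (a \o b),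
      adjoint_closed A &
      norm_closed A].

Definition cstar H (S : set (H -> H)) : set (H -> H) :=
  [set T | forall A, cstar_subalgebra A -> S `<=` A -> A T].

Definition representation H K (A : set (H -> H))
    (pi : (H -> H) -> (K -> K)) : Prop :=
  [/\ forall a, A a -> bounded_op (pi a),
      forall (c : R[i]) a b, A a -> A b -> pi (c *: a + b) = c *: pi a + pi b,
      forall a b, A a -> A b -> pi (a \o b) = pi a \o pi b,
      forall a b, A a -> A b -> adjoint a b -> adjoint (pi a) (pi b) &
      pi idfun = idfun].

Definition unital_star_hom H K (A : set (H -> H)) (B : set (K -> K))
    (rho : (H -> H) -> (K -> K)) : Prop :=
  representation A rho /\ forall a, A a -> B (rho a).

Definition closed_subspace H (G : set H) : Prop :=
  [/\ G 0,
      forall (c : R[i]) x y, G x -> G y -> G (c *: x + y) &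
      forall x, (forall e : R, 0 < e -> exists2 y, G y & hnorm (x - y) < e) ->
        G x].

Definition invariant H (S : set (H -> H)) (G : set H) : Prop :=
  forall s x, S s -> G x -> G (s x).

Definition orthocomplement H (G : set H) : set H :=
  [set x | forall y, G y -> hdot x y = 0].

Definition reducing H (S : set (H -> H)) (G : set H) : Prop :=
  invariant S G /\ invariant S (orthocomplement G).

Definition orthogonal_projection H (G : set H) (P : H -> H) : Prop :=
  forall x, G (P x) /\ orthocomplement G (x - P x).

Definition irreducible_rep H K (A : set (H -> H))
    (pi : (H -> H) -> (K -> K)) : Prop :=
  [/\ representation A pi,
      exists x : K, x <> 0 &
      forall G : set K, closed_subspace G -> invariant [set pi a | a in A] G ->
        G = [set 0] \/ G = setT].

Definition unitary H K (U : H -> K) : Prop :=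
  [/\ linear U, bijective U & forall x y, hdot (U x) (U y) = hdot x y].

Definition unitarily_equivalent H K L (A : set (H -> H))
    (pi : (H -> H) -> (K -> K)) (sigma : (H -> H) -> (L -> L)) : Prop :=
  exists2 U : K -> L, unitary U & forall a, A a -> U \o pi a = sigma a \o U.

(* The value 0 is only taken when the T i are not uniformly bounded; for a
   family of representations the first branch always applies. *)
Definition direct_sum_op (I : choiceType) (K : I -> hilbert R)
    (T : forall i, K i -> K i) : hilbert_sum K -> hilbert_sum K :=
  fun f => if pselect (square_summable (fun i => T i (f i))) is left h
           then Hsum h else 0.

Definition direct_sum_rep H (I : choiceType) (K : I -> hilbert R)
    (pi : forall i, (H -> H) -> (K i -> K i)) :
    (H -> H) -> (hilbert_sum K -> hilbert_sum K) :=
  fun a => direct_sum_op (fun i => pi i a).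

Definition compression_completely_isometric H (S : set (H -> H)) (G : set H) :=
  exists2 P : H -> H, orthogonal_projection G P &
    completely_isometric_on S G (fun s => P \o s).

Definition fully_compressed H (S : set (H -> H)) : Prop :=
  forall G : set H, closed_subspace G -> G <> setT ->
    ~ compression_completely_isometric S G.

Definition minimal H (S : set (H -> H)) : Prop :=
  forall G : set H, closed_subspace G -> G <> setT -> reducing S G ->
    ~ compression_completely_isometric S G.

(* Recall that [sup set0 = 0]; the set below is bounded since representations
   are contractive. *)
Definition strongly_peaking H K (S : set (H -> H))
    (pi : (H -> H) -> (K -> K)) : Prop :=
  irreducible_rep (cstar S) pi /\
  exists n (A : 'M[H -> H]_n), entries_in S A /\
    sup [set r | exists (L : hilbert R) (sigma : (H -> H) -> (L -> L)),
           [/\ irreducible_rep (cstar S) sigma,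
               ~ unitarily_equivalent (cstar S) sigma pi &
               r = mxnorm (map_mx sigma A)]]
      < mxnorm (map_mx pi A).

(* C*-algebras are taken represented on Hilbert spaces: the cover (A, j) is
   encoded by j : S -> B(K), with A = cstar (j @` S) inside B(K). *)
Definition cstar_cover H K (S : set (H -> H))
    (j : (H -> H) -> (K -> K)) : Prop :=
  [/\ forall s, S s -> bounded_op (j s),
      forall (c : R[i]) s t, S s -> S t -> j (c *: s + t) = c *: j s + j t,
      j idfun = idfun &
      completely_isometric S j].

Definition cstar_envelope H E (S : set (H -> H))
    (iota : (H -> H) -> (E -> E)) : Prop :=
  cstar_cover S iota /\
  forall K (j : (H -> H) -> (K -> K)), cstar_cover S j ->
    exists2 rho : (K -> K) -> (E -> E),
      unital_star_hom (cstar (j @` S)) (cstar (iota @` S)) rho &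
      forall s, S s -> rho (j s) = iota s.

(* C*(S) = C*_e(S): for any C*-envelope, the canonical *-homomorphism from
   C*(S) onto it is an isomorphism. *)
Definition cstar_is_envelope H (S : set (H -> H)) : Prop :=
  forall E (iota : (H -> H) -> (E -> E)), cstar_envelope S iota ->
    exists rho : (H -> H) -> (E -> E),
      [/\ unital_star_hom (cstar S) (cstar (iota @` S)) rho,
          forall s, S s -> rho s = iota s &
          set_bij (cstar S) (cstar (iota @` S)) rho].

End Operators.

(* Main.v *)
Require Import Defs.
From HB Require Import structures.
From mathcomp Require Import all_boot all_order all_algebra.
From mathcomp Require Import finmap complex.
From mathcomp Require Import all_classical all_reals.
From mathcomp Require Import interval_inference topology normedtype sequences.
From mathcomp Require Import ring lra.
Set Implicit Arguments.
Unset Strict Implicit.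
Unset Printing Implicit Defensive.
Import Order.TTheory GRing.Theory Num.Theory.
Import numFieldNormedType.Exports.
Local Open Scope classical_set_scope.
Local Open Scope ring_scope.

(** Idea.  Write p_i for the i-th block of H and call T in M_k(S) peaking at i
    if |psi_j T| <= r < |psi_i T| for all j <> i.

    (1) => (2) is the compression to the reducing subspace ker p_i, and if the
    blocks j <> i do not suffice to norm S, some T peaks at i.  A cluster point
    of the powers of T^* T / |psi_i T|^2 is then a nonzero element of the ideal
    J_i of those a in C*(S) with psi_j a = 0 for j <> i, and since psi_i is
    irreducible, psi_i (J_i) is the full matrix algebra.  An irreducible
    representation not killing J_i is equivalent to psi_i, and one killing J_i
    satisfies |sigma T| <= r; this gives (3).

    (3) => (4): if the compression to G is completely isometric, then for every
    T peaking at i compactness yields a norm attaining vector of psi_i T with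
    all components in G.  Replacing T by the adjoint of the column (T, e s_1,
    ..., e s_q), where psi_i (s_1), ..., psi_i (s_q) span psi_i (S) and e is
    small, strictly increases the minimal dimension of the span of the
    components of a norm attaining vector, by irreducibility, as long as that
    span is not the whole block.  Hence G contains every block.

    For the C*-envelope, the canonical map cannot kill any J_i, because it is
    completely isometric on S; so it is isometric on each block, hence
    isometric with closed range. *)

(** * Norms and inner products *)

(** In the last implication G is not assumed invariant, so no element of S can be used to move
    vectors inside G: only vectors at which a matrix over S attains its norm are forced into G. A
    matrix has to be built whose attaining vectors span the block. The adjoint of a column X does
    this because, if w attains its norm, then x = X^* w attains that of X and X x is a nonzero
    multiple of w; so the components of w span those of X x, which are, up to the factor e, the
    psi_i (s_k) x_j. The identity is added to the s_k so that the x_j occur as well. If the span did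
    not grow, those of x and w would coincide and be invariant.

    The other obstacle is that the blocks may be infinite in number. Compactness is available on one
    block only, so on all the others the estimates must be uniform; they rest on the single bound r
    and on the contractivity of representations.

    Functional calculus is avoided: a Neumann series gives contractivity, and powers take the place
    of continuous functions of T^* T. Since columns are rectangular, matrices are indexed by finite
    types and padded with zeros when square ones are required. *)

Section HilbertNorm.
Variable R : realType.
Implicit Types (H K L : hilbert R) (a : R[i]).

(** The norm of [R[i]] takes its values in [R[i]]; this is the same modulus as an element of [R],
    comparable with [hnorm]. *)
Definition cabs a : R := Num.sqrt (complex.Re a ^+ 2 + complex.Im a ^+ 2).

Lemma cabs_ge0 a : 0 <= cabs a. Proof. exact: sqrtr_ge0. Qed.

Lemma normc_cabs a : `|a| = (cabs a)%:C%C. Proof. exact: normc_def. Qed.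

Lemma cabsD a b : cabs (a + b) <= cabs a + cabs b.
Proof. by have := ler_normD a b; rewrite !normc_cabs -rmorphD lecR. Qed.

Lemma cabs_conj a : cabs (Num.conj a) = cabs a.
Proof. by have := norm_conjC a; rewrite !normc_cabs => /complexI. Qed.

Lemma cabs0 : cabs 0 = 0.
Proof. by rewrite /cabs /= !expr0n addr0 sqrtr0. Qed.

Lemma cabs_real (r : R) : cabs (r%:C)%C = `|r|.
Proof. by rewrite /cabs /= expr0n addr0 sqrtr_sqr. Qed.

Lemma cabs_eq0 a : (cabs a == 0) = (a == 0).
Proof.
by rewrite -[in RHS]normr_eq0 normc_cabs -(inj_eq (@complexI R)) rmorph0.
Qed.

Lemma Re_le_cabs a : `|complex.Re a| <= cabs a.
Proof. by rewrite -sqrtr_sqr ler_wsqrtr // lerDl sqr_ge0. Qed.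

Lemma Im_le_cabs a : `|complex.Im a| <= cabs a.
Proof. by rewrite -sqrtr_sqr ler_wsqrtr // lerDr sqr_ge0. Qed.

Lemma cabs_le a : cabs a <= `|complex.Re a| + `|complex.Im a|.
Proof.
rewrite -[leRHS]ger0_norm ?addr_ge0 // -sqrtr_sqr ler_wsqrtr //.
rewrite sqrrD !real_normK ?num_real // -addrA lerD2l lerDr.
by rewrite mulrn_wge0 // mulr_ge0.
Qed.

Section OneSpace.
Variable H : hilbert R.
Implicit Types x y z : H.

Lemma hnorm_ge0 x : 0 <= hnorm x. Proof. exact: sqrtr_ge0. Qed.

Lemma hnorm_eq0 x : (hnorm x == 0) = (x == 0).
Proof. by rewrite sqrtr_eq0 -(sqn_eq0 (@hdot R H)) eq_le sqn_ge0 andbT. Qed.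

Lemma hnorm0 : hnorm (0 : H) = 0.
Proof. by apply/eqP; rewrite hnorm_eq0. Qed.

Lemma hnorm_gt0 x : (0 < hnorm x) = (x != 0).
Proof. by rewrite lt_def hnorm_eq0 hnorm_ge0 andbT. Qed.

Lemma hnorm_scale a x : hnorm (a *: x) = cabs a * hnorm x.
Proof. by rewrite /hnorm sqnZ sqrtrM // addr_ge0 ?sqr_ge0. Qed.

Lemma hnorm_opp x : hnorm (- x) = hnorm x.
Proof. by rewrite /hnorm sqnN. Qed.

Lemma hnormBC x y : hnorm (x - y) = hnorm (y - x).
Proof. by rewrite -hnorm_opp opprB. Qed.

Lemma hdotC x y : hdot x y = Num.conj (hdot y x).
Proof. by rewrite hermC expr0 mul1r. Qed.

Lemma hdot0l x : hdot 0 x = 0. Proof. exact: linear0l. Qed.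
Lemma hdot0r x : hdot x 0 = 0. Proof. exact: linear0r. Qed.
Lemma hdotDl x y z : hdot (x + y) z = hdot x z + hdot y z.
Proof. exact: linearDl. Qed.
Lemma hdotDr x y z : hdot x (y + z) = hdot x y + hdot x z.
Proof. exact: linearDr. Qed.
Lemma hdotZl a x y : hdot (a *: x) y = a * hdot x y.
Proof. exact: linearZl_LR. Qed.
Lemma hdotZr a x y : hdot x (a *: y) = Num.conj a * hdot x y.
Proof. exact: linearZr_LR. Qed.
Lemma hdotNl x y : hdot (- x) y = - hdot x y.
Proof. by rewrite -scaleN1r hdotZl mulN1r. Qed.
Lemma hdotNr x y : hdot x (- y) = - hdot x y.
Proof. by rewrite hdotC hdotNl [hdot x y in RHS]hdotC; exact: rmorphN. Qed.
Lemma hdotBl x y z : hdot (x - y) z = hdot x z - hdot y z.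
Proof. by rewrite hdotDl hdotNl. Qed.
Lemma hdotBr x y z : hdot x (y - z) = hdot x y - hdot x z.
Proof. by rewrite hdotDr hdotNr. Qed.
Lemma hdot_suml (I : Type) (r : seq I) (P : pred I) (f : I -> H) y :
  hdot (\sum_(i <- r | P i) f i) y = \sum_(i <- r | P i) hdot (f i) y.
Proof.
by apply: (big_morph (fun z => hdot z y)) => [u v|]; rewrite ?hdotDl ?hdot0l.
Qed.
Lemma hdot_sumr (I : Type) (r : seq I) (P : pred I) (f : I -> H) y :
  hdot y (\sum_(i <- r | P i) f i) = \sum_(i <- r | P i) hdot y (f i).
Proof.
by apply: (big_morph (hdot y)) => [u v|]; rewrite ?hdotDr ?hdot0r.
Qed.

Lemma hdotxx x : hdot x x = ((hnorm x ^+ 2)%:C)%C.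
Proof. by rewrite dot_sqn hnorm_sqr. Qed.

Lemma hdot_eq0 x : (hdot x x == 0) = (x == 0).
Proof. by rewrite dnorm_eq0. Qed.

Lemma hnormD_sqr x y :
  hnorm (x + y) ^+ 2 = hnorm x ^+ 2 + hnorm y ^+ 2 + 2 * complex.Re (hdot x y).
Proof. by rewrite !hnorm_sqr sqnD. Qed.

Lemma Re_hdot_le x y : complex.Re (hdot x y) <= hnorm x * hnorm y.
Proof.
have [->|x0] := eqVneq x 0.
  by rewrite hdot0l mulr_ge0 ?hnorm_ge0.
have [->|y0] := eqVneq y 0.
  by rewrite hdot0r mulr_ge0 ?hnorm_ge0.
have s0 : 0 < hnorm x by rewrite hnorm_gt0.
have t0 : 0 < hnorm y by rewrite hnorm_gt0.
have := sqr_ge0 (hnorm (((hnorm y)%:C)%C *: x - ((hnorm x)%:C)%C *: y)).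
rewrite hnormD_sqr hnorm_opp !hnorm_scale !cabs_real !(ger0_norm (hnorm_ge0 _)).
rewrite hdotNr hdotZl hdotZr /=.
case: (hdot x y) => p q /=; move: (hnorm x) (hnorm y) s0 t0 => s t s0 t0.
rewrite [X in 0 <= X -> _](_ : _ = (2 * (t * s)) * (s * t - p)); last by ring.
by rewrite pmulr_rge0 ?mulr_gt0 // subr_ge0.
Qed.

Lemma cabs_hdot_le x y : cabs (hdot x y) <= hnorm x * hnorm y.
Proof.
have [e0|e0] := eqVneq (hdot x y) 0.
  by rewrite e0 cabs0 mulr_ge0 ?hnorm_ge0.
have c0 : 0 < cabs (hdot x y) by rewrite lt_def cabs_eq0 e0 cabs_ge0.
(* Multiplying x by the conjugate of <x, y> turns the inner product into |<x, y>|^2, which equals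
   its own real part. *)
have := Re_hdot_le (Num.conj (hdot x y) *: x) y.
rewrite hnorm_scale cabs_conj hdotZl => h.
rewrite -(ler_pM2l c0) mulrA; apply: le_trans h.
rewrite -expr2 sqr_sqrtr ?addr_ge0 ?sqr_ge0 // le_eqVlt.
by case: (hdot x y) => p q /=; rewrite (_ : _ - _ = p ^+ 2 + q ^+ 2) ?eqxx //; ring.
Qed.

Lemma hnorm_triangle x y : hnorm (x + y) <= hnorm x + hnorm y.
Proof.
rewrite -(ler_pXn2r (n := 2)) ?nnegrE ?addr_ge0 ?hnorm_ge0 // hnormD_sqr sqrrD.
have := Re_hdot_le x y; lra.
Qed.

Lemma hnormB_le x y : hnorm x <= hnorm y + hnorm (x - y).
Proof. by rewrite -{1}(subrK y x) addrC hnorm_triangle. Qed.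

Lemma hnorm_sum (I : Type) (r : seq I) (P : pred I) (f : I -> H) :
  hnorm (\sum_(i <- r | P i) f i) <= \sum_(i <- r | P i) hnorm (f i).
Proof.
elim/big_rec2: _ => [|i s t _ h]; first by rewrite hnorm0.
by rewrite (le_trans (hnorm_triangle _ _)) // lerD2l.
Qed.

End OneSpace.
End HilbertNorm.

(** * Bounded operators and adjoints *)

Section OperatorNorm.
Variable R : realType.
Implicit Types (H K L : hilbert R) (a : R[i]).

Section Linear.
Variables (H K : hilbert R) (T : H -> K).
Hypothesis T_lin : linear T.

Lemma lin_op0 : T 0 = 0.
Proof. by have := T_lin (-1) 0 0; rewrite scaler0 addr0 scaleN1r addNr. Qed.
Lemma lin_opZ a x : T (a *: x) = a *: T x.
Proof. by have := T_lin a x 0; rewrite lin_op0 !addr0. Qed.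
Lemma lin_opD x y : T (x + y) = T x + T y.
Proof. by have := T_lin 1 x y; rewrite !scale1r. Qed.
Lemma lin_opN x : T (- x) = - T x.
Proof. by rewrite -scaleN1r lin_opZ scaleN1r. Qed.
Lemma lin_opB x y : T (x - y) = T x - T y.
Proof. by rewrite lin_opD lin_opN. Qed.
Lemma lin_op_sum (I : Type) (r : seq I) (P : pred I) (f : I -> H) :
  T (\sum_(i <- r | P i) f i) = \sum_(i <- r | P i) T (f i).
Proof. by apply: (big_morph T) => [u v|]; rewrite ?lin_opD ?lin_op0. Qed.
End Linear.

(** Most estimates use this predicate and not [opnorm]: it needs no prior boundedness and passes
    directly to blocks and matrices. *)
Definition opbd H K (T : H -> K) (c : R) := forall x, hnorm (T x) <= c * hnorm x.

Lemma opbdW H K (T : H -> K) c d : c <= d -> opbd T c -> opbd T d.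
Proof.
by move=> cd Tc x; apply: le_trans (Tc x) _; rewrite ler_wpM2r ?hnorm_ge0.
Qed.

Lemma bounded_opP H K (T : H -> K) :
  bounded_op T <-> linear T /\ exists2 c, 0 <= c & opbd T c.
Proof.
split=> [[lT [M HM]]|[lT [c _ Tc]]]; split=> //; last by exists c.
exists (Num.max 0 M); first by rewrite le_max lexx.
by apply: opbdW HM; rewrite le_max lexx orbT.
Qed.

Section NormOn.
Variables (H K : hilbert R) (G : set H) (T : H -> K).
Hypotheses (G0 : G 0) (GZ : forall a x, G x -> G (a *: x)) (T_lin : linear T).

(** Common form of [opnorm], where [G] is everything, and of [mxnorm_on], where [H] is a finite
    power. *)
Definition opnorm_on := sup [set hnorm (T x) | x in [set x | G x /\ hnorm x <= 1]].

Lemma opnorm_on_le c : 0 <= c -> (forall x, G x -> hnorm (T x) <= c * hnorm x) ->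
  opnorm_on <= c.
Proof.
move=> c0 Tc; apply: sup_le_ub.
  by exists (hnorm (T 0)), 0; rewrite //= hnorm0.
move=> _ [x [Gx x1] <-]; apply: le_trans (Tc x Gx) _.
by rewrite -[leRHS]mulr1 ler_wpM2l.
Qed.

Lemma opnorm_on_bd c x : 0 <= c -> (forall x, G x -> hnorm (T x) <= c * hnorm x) ->
  G x -> hnorm (T x) <= opnorm_on * hnorm x.
Proof.
move=> c0 Tc Gx; have [->|x0] := eqVneq x 0.
  by rewrite lin_op0 // !hnorm0 mulr0.
have n0 : 0 < hnorm x by rewrite hnorm_gt0.
rewrite -ler_pdivrMr //.
pose r := (((hnorm x)^-1)%:C)%C.
have E : hnorm (T (r *: x)) = hnorm (T x) / hnorm x.
  by rewrite lin_opZ // hnorm_scale cabs_real ger0_norm ?invr_ge0 ?hnorm_ge0 // mulrC.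
rewrite -E; apply: sup_upper_bound; last first.
  exists (r *: x) => //; split; first exact: GZ.
  rewrite hnorm_scale cabs_real ger0_norm ?invr_ge0 ?hnorm_ge0 //.
  by rewrite mulVf // gt_eqF.
split; first by exists (hnorm (T 0)), 0; rewrite //= hnorm0.
exists c => _ [y [Gy y1] <-]; apply: le_trans (Tc y Gy) _.
by rewrite -[leRHS]mulr1 ler_wpM2l.
Qed.

Lemma opnorm_on_ge0 c : 0 <= c -> (forall x, G x -> hnorm (T x) <= c * hnorm x) ->
  0 <= opnorm_on.
Proof.
move=> c0 Tc; rewrite -(hnorm0 K) -(lin_op0 T_lin).
apply: sup_upper_bound; last by exists 0; rewrite //= hnorm0.
split; first by exists (hnorm (T 0)), 0; rewrite //= hnorm0.
exists c => _ [y [Gy y1] <-]; apply: le_trans (Tc y Gy) _.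
by rewrite -[leRHS]mulr1 ler_wpM2l.
Qed.

End NormOn.

Lemma opnormE H K (T : H -> K) : opnorm T = opnorm_on setT T.
Proof.
congr sup; apply/seteqP; split=> [_ [x x1 <-]|_ [x [_ x1] <-]]; by exists x.
Qed.

Lemma opnorm_le H K (T : H -> K) c : 0 <= c -> opbd T c -> opnorm T <= c.
Proof. by move=> c0 Tc; rewrite opnormE; apply: opnorm_on_le => // x _; apply: Tc. Qed.

Lemma opnorm_bd H K (T : H -> K) : bounded_op T -> opbd T (opnorm T).
Proof.
move=> /bounded_opP[lT [c c0 Tc]] x; rewrite opnormE.
by apply: (@opnorm_on_bd _ _ _ _ _ _ _ c) => // y _; apply: Tc.
Qed.

Lemma opnorm_ge0 H K (T : H -> K) : bounded_op T -> 0 <= opnorm T.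
Proof.
move=> /bounded_opP[lT [c c0 Tc]]; rewrite opnormE.
by apply: (@opnorm_on_ge0 _ _ _ _ _ _ c) => // y _; apply: Tc.
Qed.

Lemma bounded_op_lincomb H K (T U : H -> K) a :
  bounded_op T -> bounded_op U -> bounded_op (a *: T + U).
Proof.
move=> /bounded_opP[lT [c c0 Tc]] /bounded_opP[lU [d d0 Ud]].
apply/bounded_opP; split=> [b x y|].
  rewrite !fctE lT lU !scalerDr !scalerA mulrC !addrA; congr (_ + _).
  by rewrite -!addrA; congr (_ + _); rewrite addrC.
exists (cabs a * c + d); first by rewrite addr_ge0 ?mulr_ge0 ?cabs_ge0.
move=> x; rewrite fctE (le_trans (hnorm_triangle _ _)) // mulrDl lerD ?Ud //.
by rewrite hnorm_scale -mulrA ler_wpM2l ?cabs_ge0.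
Qed.

Lemma bounded_opB H K (T U : H -> K) :
  bounded_op T -> bounded_op U -> bounded_op (T - U).
Proof.
move=> bT bU; rewrite -scaleN1r addrC; exact: bounded_op_lincomb.
Qed.

Lemma bounded_op_comp H K L (T : K -> L) (U : H -> K) :
  bounded_op T -> bounded_op U -> bounded_op (T \o U).
Proof.
move=> /bounded_opP[lT [c c0 Tc]] /bounded_opP[lU [d d0 Ud]].
apply/bounded_opP; split=> [b x y|]; first by rewrite /= lU lT.
exists (c * d); first exact: mulr_ge0.
by move=> x /=; rewrite (le_trans (Tc _)) // -mulrA ler_wpM2l.
Qed.

Lemma bounded_op0 H K : bounded_op (0 : H -> K).
Proof.
by split=> [a x y|]; [rewrite scaler0 addr0 | exists 0 => x; rewrite hnorm0 mul0r].
Qed.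

Lemma hdot_inj H (x y : H) : (forall z, hdot x z = hdot y z) -> x = y.
Proof.
move=> xy; apply/eqP; rewrite -subr_eq0 -hdot_eq0 hdotBl xy subrr //.
Qed.

Lemma adjoint_sym H K (T : H -> K) T' : adjoint T T' -> adjoint T' T.
Proof. by move=> h x y; rewrite hdotC -h -hdotC. Qed.

Lemma adjoint_uniq H K (T : H -> K) T1 T2 :
  adjoint T T1 -> adjoint T T2 -> T1 = T2.
Proof.
move=> h1 h2; apply: funext => y; apply: hdot_inj => z.
by rewrite (adjoint_sym h1) (adjoint_sym h2).
Qed.

Lemma adjoint_linear H K (T : H -> K) T' : adjoint T T' -> linear T'.
Proof.
move=> /adjoint_sym h a x y; apply: hdot_inj => z.
by rewrite h !hdotDl !hdotZl !h.
Qed.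

Lemma opbd_sqr H K (T : H -> K) c : 0 <= c ->
  opbd T c <-> forall x, hnorm (T x) ^+ 2 <= c ^+ 2 * hnorm x ^+ 2.
Proof.
move=> c0; split=> h x; have := h x; rewrite -exprMn.
  by rewrite ler_pXn2r // nnegrE ?mulr_ge0 ?hnorm_ge0.
by rewrite ler_pXn2r // nnegrE ?mulr_ge0 ?hnorm_ge0.
Qed.

(** From |T' y|^2 = <T (T' y), y> <= c |T' y| |y|. *)
Lemma adjoint_bd H K (T : H -> K) T' c : 0 <= c -> adjoint T T' ->
  opbd T c -> opbd T' c.
Proof.
move=> c0 h Tc y; have [->|n0] := eqVneq (hnorm (T' y)) 0.
  by rewrite mulr_ge0 ?hnorm_ge0.
have n1 : 0 < hnorm (T' y) by rewrite lt_def n0 hnorm_ge0.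
rewrite -(ler_pM2l n1) -expr2.
have := Re_hdot_le (T (T' y)) y; rewrite h hdotxx /= => h1.
apply: le_trans h1 _; rewrite mulrCA mulrA ler_wpM2r ?hnorm_ge0 //.
Qed.

Lemma adjoint_lincomb H K (T U : H -> K) T' U' a : adjoint T T' -> adjoint U U' ->
  adjoint (a *: T + U) (Num.conj a *: T' + U').
Proof.
move=> h1 h2 x y; rewrite !fctE hdotDl hdotZl h1 h2 hdotDr hdotZr conjCK.
by [].
Qed.

Lemma adjoint_comp H K L (T : K -> L) (U : H -> K) T' U' :
  adjoint T T' -> adjoint U U' -> adjoint (T \o U) (U' \o T').
Proof. by move=> h1 h2 x y /=; rewrite h1 h2. Qed.

Lemma adjoint0 H K : adjoint (0 : H -> K) 0.
Proof. by move=> x y; rewrite hdot0l hdot0r. Qed.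

Lemma le_of_le_add (x y : R) : (forall e, 0 < e -> x <= y + e) -> x <= y.
Proof. by move=> h; apply/ler_addgt0Pr. Qed.

Lemma hnorm_le0_eq H (x : H) (c : R) : 0 <= c ->
  (forall e, 0 < e -> hnorm x <= c * e) -> x = 0.
Proof.
move=> c0 h; apply/eqP; rewrite -hnorm_eq0 eq_le hnorm_ge0 andbT.
apply: le_of_le_add => e e0; rewrite add0r.
have c1 : 0 < c + 1 by rewrite ltr_wpDl.
apply: le_trans (h (e / (c + 1)) _) _; first exact: divr_gt0.
by rewrite mulrCA ger_pMr // ler_pdivrMr // mul1r lerDl.
Qed.

(** Limits exist pointwise; letting one index grow in the Cauchy bound makes the convergence
    uniform, and the limit inherits linearity and boundedness from nearby terms. *)
Lemma op_complete H K (u : nat -> H -> K) :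
  (forall k, bounded_op (u k)) ->
  (forall e, 0 < e -> exists N, forall m n, (N <= m)%N -> (N <= n)%N ->
     opbd (u m - u n) e) ->
  exists2 T : H -> K, bounded_op T &
    forall e, 0 < e -> exists N, forall n, (N <= n)%N -> opbd (u n - T) e.
Proof.
move=> ub uc.
have lim x : exists l, forall e, 0 < e -> exists N, forall n, (N <= n)%N ->
    hnorm (u n x - l) < e.
  apply: (@hilbert_complete R K) => e e0.
  have x1 : 0 < hnorm x + 1 by rewrite ltr_wpDl ?hnorm_ge0.
  have [N HN] := uc _ (divr_gt0 e0 x1); exists N => m n h1 h2.
  apply: le_lt_trans (HN m n h1 h2 x) _.
  by rewrite -mulrA gtr_pMr // mulrC ltr_pdivrMr // mul1r ltrDl.
have [T HT] := choice lim.
have Td e : 0 < e -> exists N, forall n, (N <= n)%N -> opbd (u n - T) e.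
  move=> e0; have [N HN] := uc e e0; exists N => n Nn x.
  apply: le_of_le_add => d d0; have [M HM] := HT x d d0.
  have := HN n (maxn N M) Nn (leq_maxl _ _) x.
  have := HM (maxn N M) (leq_maxr _ _).
  set m := maxn N M; rewrite !fctE => h1 h2.
  rewrite -(subrKA (u m x)) (le_trans (hnorm_triangle _ _)) // lerD // ltW //.
exists T => //.
have lT : linear T.
  move=> a x y; apply/eqP; rewrite -subr_eq0; apply/eqP.
  apply: (@hnorm_le0_eq _ _ (hnorm (a *: x + y) + (cabs a * hnorm x + hnorm y))).
    by rewrite !addr_ge0 ?mulr_ge0 ?cabs_ge0 ?hnorm_ge0.
  move=> e e0; have [N HN] := Td e e0; have {}HN := HN N (leqnn N).
  have lu := (ub N).1.
  rewrite (_ : _ - _ = - (u N - T) (a *: x + y) +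
     (a *: (u N - T) x + (u N - T) y)); last first.
    rewrite !fctE lu scalerBr opprB (addrACA (a *: u N x)) -opprD addrA subrK.
    by [].
  rewrite (le_trans (hnorm_triangle _ _)) // hnorm_opp mulrDl lerD //.
    by rewrite mulrC.
  rewrite (le_trans (hnorm_triangle _ _)) // mulrDl lerD //.
    by rewrite hnorm_scale -mulrA ler_wpM2l ?cabs_ge0 // mulrC.
  by rewrite mulrC.
split=> //; have [N HN] := Td 1 ltr01.
have /bounded_opP[_ [c c0 uN]] := ub N.
exists (c + 1) => x; have := HN N (leqnn N) x; rewrite mul1r => h.
rewrite (le_trans (hnormB_le _ (u N x))) // mulrDl mul1r lerD //.
by rewrite hnormBC.
Qed.

End OperatorNorm.

(** * C*-subalgebras of B(H) and their representations *)

Section CstarAlgebra.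
Variable R : realType.
Implicit Types (H K L : hilbert R).

Lemma expr_small (q e : R) : 0 <= q -> q < 1 -> 0 < e ->
  exists N, forall n, (N <= n)%N -> q ^+ n < e.
Proof.
move=> q0 q1 e0; have /cvgrPdist_lt/(_ e e0)[N _ HN] : (q ^+ k)@[k --> \oo] --> (0 : R).
  by apply: cvg_expr; rewrite ger0_norm.
exists N => n /HN /=; rewrite sub0r normrN ger0_norm // exprn_ge0 //.
Qed.

Lemma natSinv_gt0 (k : nat) : 0 < k.+1%:R^-1 :> R.
Proof. by rewrite invr_gt0. Qed.

Lemma natSinv_small (e : R) : 0 < e ->
  exists N, forall n, (N <= n)%N -> n.+1%:R^-1 <= e.
Proof.
move=> e0; have [N _ HN] := near_infty_natSinv_lt (PosNum e0).
by exists N => n /HN /ltW.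
Qed.

Lemma cstar_closed H (A : set (H -> H)) T : cstar_subalgebra A -> bounded_op T ->
  (forall e : R, 0 < e -> exists2 a, A a & opbd (T - a) e) -> A T.
Proof.
move=> [[_ _ _] _ _ Acl] bT h; apply: Acl => // e e0.
have e2 : 0 < e / 2 by rewrite divr_gt0.
have [a Aa Ta] := h _ e2; exists a => //.
apply: le_lt_trans (opnorm_le (ltW e2) Ta) _.
by rewrite ltr_pdivrMr // ltr_pMr // ltr1n.
Qed.

(** Since [cstar S] is an intersection, its elements have adjoints as soon as one C*-subalgebra
    containing S consists of operators with adjoints. This one serves, without the Riesz
    representation theorem. *)
Definition adjointable H : set (H -> H) :=
  [set T | bounded_op T /\ exists2 T', bounded_op T' & adjoint T T'].

(** The adjoints of a sequence converging to T are Cauchy, with the same bounds, and their limit is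
    an adjoint of T. *)
Lemma adjointable_closed H : norm_closed (adjointable (H := H)).
Proof.
move=> T bT h; split => //.
have {}h k : exists ab : (H -> H) * (H -> H), [/\ bounded_op ab.1, bounded_op ab.2,
    adjoint ab.1 ab.2 & opbd (T - ab.1) k.+1%:R^-1].
  have [a [ba [a' ba' aa'] Ta]] := h _ (natSinv_gt0 k).
  exists (a, a'); split=> //; apply: opbdW (ltW Ta) _.
  apply: opnorm_bd; rewrite (_ : T - a = (- 1) *: a + T).
    exact: bounded_op_lincomb.
  by rewrite scaleN1r addrC.
have [u Hu] := choice h.
have bd m n : opbd ((u m).1 - (u n).1) (m.+1%:R^-1 + n.+1%:R^-1).
  move=> x; have [_ _ _ h1] := Hu m; have [_ _ _ h2] := Hu n.
  rewrite !fctE -(subrKA (T x)) (le_trans (hnorm_triangle _ _)) // mulrDl.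
  by rewrite lerD ?h2 // hnormBC h1.
have [k|e e0|T' bT' HT'] := @op_complete R H H (fun k => (u k).2).
- by have [] := Hu k.
- have e2 : 0 < e / 2 by rewrite divr_gt0.
  have [N HN] := natSinv_small e2; exists N => m n h1 h2.
  apply: (@opbdW _ _ _ _ (m.+1%:R^-1 + n.+1%:R^-1)).
    by rewrite (splitr e) lerD ?HN.
  apply: adjoint_bd (bd m n); first by rewrite addr_ge0 ?invr_ge0.
  have [_ _ am _] := Hu m; have [_ _ an _] := Hu n.
  by move=> x y; rewrite !fctE hdotBl hdotBr am an.
exists T' => // x y; apply/eqP; rewrite -subr_eq0 -cabs_eq0.
rewrite eq_le cabs_ge0 andbT; apply: le_of_le_add => e e0; rewrite add0r.
pose c := hnorm x * hnorm y + 1.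
have c0 : 0 < c by rewrite ltr_wpDl ?mulr_ge0 ?hnorm_ge0.
have e2 : 0 < e / 2 / c by rewrite !divr_gt0.
have [N HN] := natSinv_small e2; have [M HM] := HT' _ e2.
pose n := maxn N M; have [_ _ an Tn] := Hu n.
have -> : hdot (T x) y - hdot x (T' y) =
  hdot (T x - (u n).1 x) y + hdot x ((u n).2 y - T' y).
  by rewrite hdotBl hdotBr an addrA subrK.
rewrite (le_trans (cabsD _ _)) // (splitr e) lerD //.
  rewrite (le_trans (cabs_hdot_le _ _)) //.
  apply: (@le_trans _ _ (e / 2 / c * hnorm x * hnorm y)).
    rewrite ler_wpM2r ?hnorm_ge0 // (le_trans (Tn x)) // ler_wpM2r ?hnorm_ge0 //.
    by rewrite HN // leq_maxl.
  by rewrite -mulrA -[leRHS](@divfK _ c) ?gt_eqF // ler_pM2l // lerDl.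
rewrite (le_trans (cabs_hdot_le _ _)) //.
apply: (@le_trans _ _ (hnorm x * (e / 2 / c * hnorm y))).
  by rewrite ler_wpM2l ?hnorm_ge0 // HM // leq_maxr.
by rewrite mulrCA -[leRHS](@divfK _ c) ?gt_eqF // ler_pM2l // lerDl.
Qed.

Lemma adjointable_cstar H : cstar_subalgebra (adjointable (H := H)).
Proof.
split=> [|T U|T|]; last exact: adjointable_closed.
- split=> [T []//||c T U [bT [T' bT' hT]] [bU [U' bU' hU]]].
    split; first exact: bounded_op0.
    by exists 0; [exact: bounded_op0|exact: adjoint0].
  split; first exact: bounded_op_lincomb.
  by exists (Num.conj c *: T' + U'); [exact: bounded_op_lincomb|exact: adjoint_lincomb].
- move=> [bT [T' bT' hT]] [bU [U' bU' hU]]; split; first exact: bounded_op_comp.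
  by exists (U' \o T'); [exact: bounded_op_comp|exact: adjoint_comp].
- move=> [bT [T' bT' hT]]; exists T' => //; split=> //; exists T => //.
  exact: adjoint_sym.
Qed.

Section Generated.
Variables (H : hilbert R) (S : set (H -> H)).
Hypotheses (S_bd : forall s, S s -> bounded_op s) (S_adj : adjoint_closed S).

Lemma sub_cstar : S `<=` cstar S. Proof. by move=> s Ss A _; apply. Qed.

Lemma cstar_alg : cstar_subalgebra (cstar S).
Proof.
have SA : S `<=` adjointable (H := H).
  move=> s Ss; split; first exact: S_bd.
  by have [s' Ss' h] := S_adj Ss; exists s' => //; exact: S_bd.
split=> [|a b ha hb A A_alg A_S|a ha|T bT h A A_alg A_S].
- split=> [T /(_ _ (adjointable_cstar H) SA)[]//||c T U hT hU] A A_alg A_S;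
    have [[A_bd A0 A_lin] _ _ _] := A_alg => //.
  by apply: A_lin; [apply: hT|apply: hU].
- by have [_ A_mul _ _] := A_alg; apply: A_mul; [apply: ha|apply: hb].
(* Adjoints are unique, so the one found in [adjointable] is the one supplied by every algebra of
   the intersection. *)
- have [_ [a' ba' aa']] := ha _ (adjointable_cstar H) SA; exists a' => //.
  move=> A A_alg A_S; have [_ _ A_adj _] := A_alg.
  by have [b Ab ab] := A_adj _ (ha _ A_alg A_S); rewrite (adjoint_uniq aa' ab).
- have [_ _ _ A_cl] := A_alg; apply: A_cl => // e /h[a ha Ta].
  by exists a => //; apply: ha.
Qed.
End Generated.

Section Algebra.
Variables (H : hilbert R) (A : set (H -> H)).
Hypothesis A_alg : cstar_subalgebra A.
Implicit Types (a b h : H -> H) (c : R[i]).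

Lemma alg_bd a : A a -> bounded_op a.
Proof. by have [[h _ _] _ _ _] := A_alg; apply: h. Qed.
Lemma alg0 : A 0. Proof. by have [[]] := A_alg. Qed.
Lemma alg_lincomb c a b : A a -> A b -> A (c *: a + b).
Proof. by have [[_ _ h] _ _ _] := A_alg; apply: h. Qed.
Lemma algD a b : A a -> A b -> A (a + b).
Proof. by move=> ha hb; rewrite -[a]scale1r; apply: alg_lincomb. Qed.
Lemma algZ c a : A a -> A (c *: a).
Proof. by move=> ha; rewrite -[_ *: _]addr0; apply: alg_lincomb alg0. Qed.
Lemma algB a b : A a -> A b -> A (a - b).
Proof. by move=> ha hb; rewrite -scaleN1r addrC; apply: alg_lincomb. Qed.
Lemma alg_comp a b : A a -> A b -> A (a \o b).
Proof. by have [_ h _ _] := A_alg; apply: h. Qed.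
Lemma alg_adj a : A a -> exists2 a', A a' & adjoint a a'.
Proof. by have [_ _ h _] := A_alg; apply: h. Qed.
Lemma alg_sum (I : Type) (r : seq I) (P : pred I) (f : I -> H -> H) :
  (forall i, A (f i)) -> A (\sum_(i <- r | P i) f i).
Proof. by move=> hf; elim/big_ind: _; [exact: alg0|exact: algD|]. Qed.

Hypothesis A1 : A idfun.

(** y is the sum of the powers of h, and [u k] the k-th partial sum in the form u (k + 1) = 1 + u k
    h. A left inverse of 1 - h is all that [rep_contractive] requires. *)
Lemma neumann h q : A h -> 0 <= q -> q < 1 -> opbd h q ->
  exists2 y, A y & forall x, y (x - h x) = x.
Proof.
move=> Ah q0 q1 hq; have [lh _] := alg_bd Ah.
pose u k : H -> H := iter k (fun f => idfun + (f \o h)) 0.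
have Au k : A (u k) by elim: k => [|k IH]; [exact: alg0|exact/algD/alg_comp].
have lu k : linear (u k) by have [] := alg_bd (Au k).
have r0 : 0 < 1 - q by rewrite subr_gt0.
have ri : 0 < (1 - q)^-1 by rewrite invr_gt0.
have u_bd k : opbd (u k) (1 - q)^-1.
  elim: k => [|k IH] x; first by rewrite hnorm0 mulr_ge0 ?hnorm_ge0 ?(ltW ri).
  rewrite /= fctE (le_trans (hnorm_triangle _ _)) //=.
  have -> : (1 - q)^-1 * hnorm x = hnorm x + (1 - q)^-1 * (q * hnorm x).
    by field; rewrite gt_eqF.
  by rewrite lerD2l (le_trans (IH _)) // ler_pM2l.
have du n k : opbd (u (n + k)%N - u n) (q ^+ n * (1 - q)^-1).
  elim: n => [|n IH] x; first by rewrite expr0 mul1r fctE subr0 u_bd.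
  have -> : (u (n.+1 + k)%N - u n.+1) x = (u (n + k)%N - u n) (h x).
    by rewrite addSn !fctE /= !fctE /= opprD addrACA subrr add0r.
  rewrite (le_trans (IH _)) // exprSr -!mulrA ler_wpM2l ?exprn_ge0 //.
  by rewrite mulrCA ler_pM2l.
have cau e : 0 < e -> exists N, forall m n, (N <= m)%N -> (N <= n)%N ->
    opbd (u m - u n) e.
  move=> e0; have [N HN] := expr_small q0 q1 (mulr_gt0 e0 r0).
  have W m n : (N <= m)%N -> (m <= n)%N -> opbd (u n - u m) e.
    move=> Nm mn; rewrite -(subnKC mn); apply: opbdW (du _ _).
    by rewrite ler_pdivrMr // ltW // HN.
  exists N => m n Nm Nn; have [mn|nm] := leqP m n; last exact: W (ltnW nm).
  by move=> x; rewrite hnormBC; apply: W.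
have [y by_ yu] := op_complete (fun k => alg_bd (Au k)) cau.
exists y.
  apply: cstar_closed => // e /yu[N HN]; exists (u N) => // x.
  by rewrite hnormBC; apply: HN.
move=> x; apply/eqP; rewrite -subr_eq0; apply/eqP.
apply: (@hnorm_le0_eq _ _ _ (hnorm (x - h x) + hnorm x)) => [|e e0].
  by rewrite addr_ge0 ?hnorm_ge0.
have [N HN] := yu e e0; have [M HM] := expr_small q0 q1 e0.
pose n := maxn N M.
have uE k z : u k (z - h z) = z - iter k h z.
  elim: k z => [|k IH] z; first by rewrite subrr.
  by rewrite /= fctE /= (lin_opB lh) IH -iterSr /= addrA subrK.
have hk k : hnorm (iter k h x) <= q ^+ k * hnorm x.
  elim: k => [|k IH]; first by rewrite mul1r.
  by rewrite /= exprS (le_trans (hq _)) // -mulrA ler_wpM2l.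
have pw k : hnorm (u k (x - h x) - x) <= q ^+ k * hnorm x.
  by rewrite uE addrAC subrr sub0r hnorm_opp.
rewrite -(subrKA (u n (x - h x))) (le_trans (hnorm_triangle _ _)) // mulrDl lerD //.
  rewrite mulrC [leLHS]hnormBC.
  by apply: (HN n (leq_maxl _ _) (x - h x)).
by rewrite (le_trans (pw _)) // mulrC ler_wpM2l ?hnorm_ge0 // ltW // HM // leq_maxr.
Qed.

Section Representation.
Variables (K : hilbert R) (rho : (H -> H) -> (K -> K)).
Hypothesis rho_rep : representation A rho.

Lemma rep_bd a : A a -> bounded_op (rho a).
Proof. by have [h _ _ _ _] := rho_rep; apply: h. Qed.
Lemma rep_lincomb c a b : A a -> A b -> rho (c *: a + b) = c *: rho a + rho b.
Proof. by have [_ h _ _ _] := rho_rep; apply: h. Qed.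
Lemma rep_comp a b : A a -> A b -> rho (a \o b) = rho a \o rho b.
Proof. by have [_ _ h _ _] := rho_rep; apply: h. Qed.
Lemma rep_adj a b : A a -> A b -> adjoint a b -> adjoint (rho a) (rho b).
Proof. by have [_ _ _ h _] := rho_rep; apply: h. Qed.
Lemma rep1 : rho idfun = idfun.
Proof. by have [] := rho_rep. Qed.
Lemma rep0 : rho 0 = 0.
Proof.
have := rep_lincomb (- 1) alg0 alg0.
by rewrite scaleN1r addNr => ->; rewrite scaleN1r addNr.
Qed.
Lemma repD a b : A a -> A b -> rho (a + b) = rho a + rho b.
Proof. by move=> ha hb; have := rep_lincomb 1 ha hb; rewrite !scale1r. Qed.
Lemma repZ c a : A a -> rho (c *: a) = c *: rho a.
Proof. by move=> ha; have := rep_lincomb c ha alg0; rewrite rep0 !addr0. Qed.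
Lemma repB a b : A a -> A b -> rho (a - b) = rho a - rho b.
Proof.
move=> ha hb; have := rep_lincomb (- 1) hb ha.
by rewrite !scaleN1r ![- _ + _]addrC.
Qed.
Lemma rep_sum (I : Type) (r : seq I) (P : pred I) (f : I -> H -> H) :
  (forall i, A (f i)) -> rho (\sum_(i <- r | P i) f i) = \sum_(i <- r | P i) rho (f i).
Proof.
move=> hf; elim: r => [|i r IH]; first by rewrite !big_nil rep0.
by rewrite !big_cons; case: ifP => _; rewrite ?repD ?IH //; exact: alg_sum.
Qed.

(* If k = |rho a| exceeded |a|, then 1 - a^* a / k^2 would be invertible in A,
   hence 1 - rho(a)^* rho(a) / k^2 would be bounded below. *)
Lemma rep_contractive a (c : R) : A a -> 0 <= c -> opbd a c -> opbd (rho a) c.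
Proof.
move=> Aa c0 ac; have ba := rep_bd Aa.
pose k := opnorm (rho a); have ak : opbd (rho a) k by exact: opnorm_bd.
have [kc|ck] := leP k c; first exact: opbdW ak.
have k0 : 0 < k by apply: le_lt_trans ck.
have [a' Aa' aa'] := alg_adj Aa.
pose t := k ^- 2; have t0 : 0 < t by rewrite invr_gt0 exprn_gt0.
pose h := (t%:C)%C *: (a' \o a).
have Ah : A h by apply: algZ; exact: alg_comp.
have hq : opbd h (t * c ^+ 2).
  move=> x; rewrite /h fctE hnorm_scale cabs_real ger0_norm ?(ltW t0) // -mulrA ler_pM2l //.
  rewrite (le_trans (adjoint_bd c0 aa' ac _)) // expr2 -mulrA ler_wpM2l //.
have [||y Ay yh] := neumann Ah _ _ hq; first by rewrite mulr_ge0 ?sqr_ge0 ?ltW.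
  by rewrite mulrC ltr_pdivrMr ?exprn_gt0 // mul1r ltr_pXn2r // nnegrE ltW.
have yhE : y \o (idfun - h) = idfun by apply: funext => x /=; rewrite fctE yh.
have Ai : A (idfun - h) by exact: algB.
have := rep_comp Ay Ai; rewrite yhE rep1 repB // rep1 repZ; last exact: alg_comp.
rewrite rep_comp // => E.
have /bounded_opP[ly [M M0 yM]] := rep_bd Ay.
have aa2 := rep_adj Aa Aa' aa'.
(* The left inverse gives |x| <= M |x - t rho(a') rho(a) x|. In the expanded square the cross term
   is -2 t |rho(a) x|^2, and the last term is at most t |rho(a) x|^2 because rho(a') is bounded by
   k. *)
have key x : hnorm x ^+ 2 <= M ^+ 2 * (hnorm x ^+ 2 - t * hnorm (rho a x) ^+ 2).
  have := congr1 (fun f => f x) E; rewrite /= !fctE /= => Ex.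
  have := yM (x - (t%:C)%C *: rho a' (rho a x)); rewrite -Ex => h1.
  have h2 : hnorm x ^+ 2 <= M ^+ 2 * hnorm (x - (t%:C)%C *: rho a' (rho a x)) ^+ 2.
    by rewrite -exprMn ler_pXn2r // nnegrE ?mulr_ge0 ?hnorm_ge0.
  apply: le_trans h2 _; rewrite ler_wpM2l ?sqr_ge0 //.
  rewrite hnormD_sqr hnorm_opp hnorm_scale cabs_real ger0_norm ?(ltW t0) //.
  rewrite hdotNr hdotZr -aa2 hdotxx.
  have -> : complex.Re (- (Num.conj (t%:C)%C * ((hnorm (rho a x) ^+ 2)%:C)%C)) =
    - (t * hnorm (rho a x) ^+ 2).
    by rewrite /=; ring.
  have := adjoint_bd (ltW k0) aa2 ak (rho a x).
  move: (hnorm (rho a' _)) (hnorm (rho a x)) (hnorm_ge0 (rho a' (rho a x)))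
    (hnorm_ge0 (rho a x)) => p r p0 r0 pr.
  have : (t * p) ^+ 2 <= t * r ^+ 2.
    rewrite exprMn expr2 -mulrA ler_pM2l //.
    have -> : r ^+ 2 = t * (k * r) ^+ 2 by rewrite exprMn mulrA mulVf ?mul1r // gt_eqF ?exprn_gt0.
    by rewrite ler_pM2l // ler_pXn2r // nnegrE mulr_ge0 // ltW.
  lra.
(* If M >= 1, [key] bounds rho(a) by k sqrt(1 - M^-2), which is less than its norm k. If M < 1,
   [key] leaves only K = 0. *)
have [M1|M1] := ltP M 1; last first.
  have m0 : 0 < M ^+ 2 by rewrite exprn_gt0 // (lt_le_trans ltr01).
  pose s := Num.sqrt (k ^+ 2 * (1 - M ^- 2)).
  have p0 : 0 <= k ^+ 2 * (1 - M ^- 2).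
    by rewrite mulr_ge0 ?sqr_ge0 // subr_ge0 invf_le1 // exprn_ege1.
  have : k <= s.
    apply: opnorm_le (sqrtr_ge0 _) _; apply/opbd_sqr; first exact: sqrtr_ge0.
    move=> x; rewrite [s ^+ 2]sqr_sqrtr //; have := key x.
    rewrite -ler_pdivrMl // => h1.
    have h2 : t * hnorm (rho a x) ^+ 2 <= (1 - M ^- 2) * hnorm x ^+ 2 by lra.
    rewrite -mulrA -ler_pdivrMl ?exprn_gt0 //.
  rewrite -(@ler_pXn2r _ 2) ?nnegrE ?(ltW k0) ?sqrtr_ge0 // [s ^+ 2]sqr_sqrtr //.
  by rewrite ler_pMr ?exprn_gt0 // lerDl oppr_ge0 leNgt invr_gt0 m0.
have z (x : K) : hnorm x = 0.
  have w0 : 0 <= t * hnorm (rho a x) ^+ 2 by rewrite mulr_ge0 ?sqr_ge0 ?(ltW t0).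
  have v1 : 0 < 1 - M ^+ 2 by rewrite subr_gt0 expr_lt1.
  have u0 : (1 - M ^+ 2) * hnorm x ^+ 2 <= 0.
    have := key x; have := mulr_ge0 (sqr_ge0 M) w0; lra.
  apply/eqP; rewrite -sqrf_eq0 eq_le sqr_ge0 andbT.
  by rewrite -(pmulr_rle0 _ v1).
by move=> x; rewrite !z mulr0.
Qed.

End Representation.
End Algebra.
End CstarAlgebra.

(** * Finite powers of a Hilbert space and operator matrices *)

Section FiniteSums.
Variable R : realType.
Implicit Types (H K L : hilbert R).

Lemma is_usum_fin (J : finType) (a : J -> R[i]) : is_usum a (\sum_j a j).
Proof.
move=> e e0; exists [fset j in enum J]%fset => F /fsubsetP JF.
rewrite (big_uniq _ (fset_uniq F)) (eq_bigl xpredT) ?subrr ?normr0 // => j.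
by apply: JF; rewrite in_fset /= mem_enum.
Qed.

Lemma is_usum_single (I : choiceType) (a : I -> R[i]) i :
  (forall j, j != i -> a j = 0) -> is_usum a (a i).
Proof.
move=> ai e e0; exists [fset i]%fset => F; rewrite fsub1set => iF.
rewrite (big_fsetD1 i) //= big_seq big1 ?addr0 ?subrr ?normr0 // => j.
by rewrite in_fsetD1 => /andP[/ai].
Qed.

Section Injection.
Variables (I : choiceType) (K : I -> hilbert R).

Lemma hinj_summable i (v : K i) :
  square_summable (dfwith (fun j => 0 : K j) i v).
Proof.
exists (hnorm v ^+ 2) => F.
have E j : hnorm (dfwith (fun j => 0 : K j) i v j) ^+ 2 =
    if j == i then hnorm v ^+ 2 else 0.
  case: eqVneq => [->|ji]; first by rewrite dfwithin.
  by rewrite dfwithout 1?eq_sym // hnorm0 expr0n.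
rewrite (eq_bigr _ (fun j _ => E j)).
have [iF|iF] := boolP (i \in F).
  rewrite (big_fsetD1 i) //= eqxx big_seq big1 ?addr0 // => j.
  by rewrite in_fsetD1 => /andP[/negPf ->].
rewrite big_seq big1 ?sqr_ge0 // => j jF; case: eqP => // ji.
by rewrite -ji jF in iF.
Qed.

Definition hinj i (v : K i) : hilbert_sum K := Hsum (hinj_summable v).
Arguments hinj i v : clear implicits.

Lemma hinj_same i (v : K i) : hinj i v i = v. Proof. exact: dfwithin. Qed.

Lemma hinj_neq i j (v : K i) : j != i -> hinj i v j = 0.
Proof. by move=> ji; rewrite [LHS]dfwithout // eq_sym. Qed.

Lemma hinj_linear i : linear (hinj i : K i -> hilbert_sum K).
Proof.
move=> a x y; apply: hsum_ext => j; rewrite hsum_addE hsum_scaleE.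
have [->|ji] := eqVneq j i; first by rewrite !hinj_same.
by rewrite !hinj_neq // scaler0 addr0.
Qed.

Lemma hdot_hinj i (v : K i) (f : hilbert_sum K) : hdot (hinj i v) f = hdot v (f i).
Proof.
apply: (is_usum_unique (hsum_dotP _ _)).
rewrite -[X in hdot X (f i)](hinj_same v).
apply: is_usum_single => j ji; by rewrite hinj_neq // hdot0l.
Qed.

Lemma hdot_hinj_r i (v : K i) (f : hilbert_sum K) : hdot f (hinj i v) = hdot (f i) v.
Proof. by rewrite hdotC hdot_hinj -hdotC. Qed.

Lemma hnorm_hinj i (v : K i) : hnorm (hinj i v) = hnorm v.
Proof.
apply/eqP; rewrite -(@eqrXn2 _ 2) ?hnorm_ge0 //; apply/eqP/(@complexI R).
by rewrite -!hdotxx hdot_hinj hinj_same.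
Qed.

End Injection.
Arguments hinj {I K} i v : simpl never.

(** Arbitrary finite index types allow sums and products of index sets without renumbering; [mxsq]
    returns to ordinals. *)
Definition hpow (J : finType) H : hilbert R := hilbert_sum (fun _ : J => H).

Section Power.
Variables (J : finType) (H : hilbert R).

Lemma hvec_summable (x : J -> H) : square_summable (K := fun=> H) x.
Proof.
exists (\sum_j hnorm (x j) ^+ 2) => F.
rewrite (big_uniq _ (fset_uniq F)) [leRHS](bigID (mem F)) /= lerDl.
by rewrite sumr_ge0 // => j _; rewrite sqr_ge0.
Qed.

Definition hvec (x : J -> H) : hpow J H := Hsum (hvec_summable x).

Lemma hpowP (x y : hpow J H) : (forall j, x j = y j) -> x = y.
Proof. exact: hsum_ext. Qed.
Lemma hpowD (x y : hpow J H) j : (x + y) j = x j + y j.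
Proof. exact: hsum_addE. Qed.
Lemma hpowB (x y : hpow J H) j : (x - y) j = x j - y j.
Proof. by rewrite hsum_addE hsum_oppE. Qed.
Lemma hpowZ a (x : hpow J H) j : (a *: x) j = a *: x j.
Proof. exact: hsum_scaleE. Qed.
Lemma hpow_sum (I : Type) (r : seq I) (P : pred I) (f : I -> hpow J H) j :
  (\sum_(i <- r | P i) f i : hpow J H) j = \sum_(i <- r | P i) f i j.
Proof.
by apply: (big_morph (fun z : hpow J H => z j)) => // x y; rewrite hpowD.
Qed.

Lemma hdot_hpow (x y : hpow J H) : hdot x y = \sum_j hdot (x j) (y j).
Proof. exact: (is_usum_unique (hsum_dotP _ _) (is_usum_fin _)). Qed.

Lemma hnorm_hpow (x : hpow J H) : hnorm x ^+ 2 = \sum_j hnorm (x j) ^+ 2.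
Proof.
apply: (@complexI R); rewrite -hdotxx hdot_hpow rmorph_sum.
by apply: eq_bigr => j _; rewrite hdotxx.
Qed.

Lemma hnorm_coord (x : hpow J H) j : hnorm (x j) <= hnorm x.
Proof.
rewrite -(@ler_pXn2r _ 2) ?nnegrE ?hnorm_ge0 // hnorm_hpow (bigD1 j) //= lerDl.
by rewrite sumr_ge0 // => k _; rewrite sqr_ge0.
Qed.

Lemma hpow_hinj_sum (x : hpow J H) : x = \sum_j hinj (K := fun=> H) j (x j).
Proof.
apply: hpowP => k; rewrite hpow_sum (bigD1 k) // hinj_same big1 ?Monoid.mulm1 //.
by move=> j jk; rewrite hinj_neq // eq_sym.
Qed.

End Power.

Definition opmx (H L : hilbert R) (J K : finType) (T : J -> K -> H -> L) : hpow K H -> hpow J L :=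
  fun x => hvec (fun j => \sum_k T j k (x k)).

Lemma opmxE (H L : hilbert R) (J K : finType) (T : J -> K -> H -> L) x j :
  opmx T x j = \sum_k T j k (x k).
Proof. by []. Qed.

Definition entry (H L : hilbert R) (J K : finType) (T : hpow K H -> hpow J L) j k : H -> L :=
  fun x => T (hinj (K := fun=> H) k x) j.

Lemma opmx_bd (H L : hilbert R) (J K : finType) (T : J -> K -> H -> L) :
  (forall j k, bounded_op (T j k)) -> bounded_op (opmx T).
Proof.
move=> T_bd; apply/bounded_opP.
have lT j k : linear (T j k) by have [] := T_bd j k.
split=> [a x y|].
  apply: hpowP => j; rewrite hpowD hpowZ !opmxE scaler_sumr -big_split.
  by apply: eq_bigr => k _; rewrite hpowD hpowZ lT.
have h j : exists c : K -> R, forall k, 0 <= c k /\ opbd (T j k) (c k).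
  suff h k : exists c : R, 0 <= c /\ opbd (T j k) c by have [c] := choice h; exists c.
  by have /bounded_opP[_ [c c0 Tc]] := T_bd j k; exists c.
have [c Hc] := choice h.
pose d j := \sum_k c j k.
have d0 j : 0 <= d j by apply: sumr_ge0 => k _; have [] := Hc j k.
exists (Num.sqrt (\sum_j d j ^+ 2)); first exact: sqrtr_ge0.
apply/opbd_sqr; first exact: sqrtr_ge0.
move=> x; rewrite [Num.sqrt (\sum_j d j ^+ 2) ^+ 2]sqr_sqrtr; last by apply: sumr_ge0 => j _; rewrite sqr_ge0.
rewrite hnorm_hpow mulr_suml; apply: ler_sum => j _.
rewrite -exprMn ler_pXn2r ?nnegrE ?mulr_ge0 ?hnorm_ge0 //=.
rewrite (le_trans (hnorm_sum _ _ _)) // mulr_suml; apply: ler_sum => k _.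
have [c0 Tc] := Hc j k; apply: le_trans (Tc _) _.
by rewrite ler_wpM2l // hnorm_coord.
Qed.

Lemma opmx_adj (H L : hilbert R) (J K : finType) (T : J -> K -> H -> L) (T' : K -> J -> L -> H) :
  (forall j k, adjoint (T j k) (T' k j)) -> adjoint (opmx T) (opmx T').
Proof.
move=> h x y; rewrite !hdot_hpow /=.
under eq_bigr => j _ do rewrite hdot_suml.
under [RHS]eq_bigr => k _ do rewrite hdot_sumr.
by rewrite exchange_big; do 2!apply: eq_bigr => ? _; rewrite h.
Qed.

Lemma opmxK (H L : hilbert R) (J K : finType) (T : J -> K -> H -> L) j k :
  (forall j k, linear (T j k)) -> entry (opmx T) j k = T j k.
Proof.
move=> lT; apply: funext => x; rewrite /entry opmxE (bigD1 k) //.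
rewrite hinj_same big1 ?Monoid.mulm1 // => i ik.
by rewrite hinj_neq // lin_op0.
Qed.

Lemma entryK (H L : hilbert R) (J K : finType) (T : hpow K H -> hpow J L) :
  linear T -> opmx (entry T) = T.
Proof.
move=> lT; apply: funext => x; apply: hpowP => j.
by rewrite [x in RHS]hpow_hinj_sum (lin_op_sum lT) hpow_sum.
Qed.

Lemma entry_linear (H L : hilbert R) (J K : finType) (T : hpow K H -> hpow J L) j k :
  linear T -> linear (entry T j k).
Proof. by move=> lT a x y; rewrite /entry hinj_linear lT hpowD hpowZ. Qed.

Lemma entry_opbd (H L : hilbert R) (J K : finType) (T : hpow K H -> hpow J L) j k c :
  opbd T c -> opbd (entry T j k) c.
Proof.
move=> Tc x; apply: le_trans (hnorm_coord _ _) _.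
by apply: le_trans (Tc _) _; rewrite hnorm_hinj.
Qed.

Lemma entry_comp (H L M : hilbert R) (J K I : finType)
    (T : hpow K L -> hpow J M) (U : hpow I H -> hpow K L) j i : linear T ->
  entry (T \o U) j i = \sum_k (entry T j k \o entry U k i).
Proof.
move=> lT; apply: funext => x; rewrite fct_sumE /entry /=.
by rewrite {1}[U _]hpow_hinj_sum (lin_op_sum lT) hpow_sum.
Qed.

End FiniteSums.
Arguments hinj {R I K} i v : simpl never.

Section MatrixAlgebra.
Variable R : realType.
Implicit Types (H K L : hilbert R).

Section Amplification.
Variables (H : hilbert R) (A : set (H -> H)) (J : finType).
Hypotheses (A_alg : cstar_subalgebra A) (A1 : A idfun).

(** M_J(A) acting on H^J. It is again a C*-subalgebra, so complete contractivity of a representation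
    is [rep_contractive] applied to its amplification [mxrep]. *)
Definition mxalg : set (hpow J H -> hpow J H) :=
  [set T | linear T /\ forall p q, A (entry T p q)].

Lemma mxalg_bd T : mxalg T -> bounded_op T.
Proof.
move=> [lT hT]; rewrite -(entryK lT); apply: opmx_bd => p q.
exact: (alg_bd A_alg).
Qed.

Lemma mxalg_opmx (T : J -> J -> H -> H) : (forall p q, A (T p q)) -> mxalg (opmx T).
Proof.
move=> hT; have [|lT _] := @opmx_bd _ _ _ _ _ T; first by move=> p q; exact: (alg_bd A_alg).
split=> // p q; rewrite opmxK // => i j; by have [] := alg_bd A_alg (hT i j).
Qed.

Lemma entry_id p q :
  entry (idfun : hpow J H -> hpow J H) p q = if p == q then idfun else 0.
Proof.
apply: funext => x; rewrite /entry /idfun.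
by case: eqVneq => [->|pq]; [rewrite hinj_same|rewrite hinj_neq].
Qed.

Lemma entry_lincomb c (T U : hpow J H -> hpow J H) p q :
  entry (c *: T + U) p q = c *: entry T p q + entry U p q.
Proof. by apply: funext => x; rewrite /entry !fctE hpowD hpowZ. Qed.

Lemma mxalg_id : mxalg idfun.
Proof.
split=> // p q; rewrite entry_id; case: ifP => _ //; exact: (alg0 A_alg).
Qed.

Lemma entry_adj (T U : hpow J H -> hpow J H) p q :
  adjoint T U -> adjoint (entry T p q) (entry U q p).
Proof.
move=> h x y.
have l := hdot_hinj_r (K := fun=> H) y (T (hinj (K := fun=> H) q x)).
have r := hdot_hinj (K := fun=> H) x (U (hinj (K := fun=> H) p y)).
rewrite /entry -[LHS]l -[RHS]r; exact: h.
Qed.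

Lemma mxalg_cstar : cstar_subalgebra mxalg.
Proof.
split=> [|T U [lT hT] [lU hU]|T hT|T bT h].
- split=> [T|| c T U [lT hT] [lU hU]]; first exact: mxalg_bd.
    by split=> [a x y|p q]; [rewrite scaler0 addr0|exact: alg0].
  split; last by move=> p q; rewrite entry_lincomb; exact: (alg_lincomb A_alg).
  have [] // : bounded_op (c *: T + U).
  by apply: bounded_op_lincomb; exact: mxalg_bd.
- split=> [a x y|p q]; first by rewrite /= lU lT.
  rewrite entry_comp //; apply: alg_sum => // k; exact: (alg_comp A_alg).
- have [lT hA] := hT.
  have h p q : exists a', A a' /\ adjoint (entry T p q) a'.
    by have [a' ? ?] := alg_adj A_alg (hA p q); exists a'.
  have {h}[a' Ha] : exists a' : J -> J -> H -> H, forall p q, A (a' p q) /\ adjoint (entry T p q) (a' p q).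
    have h2 p : exists f : J -> H -> H, forall q, A (f q) /\ adjoint (entry T p q) (f q).
      by have [f hf] := choice (h p); exists f.
    by have [f hf] := choice h2; exists f.
  exists (opmx (fun p q => a' q p)).
    by apply: mxalg_opmx => p q; have [] := Ha q p.
  rewrite -{1}(entryK lT); apply: opmx_adj => p q; by have [] := Ha p q.
- have [lT _] := bT; split=> // p q; apply: cstar_closed => //.
    have /bounded_opP[_ [c c0 Tc]] := bT; apply/bounded_opP.
    by split; [exact: entry_linear|exists c => //; exact: entry_opbd].
  move=> e e0; have e2 : 0 < e / 2 by rewrite divr_gt0.
  have [U hU TU] := h _ e0; exists (entry U p q); first by have [_] := hU.
  have E : entry T p q - entry U p q = entry (T - U) p q.
    by apply: funext => x; rewrite /entry !fctE hpowB.
  rewrite E; apply: entry_opbd; apply: opbdW (ltW TU) _; apply: opnorm_bd.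
  exact: (bounded_opB bT (mxalg_bd hU)).
Qed.

Section AmplifiedRep.
Variables (K : hilbert R) (rho : (H -> H) -> (K -> K)).
Hypothesis rho_rep : representation A rho.

Definition mxrep (T : hpow J H -> hpow J H) : hpow J K -> hpow J K :=
  opmx (fun p q => rho (entry T p q)).

Lemma mxrep_rep : representation mxalg mxrep.
Proof.
split=> [T [_ hT]|c T U [_ hT] [_ hU]|T U [lT hT] [lU hU]|T U [lT hT] [lU hU] h|].
- by apply: opmx_bd => p q; exact: (rep_bd rho_rep).
- apply: funext => x; apply: hpowP => j; rewrite !fctE hpowD hpowZ /mxrep !opmxE.
  rewrite scaler_sumr -big_split; apply: eq_bigr => k _.
  by rewrite entry_lincomb (rep_lincomb rho_rep).
- apply: funext => x; apply: hpowP => j.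
  rewrite -[RHS]/(mxrep T (mxrep U x) j) /mxrep !opmxE.
  under eq_bigr => k _.
    rewrite entry_comp // (rep_sum A_alg rho_rep) ?fct_sumE; last first.
      by move=> i; exact: (alg_comp A_alg).
    under eq_bigr => i _ do rewrite (rep_comp rho_rep) //=.
    over.
  rewrite exchange_big; apply: eq_bigr => i _; rewrite opmxE.
  by rewrite (lin_op_sum (rep_bd rho_rep (hT j i)).1).
- apply: opmx_adj => p q; apply: (rep_adj rho_rep) => //; exact: entry_adj.
- apply: funext => x; apply: hpowP => j; rewrite /mxrep opmxE (bigD1 j) //.
  rewrite entry_id eqxx (rep1 rho_rep) big1 ?Monoid.mulm1 // => k kj.
  by rewrite entry_id eq_sym (negPf kj) (rep0 A_alg rho_rep).
Qed.

Lemma rep_square_contractive (T : J -> J -> H -> H) c : (forall p q, A (T p q)) ->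
  0 <= c -> opbd (opmx T) c -> opbd (opmx (fun p q => rho (T p q))) c.
Proof.
move=> hT c0 Tc.
have := rep_contractive mxalg_cstar mxalg_id mxrep_rep (mxalg_opmx hT) c0 Tc.
congr (opbd (opmx _) c); apply: funext => p; apply: funext => q.
by rewrite opmxK // => i j; have [] := alg_bd A_alg (hT i j).
Qed.

End AmplifiedRep.
End Amplification.

Section Padding.
Variables (H L : hilbert R) (J K : finType).

(** A rectangular matrix as the off-diagonal corner of a square one over J + K, which has the same
    norm. *)
Definition mxpad (T : J -> K -> H -> L) (p q : J + K) : H -> L :=
  match p, q with inl j, inr k => T j k | _, _ => 0 end.

Lemma mxpad_inl T (x : hpow (J + K)%type H) j :
  opmx (mxpad T) x (inl j) = opmx T (hvec (fun k => x (inr k))) j.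
Proof. by rewrite !opmxE big_sumType /= big1 // add0r. Qed.

Lemma mxpad_inr T (x : hpow (J + K)%type H) k : opmx (mxpad T) x (inr k) = 0.
Proof. by rewrite !opmxE big_sumType /= !big1 // addr0. Qed.

Lemma hnorm_mxpad T (x : hpow (J + K)%type H) :
  hnorm (opmx (mxpad T) x) = hnorm (opmx T (hvec (fun k => x (inr k)))).
Proof.
apply/eqP; rewrite -(@eqrXn2 _ 2) ?hnorm_ge0 // !hnorm_hpow; apply/eqP.
transitivity (\sum_j hnorm (opmx (mxpad T) x (inl j)) ^+ 2 +
  \sum_k hnorm (opmx (mxpad T) x (inr k)) ^+ 2); first exact: big_sumType.
rewrite [X in _ + X]big1 ?addr0 => [|k _]; last by rewrite mxpad_inr hnorm0 expr0n.
by apply: eq_bigr => j _; rewrite mxpad_inl.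
Qed.

Lemma opbd_mxpad T c : 0 <= c -> opbd (opmx T) c <-> opbd (opmx (mxpad T)) c.
Proof.
move=> c0; split=> Tc x.
  rewrite hnorm_mxpad (le_trans (Tc _)) // ler_wpM2l //.
  rewrite -(@ler_pXn2r _ 2) ?nnegrE ?hnorm_ge0 // !hnorm_hpow big_sumType /=.
  by rewrite lerDr sumr_ge0 // => j _; rewrite sqr_ge0.
pose y : hpow (J + K)%type H :=
  hvec (fun p => match p with inl _ => 0 | inr k => x k end).
have -> : hnorm x = hnorm y.
  apply/eqP; rewrite -(@eqrXn2 _ 2) ?hnorm_ge0 // !hnorm_hpow big_sumType /=.
  by rewrite [X in _ == X + _]big1 ?add0r // => j _; rewrite hnorm0 expr0n.
have := Tc y; rewrite hnorm_mxpad; congr (hnorm (opmx T _) <= _).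
Qed.

End Padding.

Lemma rep_mx_contractive H K (A : set (H -> H)) (rho : (H -> H) -> (K -> K))
    (I J : finType) (T : I -> J -> H -> H) c :
  cstar_subalgebra A -> A idfun -> representation A rho ->
  (forall i j, A (T i j)) -> 0 <= c ->
  opbd (opmx T) c -> opbd (opmx (fun i j => rho (T i j))) c.
Proof.
move=> A_alg A1 rho_rep hT c0 /(opbd_mxpad _ c0) Tc; apply/(opbd_mxpad _ c0).
have hp p q : A (mxpad T p q).
  by case: p q => [i|i] [j|j] /=; rewrite ?hT //; exact: (alg0 A_alg).
have := rep_square_contractive A_alg A1 rho_rep hp c0 Tc.
congr (opbd (opmx _) c); apply: funext => -[i|i]; apply: funext => -[j|j] //=;
  exact: (rep0 A_alg rho_rep).
Qed.

Section MatrixNorm.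
Variables (H K : hilbert R) (n : nat) (G : set H) (A : 'M[H -> K]_n).
Hypotheses (G0 : G 0) (GZ : forall a x, G x -> G (a *: x)).
Hypothesis A_bd : forall i j, bounded_op (A i j).

Let Gn : set (hpow 'I_n H) := [set x | forall i, G (x i)].

Lemma vnorm_hvec L (x : 'I_n -> L) : vnorm x = hnorm (hvec x).
Proof.
by apply/eqP; rewrite -(@eqrXn2 _ 2) ?sqrtr_ge0 ?hnorm_ge0 // hnorm_hpow sqr_sqrtr //
  sumr_ge0 // => i _; rewrite sqr_ge0.
Qed.

Lemma mxnorm_onE : mxnorm_on G A = opnorm_on Gn (opmx (fun i j => A i j)).
Proof.
have E (x : 'I_n -> H) : vnorm (mxapp A x) = hnorm (opmx (fun i j => A i j) (hvec x)).
  by rewrite vnorm_hvec.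
congr sup; apply/seteqP; split=> [_ [x [Gx x1] <-]|_ [x [Gx x1] <-]].
  by exists (hvec x); rewrite ?E //; split=> //=; rewrite -vnorm_hvec.
exists x; last by rewrite E; congr hnorm; congr opmx; exact: hpowP.
by split=> //; rewrite vnorm_hvec (_ : hvec _ = x) //; exact: hpowP.
Qed.

Lemma mxnorm_on_le c : 0 <= c ->
  (forall x : hpow 'I_n H, (forall i, G (x i)) ->
     hnorm (opmx (fun i j => A i j) x) <= c * hnorm x) ->
  mxnorm_on G A <= c.
Proof.
by move=> c0 Ac; rewrite mxnorm_onE; apply: opnorm_on_le => // i; exact: G0.
Qed.

Lemma mxnorm_on_bd (x : hpow 'I_n H) : (forall i, G (x i)) ->
  hnorm (opmx (fun i j => A i j) x) <= mxnorm_on G A * hnorm x.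
Proof.
have /bounded_opP[lA [c c0 Ac]] := opmx_bd A_bd.
move=> Gx; rewrite mxnorm_onE; apply: (@opnorm_on_bd _ _ _ _ _ _ _ _ c) => //.
by move=> a y Gy i; rewrite hpowZ; exact: GZ.
Qed.

Lemma mxnorm_on_ge0 : 0 <= mxnorm_on G A.
Proof.
have /bounded_opP[lA [c c0 Ac]] := opmx_bd A_bd.
rewrite mxnorm_onE; apply: (@opnorm_on_ge0 _ _ _ _ _ _ _ c) => //.
Qed.

End MatrixNorm.

Section FullMatrixNorm.
Variables (H K : hilbert R) (n : nat) (A : 'M[H -> K]_n).

Lemma mxnorm_le c : 0 <= c -> opbd (opmx (fun i j => A i j)) c -> mxnorm A <= c.
Proof. by move=> c0 Ac; apply: mxnorm_on_le. Qed.

Hypothesis A_bd : forall i j, bounded_op (A i j).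

Lemma mxnorm_bd : opbd (opmx (fun i j => A i j)) (mxnorm A).
Proof. by move=> x; apply: mxnorm_on_bd. Qed.

Lemma mxnorm_ge0 : 0 <= mxnorm A.
Proof. exact: mxnorm_on_ge0. Qed.
End FullMatrixNorm.

End MatrixAlgebra.

(** * Compactness in finite dimension *)

Section Compactness.
Variable R : realType.
Implicit Types (H K L : hilbert R).

Lemma unit_gt H L (T : H -> L) c x : linear T -> c * hnorm x < hnorm (T x) ->
  exists a, hnorm (a *: x) = 1 /\ c < hnorm (T (a *: x)).
Proof.
move=> lT cT.
have n0 : 0 < hnorm x.
  rewrite hnorm_gt0; apply: contraTneq cT => ->.
  by rewrite (lin_op0 lT) !hnorm0 mulr0 ltxx.
exists (((hnorm x)^-1)%:C)%C.
rewrite (lin_opZ lT) !hnorm_scale cabs_real ger0_norm ?invr_ge0 ?hnorm_ge0 //.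
by split; [rewrite mulVf // gt_eqF | rewrite mulrC ltr_pdivlMr].
Qed.

(** Of the extraction only [k <= f k] is kept: it transfers eventual bounds to the subsequence and
    survives composition. *)
Lemma bw_real (u : nat -> R) C : (forall k, `|u k| <= C) ->
  exists (f : nat -> nat) (l : R), (forall k, (k <= f k)%N) /\
    forall e, 0 < e -> exists N, forall k, (N <= k)%N -> `|u (f k) - l| < e.
Proof.
move=> uC; have bu : bounded_fun u.
  by exists C; split; [exact: num_real|move=> M CM k _; exact: le_trans (uC k) (ltW CM)].
have [f fi /cvg_ex[l ul]] := bolzano_weierstrass bu.
exists f, l; split.
  elim=> // k IH; apply: leq_ltn_trans IH _.
  by rewrite -[(f k < f k.+1)%N]/((f k < f k.+1)%O) (leW_mono fi) ltEnat /=.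
move=> e e0; have /cvgrPdist_lt/(_ e e0)[N _ HN] := ul.
by exists N => k /HN /=; rewrite distrC.
Qed.

Lemma bw_seq (J : eqType) (r : seq J) (u : J -> nat -> R) C :
  (forall j k, `|u j k| <= C) ->
  exists (f : nat -> nat) (l : J -> R), (forall k, (k <= f k)%N) /\
    forall j, j \in r -> forall e, 0 < e ->
      exists N, forall k, (N <= k)%N -> `|u j (f k) - l j| < e.
Proof.
move=> uC; elim: r => [|i r [f [l [fk Hf]]]]; first by exists id, (fun=> 0).
have [g [m [gk Hg]]] := bw_real (fun k => uC i (f k)).
exists (f \o g), (fun j => if j == i then m else l j); split=> [k|j].
  exact: leq_trans (gk k) (fk _).
rewrite inE; have [-> _|ji /= jr] := eqVneq j i; first exact: Hg.
move=> e /(Hf j jr)[N HN]; exists N => k Nk /=; apply: HN.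
exact: leq_trans Nk (gk k).
Qed.

Section Euclidean.
Variable m : nat.
Local Notation E := (euclidean R m).

Lemma hnorm_coord_euclid (v : E) (j : 'I_m) : cabs ((v : 'rV[R[i]]_m) 0 j) <= hnorm v.
Proof.
rewrite ler_wsqrtr // sqn_dotmx (bigD1 j) //= lerDl sumr_ge0 // => k _.
by rewrite addr_ge0 ?sqr_ge0.
Qed.

Lemma hnorm_delta (j : 'I_m) : hnorm (delta_mx 0 j : E) = 1.
Proof.
rewrite /hnorm sqn_dotmx (bigD1 j) //= big1 ?addr0 => [|k kj].
  by rewrite mxE !eqxx /= expr0n expr1n addr0 sqrtr1.
by rewrite mxE eqxx (negPf kj) /= !expr0n addr0.
Qed.

Lemma hnorm_le_coords (v : E) : hnorm v <= \sum_j cabs ((v : 'rV[R[i]]_m) 0 j).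
Proof.
rewrite {1}[v]row_sum_delta (le_trans (hnorm_sum _ _ _)) //.
by apply: ler_sum => j _; rewrite hnorm_scale hnorm_delta mulr1.
Qed.

Lemma linear_euclid_bd L (T : E -> L) : linear T -> bounded_op T.
Proof.
move=> lT; split=> //; exists (\sum_j hnorm (T (delta_mx 0 j))) => v.
rewrite {1}[v]row_sum_delta (lin_op_sum lT) (le_trans (hnorm_sum _ _ _)) //.
rewrite mulr_suml; apply: ler_sum => j _; rewrite (lin_opZ lT) hnorm_scale mulrC.
by rewrite ler_wpM2l ?hnorm_ge0 // hnorm_coord_euclid.
Qed.

Variable K : finType.
Local Notation V := (hpow K E).

Lemma hnorm_le_sum (x : V) : hnorm x <= \sum_k hnorm (x k).
Proof.
rewrite {1}[x]hpow_hinj_sum (le_trans (hnorm_sum _ _ _)) //.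
by apply: ler_sum => j _; rewrite hnorm_hinj.
Qed.

Lemma bw_hpow (z : nat -> V) C : (forall k, hnorm (z k) <= C) ->
  exists (f : nat -> nat) (y : V), (forall k, (k <= f k)%N) /\
    forall e, 0 < e -> exists N, forall k, (N <= k)%N -> hnorm (z (f k) - y) < e.
Proof.
move=> zC; pose J := (K * 'I_m * bool)%type.
pose u (j : J) k : R := let c := (z k j.1.1 : 'rV[R[i]]_m) 0 j.1.2 in
  if j.2 then complex.Re c else complex.Im c.
have uC j k : `|u j k| <= C.
  apply: le_trans (zC k); apply: le_trans (hnorm_coord _ j.1.1).
  apply: le_trans (hnorm_coord_euclid _ j.1.2); rewrite /u.
  by case: ifP => _; [exact: Re_le_cabs|exact: Im_le_cabs].
have [f [l [fk Hf]]] := bw_seq (enum {: J}) uC.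
exists f, (hvec (fun k => (\row_j Complex (l (k, j, true)) (l (k, j, false)) : E))).
split=> // e e0.
(* [J] enumerates the real coordinates of V; the successor makes the final bound strict and the
   denominator positive even when [J] is empty. *)
pose N0 := (#|{: J}|.+1)%:R : R.
have N00 : 0 < N0 by rewrite ltr0Sn.
have eN : 0 < e / N0 by rewrite divr_gt0.
have h j : exists N, forall k, (N <= k)%N -> `|u j (f k) - l j| < e / N0.
  by apply: Hf eN; rewrite mem_enum.
have [N HN] := choice h.
exists (\max_j N j)%N => k Nk.
have B j : `|u j (f k) - l j| <= e / N0.
  by apply/ltW/HN/(leq_trans _ Nk)/leq_bigmax.
apply: le_lt_trans (hnorm_le_sum _) _.
apply: (@le_lt_trans _ _ (\sum_(i : K) \sum_(j < m) \sum_(b : bool) (e / N0))).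
  apply: ler_sum => i _; rewrite hpowB; apply: le_trans (hnorm_le_coords _) _.
  apply: ler_sum => j _; rewrite big_bool /=; apply: le_trans (cabs_le _) _.
  rewrite lerD //.
    by have := B (i, j, true); rewrite /u !mxE raddfB.
  by have := B (i, j, false); rewrite /u !mxE raddfB.
rewrite !pair_big /= sumr_const -mulr_natr mulrAC ltr_pdivrMr //.
rewrite ltr_pM2l // ltr_nat ltnS leq_eqVlt; apply/orP; left; apply/eqP.
by apply: eq_card => -[[]].
Qed.

(** Compactness of the unit sphere of the closed cone P: nearly maximizing unit vectors would
    subconverge to a vector violating the strict inequality. It is applied to all vectors in
    [norm_attained] and to vectors of small rank in [rank_gap]. *)
Lemma opbd_gap L (T : V -> L) (P : set V) c : bounded_op T ->
  (forall a x, P x -> P (a *: x)) ->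
  (forall z y, (forall k : nat, P (z k)) ->
     (forall e, 0 < e -> exists k, hnorm (z k - y) < e) -> P y) ->
  (forall x, P x -> x != 0 -> hnorm (T x) < c * hnorm x) ->
  exists2 c', c' < c & forall x, P x -> hnorm (T x) <= c' * hnorm x.
Proof.
move=> /bounded_opP[lT [M M0 TM]] PZ Pcl Pc; apply: contrapT => hc.
have h k : exists u, [/\ P u, hnorm u = 1 & c - k.+1%:R^-1 < hnorm (T u)].
  apply: contrapT => hk; apply: hc; exists (c - k.+1%:R^-1).
    by rewrite gtrBl natSinv_gt0.
  move=> x Px; rewrite leNgt; apply/negP => xk; apply: hk.
  have [a [a1 ac]] := unit_gt lT xk.
  by exists (a *: x); split=> //; exact: PZ.
have [u Hu] := choice h.
have [|f [y [fk Hf]]] := @bw_hpow u 1; first by move=> k; have [_ ->] := Hu k.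
have Py : P y.
  apply: (Pcl (u \o f)) => [k|e /Hf[N HN]]; first by have [] := Hu (f k).
  by exists N; apply: HN.
have y1 : hnorm y = 1.
  apply/eqP; rewrite eq_le; apply/andP; split; apply: le_of_le_add => e e0.
    have [N HN] := Hf e e0; have [_ <- _] := Hu (f N).
    by rewrite (le_trans (hnormB_le _ (u (f N)))) // lerD2l hnormBC ltW // HN.
  have [N HN] := Hf e e0; have [_ <- _] := Hu (f N).
  by rewrite (le_trans (hnormB_le _ y)) // lerD2l ltW // HN.
have y0 : y != 0 by rewrite -hnorm_gt0 y1.
have := Pc _ Py y0; rewrite y1 mulr1 ltNge => /negP; apply.
apply: le_of_le_add => e e0; have e2 : 0 < e / 2 by rewrite divr_gt0.
have M1 : 0 < M + 1 by rewrite ltr_wpDl.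
have [N1 HN1] := natSinv_small e2.
have [N2 HN2] := Hf _ (divr_gt0 e2 M1).
pose k := maxn N1 N2; have [_ _ hk] := Hu (f k).
have h1 : (f k).+1%:R^-1 <= e / 2.
  by apply: HN1; rewrite (leq_trans _ (fk k)) // leq_maxl.
have h2 : hnorm (T (u (f k))) <= hnorm (T y) + e / 2.
  rewrite (le_trans (hnormB_le _ (T y))) // lerD2l -lin_opB // (le_trans (TM _)) //.
  have := HN2 k (leq_maxr _ _); rewrite ltr_pdivlMr // => h3.
  apply: le_trans (ltW h3); rewrite mulrC ler_wpM2l ?hnorm_ge0 // lerDl //.
rewrite ltrBlDr in hk; apply: le_trans (ltW hk) _.
by rewrite [e in leRHS]splitr addrA lerD.
Qed.

Lemma norm_attained L (T : V -> L) : bounded_op T -> (exists x : V, x != 0) ->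
  exists2 x, x != 0 & opbd T (hnorm (T x) / hnorm x).
Proof.
move=> bT [x0 nx0]; apply: contrapT => hT.
have c0 := opnorm_ge0 bT; have Tc := opnorm_bd bT.
have att x : x != 0 -> hnorm (T x) < opnorm T * hnorm x.
  move=> nx; rewrite lt_neqAle Tc andbT; apply/eqP => E; apply: hT.
  by exists x => //; rewrite E mulfK // hnorm_eq0.
have [c' cc' Tc'] := opbd_gap bT (fun _ _ _ => I) (fun _ _ _ _ => I) (fun x (_ : setT x) => att x).
have c'0 : 0 <= c'.
  have := le_trans (hnorm_ge0 _) (Tc' x0 I); rewrite pmulr_lge0 // hnorm_gt0 //.
have : opnorm T <= c' by apply: opnorm_le => // x; exact: Tc'.
by rewrite leNgt cc'.
Qed.

End Euclidean.
End Compactness.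

(** * Direct sums *)

(* Conversion would otherwise unfold the norms of iterated Hilbert sums. *)
Opaque hnorm sqn.

Section DirectSums.
Variable R : realType.
Implicit Types (H L : hilbert R).

Section RealUsum.
Variable I : choiceType.
Implicit Types (a b : I -> R).

Lemma is_usum0 : is_usum (fun _ : I => 0 : R) 0.
Proof.
by move=> e e0; exists fset0 => F _; rewrite big1 // subr0 normr0.
Qed.

Lemma is_usum_sum (J : Type) (r : seq J) (a : J -> I -> R) (s : J -> R) :
  (forall j, is_usum (a j) (s j)) ->
  is_usum (fun i => \sum_(j <- r) a j i) (\sum_(j <- r) s j).
Proof.
move=> h; elim: r => [|j r IH].
  rewrite big_nil (_ : (fun _ => _) = fun=> 0); first exact: is_usum0.
  by apply: funext => i; rewrite big_nil.
rewrite big_cons (_ : (fun _ => _) = fun i => a j i + \sum_(j <- r) a j i).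
  exact: is_usumD.
by apply: funext => i; rewrite big_cons.
Qed.

Lemma is_usum_le a b s t : (forall i, 0 <= a i) -> (forall i, a i <= b i) ->
  is_usum a s -> is_usum b t -> s <= t.
Proof.
move=> a0 ab sa tb; rewrite leNgt -subr_gt0; apply/negP => /sa[F].
move=> /(_ _ (fsubset_refl F)); rewrite ltr_norml => /andP[_].
rewrite ltrD2l ltrN2 ltNge => /negP; apply.
apply: le_trans (ler_sum _ (fun i _ => ab i)) _.
apply: ge0_is_usum tb (num_real _) F => i; exact: le_trans (a0 i) (ab i).
Qed.
End RealUsum.

Lemma ler_of_sqr (x y : R) : 0 <= x -> 0 <= y -> x ^+ 2 <= y ^+ 2 -> x <= y.
Proof. by move=> x0 y0; rewrite ler_pXn2r. Qed.

Lemma eqr_of_sqr (x y : R) : 0 <= x -> 0 <= y -> x ^+ 2 = y ^+ 2 -> x = y.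
Proof. by move=> x0 y0 /eqP; rewrite eqrXn2 // => /eqP. Qed.

Lemma eq_hnorm H L (x : H) (y : L) : hdot x x = hdot y y -> hnorm x = hnorm y.
Proof.
move=> xy; apply: eqr_of_sqr (hnorm_ge0 _) (hnorm_ge0 _) _; apply: (@complexI R).
exact: etrans (esym (hdotxx x)) (etrans xy (hdotxx y)).
Qed.

Variables (I : choiceType) (K : I -> hilbert R).

(** Identifies the J-th power of the sum of the K_i with the sum of their J-th powers, so that
    matrices can be estimated block by block. *)
Definition crd (J : finType) i (x : hpow J (hilbert_sum K)) : hpow J (K i) :=
  hvec (fun j => (x j : hilbert_sum K) i).

Lemma crd_usum (J : finType) (x : hpow J (hilbert_sum K)) :
  is_usum (fun i => hnorm (crd i x) ^+ 2) (hnorm x ^+ 2).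
Proof.
rewrite [X in is_usum _ X](hnorm_hpow x).
have E : (fun i => hnorm (crd i x) ^+ 2) =
    fun i => \sum_j hnorm ((x j : hilbert_sum K) i) ^+ 2.
  by apply: funext => i; rewrite (hnorm_hpow (crd i x)).
rewrite E; apply: is_usum_sum => j; rewrite (hnorm_sqr (x j)).
have {}E : (fun i => hnorm ((x j : hilbert_sum K) i) ^+ 2) =
    fun i => sqn (@hdot R (K i)) ((x j : hilbert_sum K) i).
  by apply: funext => i; rewrite hnorm_sqr.
rewrite E; exact: hsum_sqn.
Qed.

Lemma hnorm_crd (J : finType) i (x : hpow J (hilbert_sum K)) : hnorm (crd i x) <= hnorm x.
Proof.
apply: ler_of_sqr (hnorm_ge0 _) (hnorm_ge0 _) _.
have := ge0_is_usum (fun i => sqr_ge0 _) (crd_usum x) (num_real _) [fset i]%fset.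
by rewrite big_seq_fset1.
Qed.

Lemma crd_bound (J J' : finType) (x : hpow J (hilbert_sum K)) (y : hpow J' (hilbert_sum K)) c :
  0 <= c -> (forall i, hnorm (crd i x) <= c * hnorm (crd i y)) ->
  hnorm x <= c * hnorm y.
Proof.
move=> c0 h; apply: ler_of_sqr (hnorm_ge0 _) (mulr_ge0 c0 (hnorm_ge0 _)) _; rewrite exprMn.
apply: is_usum_le (crd_usum x) (is_usumZ (c ^+ 2) (crd_usum y)) => i; first exact: sqr_ge0.
by rewrite -exprMn ler_pXn2r // nnegrE ?mulr_ge0 ?hnorm_ge0.
Qed.

Lemma hsum_bound (x y : hilbert_sum K) c :
  0 <= c -> (forall i, hnorm (x i) <= c * hnorm (y i)) -> hnorm x <= c * hnorm y.
Proof.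
move=> c0 h; apply: ler_of_sqr (hnorm_ge0 _) (mulr_ge0 c0 (hnorm_ge0 _)) _; rewrite exprMn.
rewrite [leLHS](hnorm_sqr x).
rewrite [X in _ * X](hnorm_sqr y).
apply: is_usum_le (hsum_sqn x) (is_usumZ (c ^+ 2) (hsum_sqn y)) => i; first exact: sqn_ge0.
by rewrite -(hnorm_sqr (x i)) -(hnorm_sqr (y i)) -exprMn ler_pXn2r // nnegrE ?mulr_ge0 ?hnorm_ge0.
Qed.

Section DirectSumOp.
Variables (T : forall i, K i -> K i) (c : R).
Hypotheses (c0 : 0 <= c) (T_lin : forall i, linear (@T i)) (Tc : forall i, opbd (@T i) c).

Lemma direct_sum_opE (f : hilbert_sum K) i : direct_sum_op T f i = @T i (f i).
Proof.
rewrite /direct_sum_op; case: pselect => // h; exfalso; apply: h.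
have [M HM] := hsumP f; exists (c ^+ 2 * M) => F.
apply: (@le_trans _ _ (\sum_(i <- F) c ^+ 2 * hnorm (f i) ^+ 2)).
  apply: ler_sum => j _; rewrite -exprMn.
  by rewrite ler_pXn2r ?nnegrE ?mulr_ge0 ?hnorm_ge0 //; exact: Tc.
by rewrite -mulr_sumr ler_wpM2l ?sqr_ge0.
Qed.

Lemma direct_sum_op_bd : bounded_op (direct_sum_op T).
Proof.
apply/bounded_opP; split=> [a x y|].
  apply: hsum_ext => i; rewrite hsum_addE hsum_scaleE !direct_sum_opE.
  by rewrite hsum_addE hsum_scaleE T_lin.
exists c => // x; apply: hsum_bound => // i; rewrite direct_sum_opE; exact: Tc.
Qed.
End DirectSumOp.

Section DirectSumRep.
Variables (H : hilbert R) (A : set (H -> H)).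
Variables (pi : forall i, (H -> H) -> (K i -> K i)).
Hypotheses (A_alg : cstar_subalgebra A) (A1 : A idfun).
Hypothesis pi_rep : forall i, representation A (@pi i).

Lemma direct_sum_repE a f i : A a -> direct_sum_rep pi a f i = @pi i a (f i).
Proof.
move=> Aa; have /bounded_opP[_ [c c0 ac]] := alg_bd A_alg Aa.
by apply: (direct_sum_opE c0) => j; exact: (rep_contractive A_alg A1).
Qed.

Lemma direct_sum_rep_bd a : A a -> bounded_op (direct_sum_rep pi a).
Proof.
move=> Aa; have /bounded_opP[_ [c c0 ac]] := alg_bd A_alg Aa.
apply: (direct_sum_op_bd c0) => j; last exact: (rep_contractive A_alg A1).
by have [] := rep_bd (pi_rep j) Aa.
Qed.

Lemma crd_opmx (P Q : finType) (T : P -> Q -> H -> H) x i :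
  (forall p q, A (T p q)) ->
  crd i (opmx (fun p q => direct_sum_rep pi (T p q)) x) =
  opmx (fun p q => @pi i (T p q)) (crd i x).
Proof.
move=> hT; apply: hpowP => p; rewrite opmxE /crd /=.
have E (r : seq Q) (f : Q -> hilbert_sum K) :
    (\sum_(q <- r) f q : hilbert_sum K) i = \sum_(q <- r) f q i.
  by apply: (big_morph (fun z : hilbert_sum K => z i)) => // u v; exact: hsum_addE.
rewrite E; apply: eq_bigr => q _; exact: direct_sum_repE.
Qed.

(** Vectors of one block embed isometrically, which bounds each block; conversely the squared norms
    of the blocks add up. *)
Lemma direct_sum_mx_opbd (P Q : finType) (T : P -> Q -> H -> H) c :
  (forall p q, A (T p q)) -> 0 <= c ->
  opbd (opmx (fun p q => direct_sum_rep pi (T p q))) c <->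
  forall i, opbd (opmx (fun p q => @pi i (T p q))) c.
Proof.
move=> hT c0; split=> [h i x|h x]; last first.
  by apply: crd_bound => // i; rewrite crd_opmx //; exact: h.
pose y : hpow Q (hilbert_sum K) := hvec (fun q => hinj i (x q)).
have yi : crd i y = x by apply: hpowP => q; exact: hinj_same.
rewrite -yi -crd_opmx // yi; apply: le_trans (hnorm_crd _ _) _.
suff <- : hnorm y = hnorm x by exact: h.
apply: eqr_of_sqr (hnorm_ge0 _) (hnorm_ge0 _) _.
apply: etrans (hnorm_hpow y) (etrans _ (esym (hnorm_hpow x))).
by apply: eq_bigr => q _; congr (_ ^+ 2); exact: hnorm_hinj.
Qed.

End DirectSumRep.
End DirectSums.

(** * Block decompositions *)

Section Blocks.
Variables (R : realType) (H : hilbert R) (A : set (H -> H)).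
Variables (I : choiceType) (E : I -> hilbert R).
Variables (psi : forall i, (H -> H) -> (E i -> E i)).

(* [pr i] and [inc i] are the coordinate projection onto and the inclusion of
   the i-th summand, transported to H along id = (+) psi_i. *)
Record block_decomposition (pr : forall i, H -> E i) (inc : forall i, E i -> H) : Prop := {
  pr_linear : forall i, linear (pr i);
  inc_linear : forall i, linear (@inc i);
  hdot_inc : forall i (v : E i) x, hdot (inc i v) x = hdot v (pr i x);
  pr_inc : forall i (v : E i), pr i (inc i v) = v;
  pr_inc_neq : forall i j (v : E i), j != i -> pr j (inc i v) = 0;
  pr_inj : forall x y, (forall i, pr i x = pr i y) -> x = y;
  pr_act : forall a i x, A a -> pr i (a x) = @psi i a (pr i x);
  pr_bound : forall (J K : finType) (x : hpow J H) (y : hpow K H) c, 0 <= c ->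
    (forall i, hnorm (hvec (fun j => pr i (x j))) <=
       c * hnorm (hvec (fun k => pr i (y k)))) ->
    hnorm x <= c * hnorm y }.

(** The unitary is used only here. [pr_bound] retains what is needed of the infinite sum of squared
    block norms: bounds for operator matrices, rectangular ones included, can be checked on each
    block. *)
Lemma block_decomposition_exists :
  cstar_subalgebra A -> A idfun -> (forall i, representation A (@psi i)) ->
  unitarily_equivalent A (fun a => a) (direct_sum_rep psi) ->
  exists pr inc, block_decomposition pr inc.
Proof.
move=> A_alg A1 psi_rep [U [lU [V UK VK] U_dot] U_int].
have lV : linear V.
  by move=> a x y; apply: (can_inj UK); rewrite VK lU !VK.
have VUdot x y : hdot (V x) y = hdot x (U y) by rewrite -U_dot VK.
have U_norm x : hnorm (U x) = hnorm x.
  by apply: eq_hnorm; rewrite U_dot.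
exists (fun i x => U x i), (fun i v => V (hinj i v)); split.
- by move=> i a x y; rewrite lU hsum_addE hsum_scaleE.
- by move=> i a x y; rewrite hinj_linear lV.
- by move=> i v x; rewrite VUdot hdot_hinj.
- by move=> i v; rewrite VK hinj_same.
- by move=> i j v ji; rewrite VK hinj_neq.
- by move=> x y h; apply: (can_inj UK); exact: hsum_ext.
- move=> a i x Aa; have := congr1 (fun f => f x) (U_int a Aa) => /= ->.
  exact: (direct_sum_repE A_alg A1).
- move=> J K x y c c0 h.
  have nU (P : finType) (z : hpow P H) :
      hnorm (hvec (fun p => U (z p)) : hpow P (hilbert_sum E)) = hnorm z.
    apply: eqr_of_sqr (hnorm_ge0 _) (hnorm_ge0 _) _.
    apply: etrans (hnorm_hpow _) (etrans _ (esym (hnorm_hpow z))).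
    by apply: eq_bigr => q _; congr (_ ^+ 2); exact: U_norm.
  rewrite -(nU J x) -(nU K y); exact: crd_bound.
Qed.

Variables (pr : forall i, H -> E i) (inc : forall i, E i -> H).
Hypothesis blocks : block_decomposition pr inc.
Hypothesis psi_rep : forall i, representation A (@psi i).

Lemma pr_lin i : linear (pr i). Proof. exact: (pr_linear blocks). Qed.
Lemma inc_lin i : linear (@inc i). Proof. exact: (inc_linear blocks). Qed.

Lemma hnorm_inc i (v : E i) : hnorm (inc v) = hnorm v.
Proof.
by apply: eq_hnorm; rewrite (hdot_inc blocks) (pr_inc blocks).
Qed.

Lemma act_inc a i (v : E i) : A a -> a (inc v) = inc (@psi i a v).
Proof.
move=> Aa; apply: (pr_inj blocks) => j; rewrite (pr_act blocks) //.
have [e|ji] := eqVneq j i; first by subst j; rewrite !(pr_inc blocks).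
rewrite !(pr_inc_neq blocks) //.
exact: (lin_op0 (rep_bd (psi_rep j) Aa).1).
Qed.

Section Powers.
Variables (J K : finType).
Implicit Types (x y : hpow K H).

Definition prn i x : hpow K (E i) := hvec (fun j => pr i (x j)).
Definition incn i (v : hpow K (E i)) : hpow K H := hvec (fun j => inc (v j)).

Lemma prnB i x y : prn i (x - y) = prn i x - prn i y.
Proof. by apply: hpowP => k; rewrite hpowB /prn /= -(lin_opB (@pr_lin i)) -hpowB. Qed.

Lemma incnB i (v w : hpow K (E i)) : incn (v - w) = incn v - incn w.
Proof. by apply: hpowP => k; rewrite hpowB /incn /= -(lin_opB (@inc_lin i)) -hpowB. Qed.

Lemma hdot_incn i (v : hpow K (E i)) x : hdot (incn v) x = hdot v (prn i x).
Proof.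
rewrite (hdot_hpow (incn v)) (hdot_hpow v); apply: eq_bigr => k _.
exact: (hdot_inc blocks).
Qed.

Lemma prn_incn i (v : hpow K (E i)) : prn i (incn v) = v.
Proof. by apply: hpowP => k; exact: (pr_inc blocks). Qed.

Lemma hnorm_incn i (v : hpow K (E i)) : hnorm (incn v) = hnorm v.
Proof.
by apply: eq_hnorm; rewrite hdot_incn prn_incn.
Qed.

Lemma incn_pythagoras i x :
  hnorm x ^+ 2 = hnorm (prn i x) ^+ 2 + hnorm (x - incn (prn i x)) ^+ 2.
Proof.
have xE : x = incn (prn i x) + (x - incn (prn i x)) by rewrite addrC subrK.
apply: etrans (congr1 (fun z : hpow K H => hnorm z ^+ 2) xE) _.
apply: etrans (hnormD_sqr _ _) _.
have h0 : hdot (incn (prn i x)) (x - incn (prn i x)) = 0.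
  by rewrite hdot_incn prnB prn_incn subrr hdot0r.
rewrite h0 [2 * _](mulr0 (2 : R)) addr0.
exact: (congr1 (fun t => t ^+ 2 + _) (hnorm_incn _)).
Qed.

End Powers.

Section PowerOperators.
Variables (J K : finType) (T : J -> K -> H -> H).
Hypothesis T_A : forall j k, A (T j k).

Lemma prn_opmx i x :
  prn i (opmx T x) = opmx (fun j k => @psi i (T j k)) (prn i x).
Proof.
apply: hpowP => j; rewrite opmxE.
apply: etrans (lin_op_sum (@pr_lin i) _ _ _) _.
by apply: eq_bigr => k _; rewrite (pr_act blocks).
Qed.

Lemma opmx_incn i (v : hpow K (E i)) :
  opmx T (incn v) = incn (opmx (fun j k => @psi i (T j k)) v).
Proof.
apply: hpowP => j; rewrite opmxE.
apply: etrans _ (esym (lin_op_sum (@inc_lin i) _ _ _)).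
by apply: eq_bigr => k _; rewrite act_inc.
Qed.

Lemma hnorm_opmx_incn i (v : hpow K (E i)) :
  hnorm (opmx T (incn v)) = hnorm (opmx (fun j k => @psi i (T j k)) v).
Proof.
exact: etrans (congr1 _ (opmx_incn v)) (hnorm_incn (opmx _ v)).
Qed.

Lemma blocks_opbd c : 0 <= c ->
  opbd (opmx T) c <-> forall i, opbd (opmx (fun j k => @psi i (T j k))) c.
Proof.
move=> c0; split=> [Tc i v|Tc x].
  by rewrite -hnorm_opmx_incn -(hnorm_incn v); exact: Tc.
apply: (pr_bound blocks) => // i; rewrite -/(prn i _) prn_opmx; exact: Tc.
Qed.

Lemma blocks_opbd_except i x c : 0 <= c ->
  (forall j, j != i -> opbd (opmx (fun p q => @psi j (T p q))) c) ->
  prn i x = 0 -> hnorm (opmx T x) <= c * hnorm x.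
Proof.
move=> c0 Tc xi; apply: (pr_bound blocks) => // j; rewrite -/(prn j _) prn_opmx.
have [e|ji] := eqVneq j i; last exact: Tc.
have [lT _] : bounded_op (opmx (fun p q => @psi i (T p q))).
  by apply: opmx_bd => p q; exact: (rep_bd (psi_rep i)).
by subst j; rewrite xi (lin_op0 lT) hnorm0 mulr_ge0 // hnorm_ge0.
Qed.

End PowerOperators.
End Blocks.

Lemma attain_limit (R : realType) (V W : hilbert R) (T : V -> W) c x :
  bounded_op T ->
  (forall e, 0 < e -> exists v, [/\ hnorm v = 1, hnorm (v - x) < e & c - e < hnorm (T v)]) ->
  hnorm x = 1 /\ c <= hnorm (T x).
Proof.
move=> /bounded_opP[lT [M M0 TM]] h; split.
  apply/eqP; rewrite eq_le; apply/andP; split; apply: le_of_le_add => e /h[v [<- vx _]].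
    by rewrite (le_trans (hnormB_le _ v)) // lerD2l [leLHS]hnormBC ltW.
  by rewrite (le_trans (hnormB_le _ x)) // lerD2l ltW.
apply: le_of_le_add => e e0; have M1 : 0 < M + 1 by rewrite ltr_wpDl.
have [v [_ vx cv]] := h _ (divr_gt0 e0 M1).
have h1 : hnorm (T v) <= hnorm (T x) + M * (e / (M + 1)).
  rewrite (le_trans (hnormB_le _ (T x))) // lerD2l -lin_opB // (le_trans (TM _)) //.
  by rewrite ler_wpM2l // ltW.
rewrite ltrBlDr in cv; apply: le_trans (ltW cv) _.
apply: le_trans (lerD h1 (lexx _)) _; rewrite -addrA lerD2l -{2}[e / _]mul1r -mulrDl.
by rewrite mulrCA divff ?mulr1 // gt_eqF.
Qed.

(** * Compressions *)

Section SquareMatrices.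
Variables (R : realType) (H L : hilbert R).

Lemma hnorm_reindex (V : hilbert R) (J J' : finType) (f : J' -> J) (x : hpow J V) : bijective f ->
  hnorm (hvec (fun b => x (f b))) = hnorm x.
Proof.
move=> bf; apply: eq_hnorm; rewrite (hdot_hpow (hvec _)) (hdot_hpow x).
by rewrite (reindex f) //; exact: onW_bij.
Qed.

Lemma opmx_reindex (J K J' K' : finType) (f : J' -> J) (g : K' -> K)
    (T : J -> K -> H -> L) (x : hpow K H) : bijective g ->
  opmx (fun a b => T (f a) (g b)) (hvec (fun b => x (g b))) =
  hvec (fun a => opmx T x (f a)).
Proof.
move=> bg; apply: hpowP => a; rewrite opmxE.
by apply: esym; apply: reindex; exact: onW_bij.
Qed.

Variables (J K : finType).

(** Complete isometry is tested on square matrices indexed by ordinals; padding by zeros and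
    renumbering gives a rectangular matrix that form. *)
Definition mxsq (T : J -> K -> H -> L) : 'M[H -> L]_#|{: J + K}| :=
  \matrix_(a, b) mxpad T (enum_val a) (enum_val b).

Lemma hnorm_mxsq T (x : hpow 'I_#|{: J + K}| H) :
  hnorm (opmx (fun a b => mxsq T a b) x) =
  hnorm (opmx T (hvec (fun k => x (enum_rank (inr k))))).
Proof.
pose z : hpow (J + K)%type H := hvec (fun p => x (enum_rank p)).
have xz : x = hvec (fun a => z (enum_val a)).
  by apply: hpowP => a; rewrite /z /= enum_valK.
have bij_ev : bijective (@enum_val {: J + K} {: J + K}) by exact: enum_val_bij.
have -> : (fun a b => mxsq T a b) = fun a b => mxpad T (enum_val a) (enum_val b).
  by apply: funext => a; apply: funext => b; rewrite mxE.
rewrite [in LHS]xz (opmx_reindex _ _ _ bij_ev).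
by rewrite (hnorm_reindex (opmx (mxpad T) z) bij_ev) hnorm_mxpad.
Qed.

Lemma hnorm_inr_le (x : hpow 'I_#|{: J + K}| H) :
  hnorm (hvec (fun k : K => x (enum_rank (inr k)))) <= hnorm x.
Proof.
pose z : hpow (J + K)%type H := hvec (fun p => x (enum_rank p)).
have bij_er : bijective (@enum_rank {: J + K}) by exact: enum_rank_bij.
rewrite -(hnorm_reindex x bij_er).
apply: ler_of_sqr (hnorm_ge0 _) (hnorm_ge0 _) _.
rewrite (hnorm_hpow (hvec _)) [leRHS](hnorm_hpow (hvec _)) big_sumType /=.
by rewrite lerDr sumr_ge0 // => j _; rewrite sqr_ge0.
Qed.

Lemma mxsq_opbd T c : 0 <= c ->
  opbd (opmx (fun a b => mxsq T a b)) c <-> opbd (opmx T) c.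
Proof.
move=> c0; split=> h x; last first.
  rewrite hnorm_mxsq; apply: le_trans (h _) _; rewrite ler_wpM2l //.
  exact: hnorm_inr_le.
apply: (opbd_mxpad T c0).2 x => z.
have bij_ev : bijective (@enum_val {: J + K} {: J + K}) by exact: enum_val_bij.
have := h (hvec (fun a => z (enum_val a))).
rewrite (hnorm_reindex z bij_ev) hnorm_mxsq hnorm_mxpad.
move=> zc; apply: (eq_ind _ (fun t => hnorm (opmx T t) <= c * hnorm z) zc).
by apply: hpowP => k /=; rewrite enum_rankK.
Qed.
End SquareMatrices.

Section Projections.
Variables (R : realType) (H : hilbert R) (G : set H) (P : H -> H).
Hypotheses (G_sub : closed_subspace G) (G_proj : orthogonal_projection G P).

Lemma subspaceZ a x : G x -> G (a *: x).
Proof. by have [G0 GD _] := G_sub; move=> Gx; rewrite -[_ *: _]addr0; exact: GD. Qed.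

Lemma subspaceD x y : G x -> G y -> G (x + y).
Proof. by have [_ GD _] := G_sub; move=> Gx Gy; rewrite -[x]scale1r; exact: GD. Qed.

Lemma subspaceB x y : G x -> G y -> G (x - y).
Proof. by move=> Gx Gy; rewrite -scaleN1r; apply/subspaceD/subspaceZ. Qed.

(** [orthogonal_projection] does not ask for linearity; the defect of linearity lies in G and is
    also orthogonal to G. *)
Lemma proj_linear : linear P.
Proof.
move=> a x y; apply/eqP; rewrite -subr_eq0; apply/eqP.
set d := _ - _.
have GP z : G (P z) by have [] := G_proj z.
have Gd : G d by apply: subspaceB => //; apply: subspaceD => //; exact: subspaceZ.
apply/eqP; rewrite -hdot_eq0; apply/eqP.
have -> : hdot d d = a * hdot (x - P x) d + hdot (y - P y) d
    - hdot (a *: x + y - P (a *: x + y)) d.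
  rewrite {1}/d !hdotBl !hdotDl !hdotZl; ring.
have [_ ->//] := G_proj x; have [_ ->//] := G_proj y.
by have [_ ->//] := G_proj (a *: x + y); rewrite mulr0 addr0 subr0.
Qed.

Lemma proj_le x : hnorm (P x) <= hnorm x.
Proof.
have [Gx xG] := G_proj x.
apply: ler_of_sqr (hnorm_ge0 _) (hnorm_ge0 _) _.
have E : hnorm (P x + (x - P x)) ^+ 2 = hnorm x ^+ 2 by rewrite addrC subrK.
rewrite -E hnormD_sqr hdotC (xG _ Gx) conjC0 /= mulr0 addr0 lerDl sqr_ge0 //.
Qed.

Lemma proj_bd : bounded_op P.
Proof. by split; [exact: proj_linear|exists 1 => x; rewrite mul1r proj_le]. Qed.

Lemma opmx_proj_le (L : hilbert R) (J K : finType) (T : J -> K -> L -> H) x :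
  hnorm (opmx (fun j k => P \o T j k) x) <= hnorm (opmx T x).
Proof.
apply: ler_of_sqr (hnorm_ge0 _) (hnorm_ge0 _) _.
rewrite [leLHS]hnorm_hpow [leRHS]hnorm_hpow; apply: ler_sum => j _.
rewrite ler_pXn2r ?nnegrE ?hnorm_ge0 // !opmxE.
have -> : \sum_k (P \o T j k) (x k) = P (\sum_k T j k (x k)).
  by rewrite (lin_op_sum proj_linear).
exact: proj_le.
Qed.

(** As P is contractive, a bound for T on G^K bounds the compression too, and by complete isometry
    the compression has the norm of T on all of H^K. The implication to [fully_compressed] uses its
    hypothesis on G only in this form. *)
Lemma compression_norming (S : set (H -> H)) (J K : finType) (T : J -> K -> H -> H) d :
  (forall s, S s -> bounded_op s) -> S 0 ->
  completely_isometric_on S G (fun s => P \o s) -> (forall j k, S (T j k)) -> 0 <= d ->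
  (forall x : hpow K H, (forall k, G (x k)) -> hnorm (opmx T x) <= d * hnorm x) ->
  opbd (opmx T) d.
Proof.
move=> S_bd S0 ci ST d0 Td; apply/(mxsq_opbd T d0).
have mS a b : S (mxsq T a b).
  by rewrite mxE; case: (enum_val a) (enum_val b) => [j|j] [k|k] //=; exact: ST.
have := ci _ (mxsq T) mS => E.
have : mxnorm (mxsq T) <= d.
  rewrite -E; apply: mxnorm_on_le => //; first by have [] := G_sub.
  move=> x Gx; rewrite (_ : (fun i j => _) = fun i j => P \o mxsq T i j); last first.
    by apply: funext => a; apply: funext => b; rewrite mxE.
  apply: le_trans (opmx_proj_le _ _) _; rewrite hnorm_mxsq.
  apply: le_trans (Td _ _) _; first by move=> k; exact: Gx.
  by rewrite ler_wpM2l // hnorm_inr_le.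
by move=> h; apply: opbdW h _; apply: mxnorm_bd => a b; exact: S_bd.
Qed.
End Projections.

(** * Rank and invariant subspaces *)

Section RowSpaces.
Variable R : realType.
Implicit Types (L : hilbert R).

Section Fixed.
Variables (m : nat) (K : finType).
Local Notation E := (euclidean R m).
Local Notation V := (hpow K E).

Lemma linear_hpow_bd L (T : V -> L) : linear T -> bounded_op T.
Proof.
move=> lT; apply/bounded_opP; split=> //.
have h k : exists c : R, 0 <= c /\ opbd (fun v : E => T (hinj (K := fun=> E) k v)) c.
  have lk : linear (fun v : E => T (hinj (K := fun=> E) k v)).
    by move=> a x y; rewrite hinj_linear lT.
  by have /bounded_opP[_ [c c0 Tc]] := linear_euclid_bd lk; exists c.
have [c Hc] := choice h.
exists (\sum_k c k); first by apply: sumr_ge0 => k _; have [] := Hc k.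
move=> x; rewrite {1}[x]hpow_hinj_sum (lin_op_sum lT).
apply: le_trans (hnorm_sum _ _ _) _; rewrite mulr_suml; apply: ler_sum => k _.
have [c0 Tc] := Hc k; apply: le_trans (Tc _) _; rewrite ler_wpM2l //.
exact: hnorm_coord.
Qed.

Definition vmx (v : V) : 'M[R[i]]_(#|K|, m) := \matrix_k (v (enum_val k) : 'rV_m).

Lemma vmx_sub p (v : V) (W : 'M[R[i]]_(p, m)) :
  reflect (forall k, ((v k : 'rV_m) <= W)%MS) (vmx v <= W)%MS.
Proof.
apply: (iffP row_subP) => [h k|h k]; last by rewrite rowK.
by have := h (enum_rank k); rewrite rowK enum_rankK.
Qed.

Lemma vmx_linear : linear vmx.
Proof.
by move=> a x y; apply/row_matrixP => k; rewrite linearD linearZ /= !rowK hpowD hpowZ.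
Qed.

Lemma vmx_eq0 (v : V) : vmx v = 0 -> v = 0.
Proof.
move=> v0; apply: hpowP => k; apply/matrixP => a j; rewrite ord1.
have := congr1 (fun M : 'M_(_, _) => M (enum_rank k) j) v0.
by rewrite !mxE enum_rankK.
Qed.

(** [P] and [Q] compress the matrix of y to the identity of size d. If the same compression of u had
    a left kernel vector w, then w = -w F(u - y), which is impossible when F(u - y) is small. *)
Lemma rank_lsc (y : V) : exists2 e : R, 0 < e &
  forall u, hnorm (u - y) < e -> (\rank (vmx y) <= \rank (vmx u))%N.
Proof.
set d := \rank (vmx y).
pose P := pinvmx (col_base (vmx y)); pose Q := pinvmx (row_base (vmx y)).
have PQ : P *m vmx y *m Q = 1%:M.
  transitivity (P *m (col_base (vmx y) *m row_base (vmx y)) *m Q).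
    by rewrite mulmx_base.
  rewrite mulmxA /P mulVpmx ?col_base_full // mul1mx.
  by rewrite mulmxVp // row_base_free.
pose F (x : V) : hpow 'I_d (euclidean R d) :=
  hvec (fun a => row a (P *m vmx x *m Q) : euclidean R d).
have lF : linear F.
  move=> a x z; apply: hpowP => k; rewrite hpowD hpowZ /F /=.
  by rewrite vmx_linear mulmxDr mulmxDl -scalemxAr -scalemxAl linearP.
have /bounded_opP[_ [c c0 Fc]] := linear_hpow_bd lF.
have c1 : 0 < d%:R * c + 1 by rewrite ltr_wpDl // mulr_ge0.
exists (d%:R * c + 1)^-1; first by rewrite invr_gt0.
move=> u uy; apply: (@leq_trans (\rank (P *m vmx u *m Q))); last first.
  by rewrite (leq_trans (mxrankM_maxl _ _)) // mxrankM_maxr.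
suff /eqP -> : row_free (P *m vmx u *m Q) by [].
rewrite -kermx_eq0; apply/eqP/row_matrixP => b; rewrite row0.
have := mulmx_ker (P *m vmx u *m Q).
move=> /(congr1 (row b)); rewrite row_mul row0; set w : 'rV_d := row b _ => wu.
apply/eqP/negP => w0.
have wE : w = - \sum_a w 0 a *: (F (u - y) a : 'rV_d).
  have uyE : vmx u = vmx y + vmx (u - y).
    have := vmx_linear 1 y (u - y); rewrite !scale1r => <-.
    by rewrite addrC subrK.
  have : w *m (P *m vmx u *m Q) = w + \sum_a w 0 a *: (F (u - y) a : 'rV_d).
    rewrite uyE mulmxDr mulmxDl PQ mulmxDr mulmx1; congr (_ + _).
    by rewrite mulmx_sum_row.
  by rewrite wu => /esym/eqP; rewrite addr_eq0 => /eqP.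
have w1 : 0 < hnorm (w : euclidean R d).
  by rewrite hnorm_gt0; exact/negP.
have : hnorm (w : euclidean R d) <= d%:R * c * hnorm (u - y) * hnorm (w : euclidean R d).
  rewrite {1}wE hnorm_opp; apply: le_trans (hnorm_sum _ _ _) _.
  apply: (@le_trans _ _ (\sum_(a < d) hnorm (w : euclidean R d) * (c * hnorm (u - y)))).
    apply: ler_sum => a _; rewrite hnorm_scale ler_pM ?cabs_ge0 ?hnorm_ge0 //.
      exact: hnorm_coord_euclid.
    apply: le_trans (hnorm_coord _ _) _; exact: Fc.
  rewrite sumr_const card_ord -mulr_natl le_eqVlt; apply/orP; left; apply/eqP; ring.
rewrite -[leLHS]mul1r ler_pM2r // leNgt => /negP; apply.
move: uy; rewrite -[X in _ < X]mul1r ltr_pdivlMr // mulrC mulrDl mul1r.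
by apply: le_lt_trans; rewrite lerDl hnorm_ge0.
Qed.

Lemma rowspace_closed p (W : 'M[R[i]]_(p, m)) :
  closed_subspace (H := E) [set v | ((v : 'rV_m) <= W)%MS].
Proof.
split=> [|a x y xW yW|x h] /=; first exact: sub0mx.
  by rewrite addmx_sub // scalemx_sub.
pose f (v : E) : E := (v : 'rV_m) *m cokermx W.
have lf : linear f by move=> a u v; rewrite /f mulmxDl -scalemxAl.
have /bounded_opP[_ [c c0 fc]] := linear_euclid_bd lf.
rewrite submxE; apply/eqP; apply: (hnorm_le0_eq (x := f x) c0) => e e0.
have [y yW xy] := h e e0.
have -> : f x = f (x - y).
  rewrite (lin_opB lf); move: yW => /=; rewrite submxE => /eqP fy.
  by rewrite [f y]fy subr0.
by apply: le_trans (fc _) _; rewrite ler_wpM2l // ltW.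
Qed.

(** Vectors are rows and matrices act on the right, so products are reversed, as in
    [mxof_psi_comp]. *)
Definition mxof (T : E -> E) : 'M[R[i]]_m := \matrix_a (T (delta_mx 0 a) : 'rV_m).

Lemma mxofE T (v : E) : linear T -> (v : 'rV_m) *m mxof T = T v.
Proof.
move=> lT; rewrite mulmx_sum_row {2}[v]row_sum_delta (lin_op_sum lT).
by apply: eq_bigr => a _; rewrite rowK (lin_opZ lT).
Qed.

(** A finite family whose matrices span a space of maximal dimension spans every [F x]. The
    conclusion is given as inclusions of row spaces, the form in which it is applied: what maps U
    into W for the family does so for all of D. *)
Lemma finite_spanning (X : Type) (F : X -> E -> E) (D : set X) : D !=set0 ->
  (forall x, D x -> linear (F x)) ->
  exists q (s : 'I_q -> X), (forall k, D (s k)) /\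
    forall p (U : 'M_(p, m)) p' (W : 'M_(p', m)),
     (forall k v, ((v : 'rV_m) <= U)%MS -> ((F (s k) v : 'rV_m) <= W)%MS) ->
     forall x, D x -> forall v, ((v : 'rV_m) <= U)%MS -> ((F x v : 'rV_m) <= W)%MS.
Proof.
move=> [x0 Dx0] lF.
pose Fam q (s : 'I_q -> X) := [seq mxof (F (s k)) | k : 'I_q].
pose P d := `[< exists q (s : 'I_q -> X), (forall k, D (s k)) /\ \dim <<Fam q s>> = d >].
have exP : exists d, P d.
  by exists (\dim <<Fam 1 (fun=> x0)>>); apply/asboolP; exists 1, (fun=> x0).
have Pub d : P d -> (d <= \dim {:'M[R[i]]_m})%N.
  by move=> /asboolP[q [s [_ <-]]]; exact/dimvS/subvf.
have [d /asboolP[q [s [sD sd]]] dmax] := ex_maxnP exP Pub.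
exists q, s; split=> // p U p' W sUW x Dx v vU.
pose s' (k : 'I_q.+1) := if unlift ord0 k is Some k' then s k' else x.
have s'D k : D (s' k) by rewrite /s'; case: unliftP.
have s'E : Fam q.+1 s' = mxof (F x) :: Fam q s.
  rewrite /Fam /image_mem enum_ordSl /= {1}/s' unlift_none -map_comp; congr (_ :: _).
  by apply: eq_map => k /=; rewrite /s' liftK.
have xs : mxof (F x) \in <<Fam q s>>%VS.
  have sub : (<<Fam q s>> <= <<Fam q.+1 s'>>)%VS.
    by apply: sub_span => z; rewrite s'E inE orbC => ->.
  have /eqP -> : <<Fam q s>>%VS == <<Fam q.+1 s'>>%VS.
    rewrite eqEdim sub sd dmax //; apply/asboolP; exists q.+1, s'; split=> //.
  by rewrite s'E memv_span // inE eqxx.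
rewrite -(mxofE v (lF x Dx)).
have := xs; rewrite -[Fam q s]in_tupleE => /coord_span ->.
rewrite mulmx_sumr summx_sub // => k _; rewrite -scalemxAr scalemx_sub //.
have /mapP[k' _ ->] := mem_nth 0 (ltn_ord k : (k < size (Fam q s))%N).
by rewrite (mxofE v (lF _ (sD k'))); exact: sUW.
Qed.

End Fixed.

(** The elements a such that a and its adjoint both leave G invariant form a C*-subalgebra
    containing S. Requiring it of both makes this set closed under adjoints; norm closure uses that
    rho is contractive and G closed. *)
Lemma rep_invariant (H K : hilbert R) (S : set (H -> H)) (rho : (H -> H) -> (K -> K))
    (G : set K) : cstar_subalgebra (cstar S) -> cstar S idfun -> adjoint_closed S ->
  representation (cstar S) rho -> closed_subspace G ->
  (forall s, S s -> forall x, G x -> G (rho s x)) ->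
  forall a, cstar S a -> forall x, G x -> G (rho a x).
Proof.
move=> A_alg A1 S_adj rho_rep G_sub SG.
have [G0 GD G_cl] := G_sub.
pose B : set (H -> H) := [set a | [/\ cstar S a, forall x, G x -> G (rho a x) &
  forall a', cstar S a' -> adjoint a a' -> forall x, G x -> G (rho a' x)]].
suff BS : cstar_subalgebra B.
  move=> a /(_ B BS) Ba; have [|_ + _] := Ba; last by [].
  move=> s Ss; split=> [|x Gx|s' _ ss' x Gx]; first exact: sub_cstar.
    exact: SG.
  have [s1 Ss1 ss1] := S_adj s Ss; rewrite (adjoint_uniq ss' ss1); exact: SG.
have adj_ex a : cstar S a -> exists a', cstar S a' /\ adjoint a a'.
  by move=> /(alg_adj A_alg)[a' ? ?]; exists a'.
split=> [|a b [Aa Ga Ga'] [Ab Gb Gb']|a [Aa Ga Ga']|T bT h].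
- split=> [a [Aa _ _]||c a b [Aa Ga Ga'] [Ab Gb Gb']]; first exact: (alg_bd A_alg).
    split=> [|x Gx|a' Aa' h x Gx]; first exact: (alg0 A_alg).
      by rewrite (rep0 A_alg rho_rep).
    by rewrite -(adjoint_uniq (@adjoint0 R H H) h) (rep0 A_alg rho_rep).
  split=> [|x Gx|d Ad h x Gx]; first exact: (alg_lincomb A_alg).
    by rewrite (rep_lincomb rho_rep) //; apply: GD; [exact: Ga|exact: Gb].
  have [a' [Aa' aa']] := adj_ex a Aa; have [b' [Ab' bb']] := adj_ex b Ab.
  rewrite (adjoint_uniq h (adjoint_lincomb c aa' bb')) (rep_lincomb rho_rep) //.
  by apply: GD; [exact: Ga' aa' _ Gx|exact: Gb' bb' _ Gx].
- split=> [|x Gx|d Ad h x Gx]; first exact: (alg_comp A_alg).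
    by rewrite (rep_comp rho_rep) //=; exact/Ga/Gb.
  have [a' [Aa' aa']] := adj_ex a Aa; have [b' [Ab' bb']] := adj_ex b Ab.
  rewrite (adjoint_uniq h (adjoint_comp aa' bb')) (rep_comp rho_rep) //=.
  by apply: (Gb' _ Ab' bb'); apply: (Ga' _ Aa' aa').
- have [a' [Aa' aa']] := adj_ex a Aa; exists a' => //.
  split=> // [x Gx|d Ad h x Gx]; first exact: (Ga' _ Aa' aa').
  by rewrite (adjoint_uniq h (adjoint_sym aa')); exact: Ga.
- have AT : cstar S T.
    by have [_ _ _ A_cl] := A_alg; apply: A_cl => // e /h[a [Aa _ _] Ta]; exists a.
  have near (U : H -> H) (hU : cstar S U) :
      (forall e : R, 0 < e -> exists2 a, cstar S a /\ (forall x, G x -> G (rho a x)) & opbd (U - a) e) ->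
      forall x, G x -> G (rho U x).
    move=> hU' x Gx; apply: G_cl => e e0.
    have x1 : 0 < hnorm x + 1 by rewrite ltr_wpDl ?hnorm_ge0.
    have [a [Aa Ga] Ua] := hU' _ (divr_gt0 e0 x1).
    exists (rho a x); first exact: Ga.
    have := rep_contractive A_alg A1 rho_rep (algB A_alg hU Aa) (ltW (divr_gt0 e0 x1)) Ua x.
    rewrite (repB rho_rep hU Aa) => h1; apply: le_lt_trans h1 _.
    rewrite -mulrA gtr_pMr // mulrC ltr_pdivrMr // mul1r ltrDl //.
  have hd e : 0 < e -> exists2 a, B a & opbd (T - a) e.
    move=> e0; have [a Ba Ta] := h e e0; exists a => //.
    apply: opbdW (ltW Ta) _; apply: opnorm_bd; apply: bounded_opB => //.
    by have [Aa _ _] := Ba; exact: (alg_bd A_alg).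
  split=> // [|T' AT' TT']; apply: near => // e e0; have [a [Aa Ga Ga'] Ta] := hd e e0.
    by exists a.
  have [a' [Aa' aa']] := adj_ex a Aa; exists a'; first by split=> //; exact: (Ga' _ Aa' aa').
  apply: adjoint_bd (ltW e0) _ Ta.
  by move=> x y; rewrite !fctE hdotBl hdotBr TT' aa'.
Qed.

End RowSpaces.

(** * Block diagonal operator systems *)

Section BlockDiagonal.
Variables (R : realType) (H : hilbert R) (S : set (H -> H)).
Variables (I : choiceType) (n : I -> nat).
Local Notation E i := (euclidean R (n i)).
Local Notation A := (cstar S).
Variables (psi : forall i, (H -> H) -> (E i -> E i)).
Variables (pr : forall i, H -> E i) (inc : forall i, E i -> H).
Hypothesis S_opsys : operator_system S.
Hypothesis psi_irr : forall i, irreducible_rep A (@psi i).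
Hypothesis blocks : block_decomposition A psi pr inc.

Lemma opsys_bd s : S s -> bounded_op s.
Proof. by have [[h _ _] _ _] := S_opsys; exact: h. Qed.

Lemma opsys0 : S 0.
Proof. by have [[_ h _] _ _] := S_opsys. Qed.

Lemma opsysZ c s : S s -> S (c *: s).
Proof.
by have [[_ h0 h] _ _] := S_opsys; move=> Ss; rewrite -[_ *: _]addr0; exact: h.
Qed.

Lemma opsys_adj : adjoint_closed S. Proof. by have [] := S_opsys. Qed.

Lemma opsys1 : S idfun. Proof. by have [] := S_opsys. Qed.

Lemma opsys_alg : cstar_subalgebra A.
Proof. exact: cstar_alg opsys_bd opsys_adj. Qed.

Lemma opsys_sub s : S s -> A s. Proof. exact: sub_cstar. Qed.

Lemma cstar1 : A idfun. Proof. apply: opsys_sub; exact: opsys1. Qed.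

Lemma psi_rep i : representation A (@psi i).
Proof. by have [h _ _] := psi_irr i; exact: h. Qed.

Definition psimx i (J K : finType) (T : J -> K -> H -> H) : hpow K (E i) -> hpow J (E i) :=
  opmx (fun j k => @psi i (T j k)).
Arguments psimx i {J K} T.

Definition peaks_at i (J K : finType) (T : J -> K -> H -> H) := exists r,
  [/\ 0 <= r, forall j, j != i -> opbd (psimx j T) r &
      exists x, r * hnorm x < hnorm (psimx i T x)].

(** * Norm attaining vectors inside a compressing subspace *)

Definition attains (V W : hilbert R) (T : V -> W) x :=
  x != 0 /\ opbd T (hnorm (T x) / hnorm x).

(** For a unit vector y, t is |T y| and u, w are the squared norms of its parts in and off the
    peaking block. Then (l^2 - r^2) w <= l^2 - t^2, while t^2 >= 2 l t - l^2 >= l^2 - 2 l e. *)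
Lemma concentration_arith (l r e t u w : R) : 0 <= l -> l - e < t -> 1 = u + w ->
  t ^+ 2 <= l ^+ 2 * u + r ^+ 2 * w -> (l ^+ 2 - r ^+ 2) * w <= 2 * l * e.
Proof.
move=> l0 et h2 h1; have h3 := sqr_ge0 (t - l).
have h4 : 0 <= l * (t - (l - e)) by rewrite mulr_ge0 // subr_ge0 ltW.
have E1 : u = 1 - w by rewrite h2 addrK.
rewrite E1 in h1; nra.
Qed.

Section Peak.
Variables (i : I) (J K : finType) (T : J -> K -> H -> H).
Hypothesis T_S : forall j k, S (T j k).

Let T_A j k : A (T j k). Proof. exact: opsys_sub. Qed.

Lemma psimx_bd l : bounded_op (psimx l T).
Proof. by apply: opmx_bd => j k; exact: (rep_bd (psi_rep l)). Qed.

Lemma psimx_pythagoras y c r : opbd (psimx i T) c -> 0 <= c -> 0 <= r ->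
  (forall j, j != i -> opbd (psimx j T) r) ->
  hnorm (opmx T y) ^+ 2 <= c ^+ 2 * hnorm (prn pr i y) ^+ 2 +
    r ^+ 2 * hnorm (y - incn inc (prn pr i y)) ^+ 2.
Proof.
move=> Tc c0 r0 Tr; rewrite (incn_pythagoras blocks i (opmx T y)).
have lT : linear (opmx T) by have [] := opmx_bd (fun j k => opsys_bd (T_S j k)).
rewrite (prn_opmx blocks T_A) -(opmx_incn blocks psi_rep T_A) -(lin_opB lT).
apply: lerD; rewrite -exprMn ler_pXn2r ?nnegrE ?mulr_ge0 ?hnorm_ge0 //; first exact: Tc.
apply: (blocks_opbd_except blocks psi_rep T_A r0 Tr).
by rewrite (prnB blocks) (prn_incn blocks) subrr.
Qed.

(* Almost norming unit vectors of G^K concentrate on the peaking block, which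
   is finite dimensional, hence subconverge in norm. *)
Lemma peak_attained G P : closed_subspace G -> orthogonal_projection G P ->
  completely_isometric_on S G (fun s => P \o s) -> peaks_at i T ->
  exists v, attains (psimx i T) v /\ forall k, G (inc (v k)).
Proof.
move=> G_sub G_proj ci [r [r0 Tr [x0 x0r]]].
pose l := opnorm (psimx i T).
have l0 : 0 <= l := opnorm_ge0 (psimx_bd i).
have Tl : opbd (psimx i T) l := opnorm_bd (psimx_bd i).
have rl : r < l.
  rewrite ltNge; apply/negP => lr; move: x0r; rewrite ltNge => /negP; apply.
  exact: (opbdW lr Tl).
have bT : bounded_op (opmx T) by exact: (opmx_bd (fun j k => opsys_bd (T_S j k))).
have lT : linear (opmx T) by have [] := bT.
(* Otherwise T would be bounded on G^K, hence everywhere, by a number below l, against the norm of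
   its i-th block. The maximum with 0 covers e > l. *)
have claim e : 0 < e -> exists y : hpow K H, [/\ forall k, G (y k), hnorm y = 1 &
    l - e < hnorm (opmx T y)].
  move=> e0; apply: contrapT => no.
  pose d := Num.max 0 (l - e).
  have d0 : 0 <= d by rewrite le_max lexx.
  have dl : d < l by rewrite gt_max (le_lt_trans r0 rl) gtrBl.
  have : opbd (opmx T) d.
    apply: (compression_norming G_sub G_proj opsys_bd opsys0 ci T_S d0) => x Gx.
    rewrite leNgt; apply/negP => hx; apply: no.
    have [a [a1 ad]] := unit_gt lT hx.
    exists (a *: x); split; last 1 first.
    - by apply: le_lt_trans ad; rewrite le_max lexx orbT.
    - by move=> k; rewrite hpowZ; exact: (subspaceZ G_sub).
    - exact: a1.
  move=> /(blocks_opbd blocks psi_rep T_A d0)/(_ i) Td.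
  by have := opnorm_le d0 Td; rewrite leNgt dl.
have conc y e : hnorm y = 1 -> l - e < hnorm (opmx T y) ->
    (l ^+ 2 - r ^+ 2) * hnorm (y - incn inc (prn pr i y)) ^+ 2 <= 2 * l * e.
  move=> y1 ye; have h1 := psimx_pythagoras y Tl l0 r0 Tr.
  have := incn_pythagoras blocks i y; rewrite y1 expr1n => h2.
  exact: concentration_arith l0 ye h2 h1.
have [y Hy] := choice (fun k => claim _ (natSinv_gt0 R k)).
have uy k : hnorm (prn pr i (y k)) <= 1.
  have [_ y1 _] := Hy k; rewrite -y1; apply: ler_of_sqr (hnorm_ge0 _) (hnorm_ge0 _) _.
  by rewrite [leRHS](incn_pythagoras blocks i) lerDl sqr_ge0.
have [f [v [fk Hf]]] := bw_hpow uy.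
have lr0 : 0 < l ^+ 2 - r ^+ 2 by rewrite subr_gt0 ltr_pXn2r ?nnegrE.
have near e : 0 < e -> exists k, [/\ forall j, G (y k j), hnorm (y k) = 1,
    hnorm (y k - incn inc v) < e & l - e < hnorm (opmx T (y k))].
  move=> e0; have e2 : 0 < e / 2 by rewrite divr_gt0.
  have l1 : 0 < 2 * l + 1 by rewrite ltr_wpDl ?mulr_ge0.
  (* By [conc], a defect of at most q in the norm leaves a mass of at most e / 2 off the block; 2 l
     + 1 in place of 2 l is visibly positive. *)
  pose q := (e / 2) ^+ 2 * (l ^+ 2 - r ^+ 2) / (2 * l + 1).
  have q0 : 0 < q by rewrite !mulr_gt0 ?invr_gt0.
  have [N1 HN1] := natSinv_small q0; have [N2 HN2] := natSinv_small e0.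
  have [N3 HN3] := Hf _ e2.
  pose k := maxn N1 (maxn N2 N3).
  have [Gy y1 yl] := Hy (f k).
  have k1 : (f k).+1%:R^-1 <= q.
    by apply: HN1; apply: leq_trans (fk k); rewrite leq_maxl.
  have k2 : (f k).+1%:R^-1 <= e.
    by apply: HN2; apply: leq_trans (fk k); rewrite /k !leq_max leqnn orbT.
  have k3 : hnorm (prn pr i (y (f k)) - v) < e / 2.
    by apply: HN3; rewrite /k !leq_max leqnn !orbT.
  exists (f k); split; [exact: Gy|exact: y1| |]; last first.
    by apply: le_lt_trans yl; rewrite lerD2l lerN2.
  pose z := incn inc (prn pr i (y (f k))).
  have zv : hnorm (z - incn inc v) < e / 2.
    apply: le_lt_trans k3; rewrite -(incnB blocks).
    by rewrite (hnorm_incn blocks).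
  have h1 : hnorm (y (f k) - incn inc v) <= hnorm (y (f k) - z) + hnorm (z - incn inc v).
    by rewrite -(subrKA z); exact: hnorm_triangle.
  apply: le_lt_trans h1 _; rewrite (splitr e); apply: ler_ltD zv.
  apply: ler_of_sqr (hnorm_ge0 _) (ltW e2) _.
  rewrite -(ler_pM2l lr0); apply: le_trans (conc _ _ y1 yl) _.
  apply: (@le_trans _ _ ((2 * l + 1) * q)).
    apply: ler_pM (mulr_ge0 _ l0) (ltW (natSinv_gt0 _ _)) _ k1; [exact: ler0n|].
    by rewrite lerDl.
  by rewrite /q mulrCA divff ?mulr1 ?gt_eqF // mulrC.
have [] := @attain_limit _ _ _ (opmx T) l (incn inc v) bT.
  by move=> e /near[k [_ y1 yv yl]]; exists (y k).
rewrite (hnorm_incn blocks) (hnorm_opmx_incn blocks psi_rep T_A) => v1 Tv.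
exists v; split; first split.
- by rewrite -hnorm_gt0 v1.
- by rewrite v1 divr1; exact: opbdW Tv Tl.
- move=> k; have [_ _ G_cl] := G_sub; apply: G_cl => e /near[m [Gy _ yv _]].
  exists (y m k); first exact: Gy.
  rewrite hnormBC; apply: le_lt_trans yv.
  have -> : y m k - inc (v k) = (y m - incn inc v) k by rewrite hpowB.
  exact: hnorm_coord.
Qed.

End Peak.

(** * Raising the rank of norm attaining vectors *)

Lemma psi_linear i a : A a -> linear (@psi i a).
Proof. by move=> Aa; have [] := rep_bd (psi_rep i) Aa. Qed.

Lemma opsys_star : exists st : (H -> H) -> (H -> H),
  forall s, S s -> S (st s) /\ adjoint s (st s).
Proof.
have h s : exists s', S s -> S s' /\ adjoint s s'.
  have [Ss|nSs] := pselect (S s); last by exists s => /nSs.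
  by have [s' Ss' ss'] := opsys_adj Ss; exists s'.
by have [st Hst] := choice h; exists st.
Qed.

(** Row spaces are closed, and invariance under S extends to [cstar S] by [rep_invariant], so
    irreducibility can be applied to a matrix and to S alone. *)
Lemma irreducible_rowspace i p (W : 'M[R[i]]_(p, n i)) :
  (forall s, S s -> forall v : E i, ((v : 'rV_(n i)) <= W)%MS ->
     ((@psi i s v : 'rV_(n i)) <= W)%MS) ->
  W = 0 \/ \rank W = n i.
Proof.
move=> SW; have [_ _ irr] := psi_irr i.
pose G : set (E i) := [set v | ((v : 'rV_(n i)) <= W)%MS].
have G_sub : closed_subspace G by exact: rowspace_closed.
have [] := irr G G_sub.
- move=> _ v [a Aa <-] Gv.
  exact: (rep_invariant opsys_alg cstar1 opsys_adj (psi_rep i) G_sub SW Aa).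
- move=> G0; left; apply/row_matrixP => k; rewrite row0.
  have : G (row k W : E i) by rewrite /G /= row_sub.
  by rewrite G0.
- move=> GT; right; apply/eqP; rewrite -[_ == _]/(row_full W) -sub1mx.
  apply/row_subP => k; have : G (row k 1%:M : E i) by rewrite GT.
  by [].
Qed.

Lemma attains_norm (V W : hilbert R) (T : V -> W) x : bounded_op T ->
  attains T x -> hnorm (T x) = opnorm T * hnorm x.
Proof.
move=> bT [x0 Tx]; apply/eqP; rewrite eq_le opnorm_bd //=.
rewrite -ler_pdivlMr ?hnorm_gt0 //; apply: opnorm_le Tx.
by rewrite divr_ge0 ?hnorm_ge0.
Qed.

(* By lower semicontinuity of the rank, the vectors of rank < d form a closed
   cone. *)
Lemma rank_gap i (K : finType) (L : hilbert R) (T : hpow K (E i) -> L) d :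
  bounded_op T -> 0 < opnorm T -> (forall v, attains T v -> (d <= \rank (vmx v))%N) ->
  exists c, [/\ 0 <= c, c < opnorm T & forall v, (\rank (vmx v) < d)%N ->
     hnorm (T v) <= c * hnorm v].
Proof.
move=> bT T0 hd; have [] := @opbd_gap R (n i) K L T
  [set v | (\rank (vmx v) < d)%N] (opnorm T) bT.
- move=> a v /=; apply: leq_ltn_trans; apply: mxrankS.
  apply/vmx_sub => k; rewrite hpowZ scalemx_sub //.
  by move: k; apply/vmx_sub.
- move=> z y zd yz /=; rewrite ltnNge; apply/negP => dy.
  have [e e0 he] := rank_lsc y; have [k /he] := yz e e0.
  by rewrite leqNgt (leq_trans (zd k) dy).
- move=> v /= vd v0; rewrite lt_neqAle opnorm_bd // andbT; apply/eqP => E0.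
  move: vd; rewrite ltnNge hd //; split=> //.
  by rewrite E0 mulfK ?hnorm_eq0 //; exact: opnorm_bd.
- move=> c cT Tc; exists (Num.max 0 c); split; first by rewrite le_max lexx.
    by rewrite gt_max T0.
  move=> v /Tc h; apply: le_trans h _; rewrite ler_wpM2r ?hnorm_ge0 //.
  by rewrite le_max lexx orbT.
Qed.

(** With l the norm of X, |X Y w - l^2 w|^2 = |X Y w|^2 + l^4 |w|^2 - 2 l^2 |Y w|^2, which is at
    most 0 since |Y w| = l |w| and |X Y w| <= l^2 |w|. *)
Lemma attains_adjoint (V W : hilbert R) (X : V -> W) (Y : W -> V) w :
  bounded_op X -> adjoint X Y -> 0 < opnorm X -> attains Y w ->
  attains X (Y w) /\ X (Y w) = ((opnorm X ^+ 2)%:C)%C *: w.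
Proof.
move=> bX XY X0 aw; have Xb := opnorm_bd bX; have l0 := ltW X0.
have bY : bounded_op Y.
  by apply/bounded_opP; split; [exact: adjoint_linear XY|exists (opnorm X) => //; exact: adjoint_bd XY Xb].
have YX : opnorm Y = opnorm X.
  apply/eqP; rewrite eq_le; apply/andP; split; apply: opnorm_le => //.
  - exact: adjoint_bd XY Xb.
  - exact: opnorm_ge0.
  - exact: (adjoint_bd (opnorm_ge0 bY) (adjoint_sym XY) (opnorm_bd bY)).
have Yw := attains_norm bY aw; rewrite YX in Yw.
have [w0 _] := aw; have w1 : 0 < hnorm w by rewrite hnorm_gt0.
set l := opnorm X in Xb l0 X0 Yw *.
have XE : X (Y w) = ((l ^+ 2)%:C)%C *: w.
  apply/eqP; rewrite -subr_eq0 -hnorm_eq0 -sqrf_eq0 eq_le sqr_ge0 andbT.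
  rewrite (hnormD_sqr (X (Y w))) hnorm_opp hnorm_scale cabs_real ger0_norm ?sqr_ge0 //.
  rewrite hdotNr hdotZr XY hdotxx Yw.
  have -> : complex.Re (- (Num.conj ((l ^+ 2)%:C)%C * (((l * hnorm w) ^+ 2)%:C)%C)) =
    - (l ^+ 2 * (l * hnorm w) ^+ 2) by rewrite /=; ring.
  have h : hnorm (X (Y w)) <= l ^+ 2 * hnorm w.
    by apply: le_trans (Xb _) _; rewrite Yw mulrA -expr2.
  have : hnorm (X (Y w)) ^+ 2 <= (l ^+ 2 * hnorm w) ^+ 2.
    by rewrite ler_pXn2r ?nnegrE ?mulr_ge0 ?sqr_ge0 ?hnorm_ge0.
  lra.
split=> //; have n0 : 0 < hnorm (Y w) by rewrite Yw mulr_gt0.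
split; first by rewrite -hnorm_gt0.
apply: opbdW Xb; rewrite XE hnorm_scale cabs_real ger0_norm ?sqr_ge0 //.
by rewrite ler_pdivlMr // Yw mulrA -expr2.
Qed.

(** The rows of [vmx v] are the components of v, so its rank is the dimension of their span.
    Rectangular T are allowed because [peak_step] produces adjoints of columns. *)
Definition peak_rank i d := exists (J K : finType) (T : J -> K -> H -> H),
  [/\ forall j k, S (T j k), peaks_at i T &
      forall v, attains (psimx i T) v -> (d <= \rank (vmx v))%N].

Section Extension.
Variables (J K O : finType) (T : J -> K -> H -> H) (s : O -> H -> H) (e : R).
Hypotheses (T_S : forall j k, S (T j k)) (s_S : forall o, S (s o)) (e0 : 0 <= e).

(** T on top of rows that apply e times each [s o] to each coordinate separately: the row
    [inr (k, o)] sends x to e s_o x_k. *)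
Definition mxext (p : J + K * O) (k : K) : H -> H :=
  match p with
  | inl j => T j k
  | inr ko => if ko.1 == k then (e%:C)%C *: s ko.2 else 0
  end.

Lemma mxext_S p k : S (mxext p k).
Proof.
case: p => [j|[k' o]] /=; first exact: T_S.
by case: ifP => _; [exact: opsysZ|exact: opsys0].
Qed.

Lemma psimx_inr i x k o : psimx i mxext x (inr (k, o)) = (e%:C)%C *: @psi i (s o) (x k).
Proof.
rewrite /psimx opmxE (bigD1 k) // big1 ?Monoid.mulm1 => [|k' k'k] /=.
  by rewrite eqxx (repZ opsys_alg (psi_rep i)) //; exact: opsys_sub.
by rewrite eq_sym (negPf k'k) (rep0 opsys_alg (psi_rep i)).
Qed.

Lemma psimx_ext_sqr i x : hnorm (psimx i mxext x) ^+ 2 =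
  hnorm (psimx i T x) ^+ 2 + e ^+ 2 * \sum_k \sum_o hnorm (@psi i (s o) (x k)) ^+ 2.
Proof.
rewrite [LHS]hnorm_hpow big_sumType [X in _ = X + _]hnorm_hpow.
congr (_ + _); rewrite (eq_bigr (fun ko : K * O => e ^+ 2 * hnorm (@psi i (s ko.2) (x ko.1)) ^+ 2)).
  by rewrite -mulr_sumr pair_big.
move=> [k o] _; rewrite psimx_inr hnorm_scale cabs_real ger0_norm // exprMn.
by [].
Qed.

End Extension.

(** Representations being contractive, C depends neither on the block nor on K; so one e in
    [peak_step] suits all the other blocks at once. *)
Lemma family_bound (O : finType) (s : O -> H -> H) : (forall o, S (s o)) ->
  exists2 C : R, 0 <= C & forall i (K : finType) (x : hpow K (E i)),
    \sum_k \sum_o hnorm (@psi i (s o) (x k)) ^+ 2 <= C * hnorm x ^+ 2.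
Proof.
move=> s_S.
have h o : exists c : R, 0 <= c /\ opbd (s o) c.
  by have /bounded_opP[_ [c c0 sc]] := opsys_bd (s_S o); exists c.
have [c Hc] := choice h.
exists (\sum_o c o ^+ 2); first by apply: sumr_ge0 => o _; exact: sqr_ge0.
move=> i K x; rewrite [in leRHS](hnorm_hpow x) mulr_sumr; apply: ler_sum => k _.
rewrite mulr_suml; apply: ler_sum => o _; have [c0 sc] := Hc o.
rewrite -exprMn ler_pXn2r ?nnegrE ?mulr_ge0 ?hnorm_ge0 //.
exact: (rep_contractive opsys_alg cstar1 (psi_rep i) (opsys_sub (s_S o)) c0 sc).
Qed.

Lemma gt_opnorm (V W : hilbert R) (T : V -> W) r : bounded_op T -> 0 <= r ->
  (exists x, r * hnorm x < hnorm (T x)) <-> r < opnorm T.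
Proof.
move=> bT r0; split=> [[x xr]|rT].
  rewrite ltNge; apply/negP => Tr; move: xr; rewrite ltNge => /negP; apply.
  exact: (opbdW Tr (opnorm_bd bT)).
apply: contrapT => no; move: rT; rewrite ltNge => /negP; apply.
apply: opnorm_le r0 _ => x; rewrite leNgt; apply/negP => h; apply: no.
by exists x.
Qed.

Lemma peak_step i d : (d < n i)%N -> peak_rank i d -> peak_rank i d.+1.
Proof.
move=> dn [J [K [T [T_S [r [r0 Tr xr]] hd]]]].
have bT : bounded_op (psimx i T) := psimx_bd T_S i.
have rT : r < opnorm (psimx i T) by apply/(gt_opnorm bT r0).
have T0 : 0 < opnorm (psimx i T) := le_lt_trans r0 rT.
have [c [c0 cT Tc]] := rank_gap bT T0 hd.
have [q [s [s_S span]]] := finite_spanning (ex_intro S _ opsys1)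
  (fun t (St : S t) => @psi_linear i _ (opsys_sub St)).
(* The identity row puts the components of x among those of X x, up to the factor e. *)
pose s' (o : option 'I_q) := if o is Some k then s k else idfun.
have s'_S o : S (s' o) by case: o => [k|] /=; [exact: s_S|exact: opsys1].
have [C C0 sC] := family_bound s'_S.
(* Both competitors lie below l: r bounds T on the other blocks, c bounds it on vectors of rank less
   than d. *)
pose g := Num.max r c.
have g0 : 0 <= g by rewrite le_max r0.
have gT : g < opnorm (psimx i T) by rewrite gt_max rT.
set l := opnorm (psimx i T) in T0 gT *.
have lg : 0 < l ^+ 2 - g ^+ 2 by rewrite subr_gt0 ltr_pXn2r ?nnegrE ?(ltW T0).
have C1 : 0 < C + 1 by rewrite ltr_wpDl.
(* The added rows raise squared norms by at most e^2 C |x|^2, and this e keeps g^2 + e^2 C below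
   l^2. *)
pose e := Num.sqrt ((l ^+ 2 - g ^+ 2) / (C + 1)).
have e0 : 0 < e by rewrite sqrtr_gt0 divr_gt0.
have e2 : e ^+ 2 * C < l ^+ 2 - g ^+ 2.
  rewrite sqr_sqrtr; last by rewrite divr_ge0 ?(ltW lg) ?(ltW C1).
  by rewrite mulrAC ltr_pdivrMr // ltr_pM2l // ltrDl.
pose r1 := Num.sqrt (g ^+ 2 + e ^+ 2 * C).
have r10 : 0 <= r1 := sqrtr_ge0 _.
have r1E : r1 ^+ 2 = g ^+ 2 + e ^+ 2 * C.
  by apply: sqr_sqrtr; rewrite addr_ge0 ?sqr_ge0 // mulr_ge0 ?sqr_ge0.
have r1l : r1 < l.
  rewrite -(@ltr_pXn2r _ 2) ?nnegrE ?(ltW T0) // r1E; lra.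
pose X := mxext T s' e.
have X_S p k : S (X p k) := mxext_S e T_S s'_S p k.
have small j (x : hpow K (E j)) : hnorm (psimx j T x) <= g * hnorm x ->
    hnorm (psimx j X x) <= r1 * hnorm x.
  move=> xg; apply: ler_of_sqr (hnorm_ge0 _) (mulr_ge0 r10 (hnorm_ge0 _)) _.
  rewrite (psimx_ext_sqr T s'_S (ltW e0)) exprMn r1E mulrDl.
  apply: lerD; last by rewrite -[leRHS]mulrA ler_wpM2l ?sqr_ge0.
  by rewrite -exprMn ler_pXn2r // nnegrE ?mulr_ge0 ?hnorm_ge0.
have big x : hnorm (psimx i T x) <= hnorm (psimx i X x).
  apply: ler_of_sqr (hnorm_ge0 _) (hnorm_ge0 _) _.
  rewrite (psimx_ext_sqr T s'_S (ltW e0)) lerDl mulr_ge0 ?sqr_ge0 //.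
  by apply: sumr_ge0 => k _; apply: sumr_ge0 => o _; exact: sqr_ge0.
have bX : bounded_op (psimx i X) := psimx_bd X_S i.
have r1X : r1 < opnorm (psimx i X).
  apply/(gt_opnorm bX r10); have [x xl] := (gt_opnorm bT r10).2 r1l.
  by exists x; apply: lt_le_trans xl (big x).
have X0 : 0 < opnorm (psimx i X) := le_lt_trans r10 r1X.
have X_att v : attains (psimx i X) v -> (d <= \rank (vmx v))%N.
  move=> [v0 Xv]; rewrite leqNgt; apply/negP => /Tc Tv.
  have v1 : 0 < hnorm v by rewrite hnorm_gt0.
  have : hnorm (psimx i X v) <= r1 * hnorm v.
    apply: small; apply: le_trans Tv _; rewrite ler_wpM2r ?hnorm_ge0 //.
    by rewrite le_max lexx orbT.
  rewrite -ler_pdivrMr // => Xr.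
  have := opnorm_le r10 (opbdW Xr Xv); by rewrite leNgt r1X.
have [st Hst] := opsys_star.
pose Y k p := st (X p k).
have Y_S k p : S (Y k p) by have [] := Hst _ (X_S p k).
have XY j : adjoint (psimx j X) (psimx j Y).
  apply: opmx_adj => p k; have [Yk XYk] := Hst _ (X_S p k).
  exact: (rep_adj (psi_rep j) (opsys_sub (X_S p k)) (opsys_sub Yk) XYk).
have bY : bounded_op (psimx i Y) := psimx_bd Y_S i.
exists K, (J + K * option 'I_q)%type, Y; split=> //.
  exists r1; split=> // [j ji|].
    apply: adjoint_bd r10 (XY j) _ => x; apply: small.
    by apply: le_trans (Tr j ji x) _; rewrite ler_wpM2r ?hnorm_ge0 // le_max lexx.
  apply/(gt_opnorm bY r10); apply: lt_le_trans r1X _; apply: opnorm_le.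
    exact: opnorm_ge0.
  exact: adjoint_bd (opnorm_ge0 bY) (adjoint_sym (XY i)) (opnorm_bd bY).
(* x attains the norm of X, so its components span at least d dimensions, and w is a nonzero
   multiple of X x: the span of w contains all x_k and all psi_i (s_o) x_k. *)
move=> w wY; have [xX XE] := attains_adjoint bX (XY i) X0 wY.
set x := psimx i Y w in xX XE.
have dx := X_att x xX.
have comp k o : ((@psi i (s' o) (x k) : 'rV_(n i)) <= vmx w)%MS.
  have wk : (((psimx i X x) (inr (k, o)) : 'rV_(n i)) <= vmx w)%MS.
    by rewrite XE hpowZ scalemx_sub //; move: (inr (k, o)); exact/vmx_sub.
  rewrite (psimx_inr T e s'_S) in wk.
  have ec : (e%:C)%C != 0 :> R[i] by rewrite (inj_eq (@complexI R)) gt_eqF.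
  rewrite -[@psi i _ _]scale1r -(mulVf ec) -scalerA; exact: scalemx_sub wk.
have xw : (vmx x <= vmx w)%MS.
  by apply/vmx_sub => k; have := comp k None; rewrite /= (rep1 (psi_rep i)).
(* If w had rank at most d, the spans of x and w would coincide. As psi_i (S) maps the first into
   the second, the span would be invariant, hence 0 or the whole block; but w is nonzero and d < n
   i. *)
rewrite ltnNge; apply/negP => wd.
have wx : (vmx w <= vmx x)%MS.
  by rewrite -(geq_leqif (mxrank_leqif_sup xw)) (leq_trans wd).
have inv t : S t -> forall v : E i, ((v : 'rV_(n i)) <= vmx w)%MS ->
    ((@psi i t v : 'rV_(n i)) <= vmx w)%MS.
  move=> St v vw; apply: (span _ (vmx x) _ (vmx w)) St _ (submx_trans vw wx).
  move=> k u /submxP[D ->].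
  have lk : linear (@psi i (s k)) := @psi_linear i _ (opsys_sub (s_S k)).
  rewrite mulmx_sum_row (lin_op_sum lk) summx_sub // => b _.
  by rewrite (lin_opZ lk) scalemx_sub // rowK; exact: (comp (enum_val b) (Some k)).
have [w0|wn] := irreducible_rowspace inv; last by rewrite wn leqNgt dn in wd.
by have [] := wY; rewrite (vmx_eq0 w0) eqxx.
Qed.

(** * Ideals supported on one block *)

Lemma psi_inj a b : A a -> A b -> (forall i, @psi i a = @psi i b) -> a = b.
Proof.
move=> Aa Ab ab; apply: funext => x; apply: (pr_inj blocks) => i.
by rewrite !(pr_act blocks) // ab.
Qed.

(** The vectors psi_i (s_k) u, for s_k spanning the image of psi_i, span an invariant subspace
    containing u, hence everything. In finite dimension each vector is reached exactly, not just
    approximated. *)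
Lemma psi_transitive i (u v : E i) : u != 0 -> exists2 b, A b & @psi i b u = v.
Proof.
move=> u0.
have [q [s [sA span]]] := finite_spanning (ex_intro A _ cstar1)
  (fun t (At : A t) => @psi_linear i _ At).
pose W := \matrix_k (@psi i (s k) u : 'rV_(n i)).
have key t : A t -> ((@psi i t u : 'rV_(n i)) <= W)%MS.
  move=> At; apply: (span _ (u : 'rV_(n i)) _ W) At _ (submx_refl _).
  move=> k _ /sub_rVP[c ->]; rewrite (lin_opZ (@psi_linear i _ (sA k))).
  by apply: scalemx_sub; rewrite -[X in (X <= _)%MS](rowK (fun k => @psi i (s k) u : 'rV_(n i))) row_sub.
have inv t : S t -> forall w : E i, ((w : 'rV_(n i)) <= W)%MS -> ((@psi i t w : 'rV_(n i)) <= W)%MS.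
  move=> St w /submxP[D ->]; rewrite mulmx_sum_row.
  have At := opsys_sub St; have lt := @psi_linear i _ At.
  rewrite (lin_op_sum lt) summx_sub // => k _; rewrite (lin_opZ lt) scalemx_sub // rowK.
  have := key _ (alg_comp opsys_alg At (sA k)).
  by rewrite (rep_comp (psi_rep i) At (sA k)) => h; exact: h.
have [W0|Wn] := irreducible_rowspace inv.
  have := key _ cstar1; rewrite (rep1 (psi_rep i)) W0 => /submx0null uz.
  have u00 : u = 0 := uz.
  by rewrite u00 eqxx in u0.
have : ((v : 'rV_(n i)) <= W)%MS by apply: submx_full; rewrite /row_full Wn.
move=> /submxP[D ->].
have Ak k : A (D 0 k *: s k) := algZ opsys_alg (D 0 k) (sA k).
exists (\sum_k D 0 k *: s k); first by apply: (alg_sum opsys_alg).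
rewrite (rep_sum opsys_alg (psi_rep i)) // fct_sumE mulmx_sum_row.
by apply: eq_bigr => k _; rewrite (repZ opsys_alg (psi_rep i) _ (sA k)) /W rowK.
Qed.

(** C is the matrix, in the basis [row_base X], of right multiplication by B X on the row space of
    X. For an eigenvalue c of C, the matrix X B X - c X factors through the singular C - c. *)
Lemma rank_drop m (X B : 'M[R[i]]_m) : X != 0 ->
  exists c : R[i], (\rank (X *m B *m X - c *: X)%R < \rank X)%N.
Proof.
move=> X0; have r0 : (0 < \rank X)%N by rewrite lt0n mxrank_eq0.
have : (row_base X *m B *m X <= row_base X)%MS.
  by rewrite eq_row_base submxMl.
move=> /submxP[C hC].
have [c /eigenvalueP[z zC z0]] := eigenvalue_closed C r0.
exists c.
have -> : X *m B *m X - c *: X = col_base X *m (C - c%:M) *m row_base X.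
  rewrite mulmxBr mulmxBl mul_mx_scalar -scalemxAl.
  rewrite mulmx_base.
  rewrite -[col_base X *m C *m _]mulmxA -hC -(mulmxA (row_base X)).
  by rewrite [col_base X *m _]mulmxA mulmx_base mulmxA.
apply: leq_ltn_trans (mxrankM_maxl _ _) _; apply: leq_ltn_trans (mxrankM_maxr _ _) _.
rewrite ltn_neqAle rank_leq_row andbT; apply/negP => /row_freeP[D CD].
have : z *m (C - c%:M) = 0 by rewrite mulmxBr zC mul_mx_scalar subrr.
move=> /(congr1 (mulmx^~ D)); rewrite -mulmxA CD mulmx1 mul0mx => zz.
by rewrite zz eqxx in z0.
Qed.

Definition block_ideal i : set (H -> H) :=
  [set a | A a /\ forall j, j != i -> @psi j a = 0].

Lemma block_idealM i a b c : A a -> A b -> block_ideal i c -> block_ideal i (a \o (c \o b)).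
Proof.
move=> Aa Ab [Ac cj]; have Acb : A (c \o b) by exact: (alg_comp opsys_alg).
split; first exact: (alg_comp opsys_alg).
move=> j ji; rewrite (rep_comp (psi_rep j)) // (rep_comp (psi_rep j)) // cj //.
apply: funext => x /=; exact: (lin_op0 (@psi_linear j _ Aa)).
Qed.

Lemma block_ideal_lincomb i c a b :
  block_ideal i a -> block_ideal i b -> block_ideal i (c *: a + b).
Proof.
move=> [Aa aj] [Ab bj]; split; first exact: (alg_lincomb opsys_alg).
by move=> j ji; rewrite (rep_lincomb (psi_rep j)) // aj // bj // scaler0 addr0.
Qed.

Lemma block_ideal0 i : block_ideal i 0.
Proof.
split=> [|j _]; first exact: (alg0 opsys_alg).
exact: (rep0 opsys_alg (psi_rep j)).
Qed.

Lemma mxof_psi_comp i a b : A a -> A b ->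
  mxof (@psi i (a \o b)) = mxof (@psi i b) *m mxof (@psi i a).
Proof.
move=> Aa Ab; apply/row_matrixP => k; rewrite row_mul !rowK.
rewrite (mxofE _ (@psi_linear i _ Aa)) (rep_comp (psi_rep i)) //.
Qed.

Lemma mxof_psi_lincomb i c a b : A a -> A b ->
  mxof (@psi i (c *: a + b)) = c *: mxof (@psi i a) + mxof (@psi i b).
Proof.
move=> Aa Ab; apply/row_matrixP => k; rewrite linearD linearZ /= !rowK.
by rewrite (rep_lincomb (psi_rep i)).
Qed.

Lemma mxof_inj m (T U : euclidean R m -> euclidean R m) : linear T -> linear U ->
  mxof T = mxof U -> T = U.
Proof.
by move=> lT lU TU; apply: funext => v; rewrite -(mxofE v lT) -(mxofE v lU) TU.
Qed.

(* An element a of minimal rank in the ideal has rank one: otherwise some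
   a b a - c a would be nonzero of smaller rank. *)
Lemma block_ideal_rank1 i a : block_ideal i a -> @psi i a <> 0 ->
  exists2 e, block_ideal i e & \rank (mxof (@psi i e)) = 1%N.
Proof.
move=> Ja a0.
have lpsi b : A b -> linear (@psi i b) := @psi_linear i b.
have nz b : A b -> @psi i b <> 0 -> mxof (@psi i b) != 0.
  move=> Ab b0; apply/eqP => M0; apply: b0; apply: mxof_inj => //; first exact: lpsi.
    by move=> c x y; rewrite scaler0 addr0.
  by rewrite M0; apply/row_matrixP => k; rewrite rowK row0.
pose P d := `[< exists b, [/\ block_ideal i b, mxof (@psi i b) != 0 & \rank (mxof (@psi i b)) = d] >].
have exP : exists d, P d.
  exists (\rank (mxof (@psi i a))); apply/asboolP; exists a; split=> //.
  by apply: nz => //; have [] := Ja.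
have [d /asboolP[b [Jb b0 bd]] dmin] := ex_minnP exP.
have [Ab _] := Jb.
exists b => //; rewrite bd; apply/eqP; rewrite eqn_leq; apply/andP; split; last first.
  by rewrite -bd lt0n mxrank_eq0.
rewrite leqNgt; apply/negP => d2.
set X := mxof (@psi i b) in b0 bd.
have [k Xk] : exists k, row k X != 0.
  apply: contrapT => no; move/eqP: b0; apply; apply/row_matrixP => k; rewrite row0.
  by apply/eqP/negPn/negP => h; apply: no; exists k.
have [k' Xk'] : exists k', ~~ (row k' X <= row k X)%MS.
  apply/row_subPn; apply/negP => /mxrankS; rewrite bd leqNgt.
  by rewrite (leq_trans _ d2) // ltnS rank_leq_row.
(* Since c takes row k of X to the k'-th basis vector, row k of X c X is row k' of X, which is not a
   multiple of row k. So X c X - l X is nonzero for every l, including the one given by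
   [rank_drop]. *)
have [c Ac cE] := @psi_transitive i (row k X : E i) (delta_mx 0 k' : E i) Xk.
have [l hl] := rank_drop (mxof (@psi i c)) b0.
pose b' := - l *: b + (b \o (c \o b)).
have Acb : A (c \o b) by exact: (alg_comp opsys_alg).
have Jbcb : block_ideal i (b \o (c \o b)) by exact: (block_idealM cstar1 Acb Jb).
have Jb' : block_ideal i b' by exact: block_ideal_lincomb.
have b'E : mxof (@psi i b') = X *m mxof (@psi i c) *m X - l *: X.
  have [Abcb _] := Jbcb.
  have E1 : mxof (@psi i (b \o (c \o b))) = X *m mxof (@psi i c) *m X.
    by rewrite (mxof_psi_comp i Ab Acb) (mxof_psi_comp i Ac Ab).
  by rewrite (mxof_psi_lincomb i (- l) Ab Abcb) E1 -/X scaleNr addrC.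
have b'0 : mxof (@psi i b') != 0.
  apply: contraNneq Xk' => /(congr1 (row k)); rewrite b'E row0 linearB linearZ /=.
  rewrite !row_mul (mxofE (row k X : E i) (lpsi _ Ac)) cE -rowE.
  by move/eqP; rewrite subr_eq0 => /eqP ->; exact: scalemx_sub.
have := dmin (\rank (mxof (@psi i b'))); rewrite b'E -bd leqNgt hl => h.
suff : false by []; apply: h; apply/asboolP; exists b'; split=> //.
by rewrite b'E.
Qed.

Lemma rank1_operator i (e : H -> H) : A e -> \rank (mxof (@psi i e)) = 1%N ->
  exists z x : E i, [/\ z != 0, x != 0 & forall v, @psi i e v = hdot v z *: x].
Proof.
move=> Ae; set X := mxof _ => X1.
have [b Xb] : exists b, row b X != 0.
  apply: contrapT => no; move: X1; suff -> : X = 0 by rewrite mxrank0.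
  by apply/row_matrixP => k; rewrite row0; apply/eqP/negPn/negP => h; apply: no; exists k.
have XX : (X <= row b X)%MS.
  rewrite -(geq_leqif (mxrank_leqif_sup (row_sub b X))) X1.
  by rewrite lt0n mxrank_eq0.
have /submxP[k kE] := XX.
(* The conjugation compensates for the conjugate-linearity of [hdot] in its second argument. *)
pose z : E i := \row_j Num.conj (k j 0).
have eE v : @psi i e v = hdot v z *: (row b X : E i).
  rewrite -(mxofE v (@psi_linear i _ Ae)) -/X.
  transitivity ((v : 'rV_(n i)) *m k *m row b X); first by rewrite -mulmxA -kE.
  rewrite [v *m k]mx11_scalar mul_scalar_mx; congr (_ *: _).
  rewrite -[hdot v z]/(dotmx (v : 'rV_(n i)) z) dotmxE; congr ((_ *m _) 0 0).
  by apply/matrixP => j l; rewrite ord1 !mxE conjCK.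
exists z, (row b X : E i); split=> //; apply/eqP => z0; move/eqP: Xb; apply.
by rewrite rowK eE z0 hdot0r scale0r.
Qed.

Lemma hdot_delta m (v : euclidean R m) k : hdot v (delta_mx 0 k : euclidean R m) = (v : 'rV_m) 0 k.
Proof.
rewrite -[LHS]/(dotmx (v : 'rV_m) (delta_mx 0 k)) dotmxE mxE (bigD1 k) //= big1 => [|j jk].
  by rewrite !mxE !eqxx conjC1 mulr1 addr0.
by rewrite !mxE (negPf jk) andbF conjC0 mulr0.
Qed.

Lemma block_full i a : block_ideal i a -> @psi i a <> 0 ->
  forall M : E i -> E i, linear M -> exists2 e, block_ideal i e & @psi i e = M.
Proof.
move=> Ja a0 M lM; have [e Je e1] := block_ideal_rank1 Ja a0.
have [Ae _] := Je; have [z [x [z0 x0 eE]]] := rank1_operator Ae e1.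
(* If e acts as <., z> x, then c e d acts as <., z'> y once c moves x to y and the adjoint of d
   moves z to z'. Sums of such operators exhaust the linear maps. *)
have rank1 (z' y : E i) : exists c, block_ideal i c /\ @psi i c = fun v => hdot v z' *: y.
  have [d' Ad' d'z] := psi_transitive z' z0; have [d Ad dd'] := alg_adj opsys_alg Ad'.
  have [c Ac cx] := psi_transitive y x0.
  exists (c \o (e \o d)); split; first exact: block_idealM.
  apply: funext => v; rewrite (rep_comp (psi_rep i)) //; last exact: (alg_comp opsys_alg).
  rewrite (rep_comp (psi_rep i)) //= eE (lin_opZ (@psi_linear i _ Ac)) cx -d'z.
  by rewrite (rep_adj (psi_rep i) Ad Ad' (adjoint_sym dd')).
have [c Hc] := choice (fun k => rank1 (delta_mx 0 k : E i) (M (delta_mx 0 k))).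
have Ac k : A (c k) by have [[]] := Hc k.
exists (\sum_k c k).
  split; first exact: (alg_sum opsys_alg).
  move=> j ji; rewrite (rep_sum opsys_alg (psi_rep j)) // big1 // => k _.
  by have [[_ cj] _] := Hc k; exact: cj.
apply: funext => v; rewrite (rep_sum opsys_alg (psi_rep i)) // fct_sumE.
rewrite {2}[v]row_sum_delta (lin_op_sum lM); apply: eq_bigr => k _.
by have [_ ->] := Hc k; rewrite hdot_delta (lin_opZ lM).
Qed.

(** A crude bound, but it reduces convergence of operators to that of the images of finitely many
    vectors, where [bw_hpow] applies. *)
Lemma opbd_basis m (J K : finType) (T : hpow J (euclidean R m) -> hpow K (euclidean R m)) :
  linear T ->
  opbd T (\sum_(t : J * 'I_m) hnorm (T (hinj (K := fun=> euclidean R m) t.1 (delta_mx 0 t.2 : euclidean R m)))).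
Proof.
move=> lT x; rewrite {1}[x]hpow_hinj_sum (lin_op_sum lT).
apply: le_trans (hnorm_sum _ _ _) _; rewrite mulr_suml -(pair_bigA _ (fun j b =>
  hnorm (T (hinj (K := fun=> euclidean R m) j (delta_mx 0 b : euclidean R m))) * hnorm x)) /=.
apply: ler_sum => j _.
have lTj : linear (fun v : euclidean R m => T (hinj (K := fun=> euclidean R m) j v)).
  by move=> a u v; rewrite hinj_linear lT.
rewrite {1}[x j]row_sum_delta (lin_op_sum lTj).
apply: le_trans (hnorm_sum _ _ _) _; apply: ler_sum => b _.
rewrite (lin_opZ lTj) hnorm_scale mulrC ler_wpM2l ?hnorm_ge0 //.
by apply: le_trans (hnorm_coord_euclid _ _) _; exact: hnorm_coord.
Qed.

(* A cluster point of the powers of (T^* T) / |psi_i T|^2 vanishes on every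
   block but the i-th, where it fixes the norm attaining vectors. *)
Lemma block_ideal_nonzero i (J : finType) (T : J -> J -> H -> H) :
  (forall j k, S (T j k)) -> peaks_at i T ->
  exists2 a, block_ideal i a & @psi i a <> 0.
Proof.
move=> T_S [r [r0 Tr [x1 x1r]]].
have T_A j k : A (T j k) by exact: opsys_sub.
pose M := @mxalg R H A J.
have M_alg : cstar_subalgebra M := @mxalg_cstar R H A J opsys_alg.
have M1 : M idfun := @mxalg_id R H A J opsys_alg cstar1.
pose rho j := mxrep (J := J) (@psi j).
have rho_rep j : representation M (rho j) := @mxrep_rep R H A J opsys_alg (E j) (@psi j) (psi_rep j).
pose t := opmx T; have Mt : M t := mxalg_opmx opsys_alg T_A.
have rt j : rho j t = psimx j T.
  congr opmx; apply: funext => p; apply: funext => q; rewrite opmxK // => a b.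
  by have [] := opsys_bd (T_S a b).
have [t' Mt' tt'] := alg_adj M_alg Mt.
have rtt' j : adjoint (rho j t) (rho j t') := rep_adj (rho_rep j) Mt Mt' tt'.
have bt j : bounded_op (rho j t) := rep_bd (rho_rep j) Mt.
have bt' j : bounded_op (rho j t') := rep_bd (rho_rep j) Mt'.
(* The norm of the adjoint is taken so that [attains_adjoint], with t' in the role of its X, gives
   rho(t') rho(t) x0 = l^2 x0 on block i. *)
pose l := opnorm (rho i t').
have tl : opbd (rho i t) l.
  exact: (adjoint_bd (opnorm_ge0 (bt' i)) (adjoint_sym (rtt' i)) (opnorm_bd (bt' i))).
have rl : r < l.
  rewrite ltNge; apply/negP => lr; move: x1r; rewrite -rt ltNge => /negP; apply.
  exact: (opbdW lr tl).
have l0 : 0 < l := le_lt_trans r0 rl.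
have x10 : x1 != 0.
  apply: contraTneq x1r => ->.
  by rewrite -rt (lin_op0 (bt i).1) !hnorm0 mulr0 ltxx.
have [x0 x00 x0b] := norm_attained (bt i) (ex_intro _ x1 x10).
have [_ fix0] := attains_adjoint (bt' i) (adjoint_sym (rtt' i)) l0 (conj x00 x0b).
pose h := ((l ^- 2)%:C)%C *: (t' \o t).
have Mh : M h := algZ M_alg _ (alg_comp M_alg Mt' Mt).
have rh j : rho j h = ((l ^- 2)%:C)%C *: (rho j t' \o rho j t).
  by rewrite (repZ M_alg (rho_rep j) _ (alg_comp M_alg Mt' Mt)) (rep_comp (rho_rep j) Mt' Mt).
have rhE j x : rho j h x = ((l ^- 2)%:C)%C *: rho j t' (rho j t x) by rewrite rh.
have l20 : 0 <= l ^- 2 by rewrite invr_ge0 exprn_ge0 // ltW.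
have rh_bd j c : 0 <= c -> opbd (rho j t) c -> opbd (rho j h) (l ^- 2 * c ^+ 2).
  move=> c0 tc x; rewrite rhE.
  rewrite (hnorm_scale ((l ^- 2)%:C)%C (rho j t' (rho j t x))).
  rewrite cabs_real (ger0_norm l20) -[leRHS]mulrA; apply: ler_wpM2l l20 _ _ _.
  apply: le_trans (adjoint_bd c0 (rtt' j) tc _) _.
  by rewrite expr2 -mulrA; apply: ler_wpM2l c0 _ _ (tc x).
pose u k : hpow J H -> hpow J H := iter k (fun f => h \o f) idfun.
have Mu k : M (u k) by elim: k => [|k IH] //=; exact: (alg_comp M_alg).
have ru j k : rho j (u k) = iter k (fun f => rho j h \o f) idfun.
  elim: k => [|k IH]; first exact: (rep1 (rho_rep j)).
  by rewrite /= (rep_comp (rho_rep j) Mh (Mu k)) IH.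
have ru_bd j k c : 0 <= c -> opbd (rho j h) c -> opbd (rho j (u k)) (c ^+ k).
  move=> c0 hc; rewrite ru; elim: k => [|k IH] x.
    rewrite expr0 [leRHS]mul1r; exact: lexx.
  apply: le_trans (hc _) _; rewrite exprS -[leRHS]mulrA.
  exact: ler_wpM2l c0 _ _ (IH x).
have ru_fix k : rho i (u k) x0 = x0.
  rewrite ru; elim: k => [|k IH] //=; rewrite IH rhE fix0.
  rewrite scalerA -rmorphM /= mulVf ?scale1r // gt_eqF // exprn_gt0 //.
have rh1 : opbd (rho i h) 1.
  apply: opbdW (rh_bd i l (ltW l0) tl); rewrite mulVf // gt_eqF // exprn_gt0 //.
have ru1 k : opbd (rho i (u k)) 1 by rewrite -(expr1n _ k); exact: ru_bd.
pose q := l ^- 2 * r ^+ 2.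
have q0 : 0 <= q by rewrite mulr_ge0 // sqr_ge0.
have q1 : q < 1.
  by rewrite /q mulrC ltr_pdivrMr ?exprn_gt0 // mul1r ltr_pXn2r // nnegrE ltW.
have ruq j k : j != i -> opbd (rho j (u k)) (q ^+ k).
  by move=> ji; apply: ru_bd q0 _; apply: rh_bd => //; rewrite rt; exact: Tr.
have diff j a b : M a -> M b -> rho j (a - b) = rho j a - rho j b.
  by move=> Ma Mb; exact: (repB (rho_rep j)).
have by_blocks B e : M B -> 0 <= e -> (forall j, opbd (rho j B) e) -> opbd B e.
  move=> [lB AB] e0 hB; rewrite -(entryK lB).
  exact: (blocks_opbd blocks psi_rep AB e0).2 hB.
(* The vector [z k] collects the images of the basis under the contraction [rho i (u k)], so
   compactness gives a convergent subsequence of these operators. *)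
pose bas (p : J * 'I_(n i)) : hpow J (E i) :=
  hinj (K := fun=> E i) p.1 (delta_mx 0 p.2 : E i).
pose z k : hpow (J * 'I_(n i) * J)%type (E i) := hvec (fun p => rho i (u k) (bas p.1) p.2).
have bas1 p : hnorm (bas p) = 1.
  apply: etrans (@hnorm_hinj R _ (fun=> E i) p.1 _) _.
  exact: hnorm_delta.
pose C : R := \sum_(p : J * 'I_(n i)) \sum_(p' : J) 1.
have C0 : 0 <= C by apply: sumr_ge0 => p _; exact: sumr_ge0.
have zC k : hnorm (z k) <= C.
  apply: le_trans (hnorm_le_sum _) _; rewrite /C pair_big /=; apply: ler_sum => p _.
  apply: le_trans (hnorm_coord (rho i (u k) (bas p.1)) p.2) _.
  apply: le_trans (ru1 k _) _.
  by rewrite mul1r bas1.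
have [f [y [fk Hf]]] := bw_hpow zC.
have dz a b : opbd (rho i (u a) - rho i (u b)) (C * hnorm (z a - z b)).
  have ld : linear (rho i (u a) - rho i (u b)).
    by rewrite -diff //; exact: (rep_bd (rho_rep i) (algB M_alg (Mu a) (Mu b))).1.
  apply: opbdW (opbd_basis ld); rewrite mulr_suml; apply: ler_sum => p _.
  apply: le_trans (hnorm_le_sum _) _; rewrite mulr_suml; apply: ler_sum => p' _.
  rewrite mul1r; have := hnorm_coord (z a - z b) (p, p'); rewrite hpowB.
  apply: le_trans; rewrite [X in hnorm X](hpowB (rho i (u a) (bas p)) (rho i (u b) (bas p)) p').
  exact: lexx.
(* On block i the subsequence is Cauchy by compactness; on every other block the powers are bounded
   by q^k, uniformly in j. The norm is controlled by the bounds on all blocks. *)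
have cau e : 0 < e -> exists N, forall a b, (N <= a)%N -> (N <= b)%N ->
    opbd (u (f a) - u (f b)) e.
  move=> e0; have e2 : 0 < e / 2 by rewrite divr_gt0.
  have C1 : 0 < C + 1 by rewrite ltr_wpDl.
  have [N1 HN1] := expr_small q0 q1 e2; have [N2 HN2] := Hf _ (divr_gt0 e2 C1).
  exists (maxn N1 N2) => a b; rewrite !geq_max => /andP[a1 a2] /andP[b1 b2].
  apply: by_blocks (ltW e0) _; first exact: (algB M_alg).
  move=> j; rewrite diff //; have [->|ji] := eqVneq j i.
    apply: opbdW (dz _ _).
    have h1 : hnorm (z (f a) - z (f b)) <= e / (C + 1).
      have -> : e / (C + 1) = e / 2 / (C + 1) + e / 2 / (C + 1) by field; rewrite gt_eqF.
      rewrite -(subrKA y); apply: le_trans (hnorm_triangle _ _) _; apply: lerD.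
        exact: ltW (HN2 a a2).
      by rewrite hnormBC; exact: ltW (HN2 b b2).
    apply: le_trans (ler_wpM2l C0 h1) _; rewrite mulrCA ger_pMr // ler_pdivrMr //.
    by rewrite mul1r lerDl.
  move=> x; apply: le_trans (hnorm_triangle _ _) _; rewrite hnorm_opp (splitr e) mulrDl.
  apply: lerD; apply: le_trans (ruq j _ ji x) _; apply: ler_wpM2r (hnorm_ge0 _) _ _ _.
    by apply/ltW/HN1/(leq_trans a1 (fk a)).
  by apply/ltW/HN1/(leq_trans b1 (fk b)).
have [B bB uB] := op_complete (fun k => alg_bd M_alg (Mu (f k))) cau.
have MB : M B.
  apply: cstar_closed M_alg bB _ => e e0; have [N HN] := uB e e0.
  by exists (u (f N)); [exact: Mu|move=> x; rewrite hnormBC; exact: (HN N (leqnn N) x)].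
have rB j e : 0 < e -> exists N, forall k, (N <= k)%N -> opbd (rho j (u (f k)) - rho j B) e.
  move=> e0; have [N HN] := uB e e0; exists N => k Nk; rewrite -diff //.
  exact: (rep_contractive M_alg M1 (rho_rep j) (algB M_alg (Mu _) MB) (ltW e0) (HN k Nk)).
have rBj j : j != i -> rho j B = 0.
  move=> ji; apply: funext => x.
  apply: (hnorm_le0_eq (c := 2 * hnorm x)); first by rewrite mulr_ge0 ?hnorm_ge0.
  move=> e e0; have [N1 HN1] := expr_small q0 q1 e0; have [N2 HN2] := rB j e e0.
  pose k := maxn N1 N2; apply: le_trans (hnormB_le _ (rho j (u (f k)) x)) _.
  have -> : 2 * hnorm x * e = e * hnorm x + e * hnorm x by ring.
  apply: lerD; last by rewrite hnormBC; exact: HN2 (leq_maxr _ _) x.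
  apply: le_trans (ruq j _ ji x) _; apply: ler_wpM2r (hnorm_ge0 _) _ _ _.
  by apply/ltW/HN1/(leq_trans (leq_maxl _ _) (fk k)).
have rBi : rho i B x0 = x0.
  apply/eqP; rewrite -subr_eq0; apply/eqP.
  apply: (hnorm_le0_eq (c := hnorm x0)); first exact: hnorm_ge0.
  move=> e e0; have [N HN] := rB i e e0; have := HN N (leqnn N) x0.
  by rewrite fctE ru_fix hnormBC mulrC.
have [lB AB] := MB.
have eB j p c : @psi j (entry B p c) = entry (rho j B) p c.
  by rewrite /rho /mxrep opmxK // => a b; exact: (@psi_linear j _ (AB a b)).
(* The entries of B lie in the ideal of block i. If psi_i killed all of them, B would act by 0 on
   that block, although it fixes x0. *)
apply: contrapT => no; move/eqP: x00; apply.
have rB0 : rho i B = 0.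
  have lr : linear (rho i B) := (rep_bd (rho_rep i) MB).1.
  rewrite -(entryK lr); apply: funext => x; apply: hpowP => p; rewrite opmxE.
  apply: big1 => c _; rewrite -eB; suff -> : @psi i (entry B p c) = 0 by [].
  apply: contrapT => nz; apply: no; exists (entry B p c) => //; split; first exact: AB.
  move=> j ji; rewrite eB rBj //.
by rewrite -rBi rB0.
Qed.

Definition full_block i := forall M : E i -> E i, linear M ->
  exists2 e, block_ideal i e & @psi i e = M.

Lemma peak_full_block i (J : finType) (T : J -> J -> H -> H) :
  (forall j k, S (T j k)) -> peaks_at i T -> full_block i.
Proof.
move=> T_S /(block_ideal_nonzero T_S)[a Ja a0]; exact: block_full Ja a0.
Qed.

Lemma block_ideal_inj i a b : block_ideal i a -> block_ideal i b ->
  @psi i a = @psi i b -> a = b.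
Proof.
move=> [Aa aj] [Ab bj] ab; apply: psi_inj => // j.
by have [->|ji] := eqVneq j i; rewrite ?ab // aj // bj.
Qed.

Lemma block_idealMl i a c : A a -> block_ideal i c -> block_ideal i (a \o c).
Proof. by move=> Aa Jc; exact: (block_idealM Aa cstar1 Jc). Qed.

(** * Representations and the ideal of a block *)

Section FullBlock.
Variables (i : I) (L : hilbert R) (sigma : (H -> H) -> (L -> L)).
Hypotheses (full : full_block i) (sigma_rep : representation A sigma).
Variable zeta : H -> H.
Hypotheses (Jzeta : block_ideal i zeta) (psi_zeta : @psi i zeta = idfun).

(** 1 - zeta acts by 0 on block i and by 1 on the others, so multiplying T by it leaves only the
    blocks bounded by r, while sigma maps it to 1. *)
Lemma rep_vanish_bound (J K : finType) (T : J -> K -> H -> H) r :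
  (forall j k, A (T j k)) -> 0 <= r -> (forall j, j != i -> opbd (psimx j T) r) ->
  sigma zeta = 0 -> opbd (opmx (fun j k => sigma (T j k))) r.
Proof.
move=> T_A r0 Tr s0; have [Az zj] := Jzeta.
pose w := idfun - zeta; have Aw : A w := algB opsys_alg cstar1 Az.
pose T1 j k := w \o T j k.
have AT1 j k : A (T1 j k) := alg_comp opsys_alg Aw (T_A j k).
have wi : @psi i w = 0 by rewrite (repB (psi_rep i) cstar1 Az) (rep1 (psi_rep i)) psi_zeta subrr.
have wj j : j != i -> @psi j w = idfun.
  by move=> ji; rewrite (repB (psi_rep j) cstar1 Az) (rep1 (psi_rep j)) zj // subr0.
have ws : sigma w = idfun.
  by rewrite (repB sigma_rep cstar1 Az) (rep1 sigma_rep) s0 subr0.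
have T1r : opbd (opmx T1) r.
  apply: (blocks_opbd blocks psi_rep AT1 r0).2 => j x.
  have [ji|ji] := eqVneq j i.
    have wj0 : @psi j w = 0 by rewrite ji.
    have -> : opmx (fun p q => @psi j (T1 p q)) x = 0.
      apply: hpowP => p; rewrite opmxE; apply: big1 => q _.
      by rewrite (rep_comp (psi_rep j)) // wj0.
    by rewrite hnorm0 mulr_ge0 // hnorm_ge0.
  have -> : opmx (fun p q => @psi j (T1 p q)) x = psimx j T x.
    apply: hpowP => p; rewrite /psimx !opmxE; apply: eq_bigr => q _.
    by rewrite (rep_comp (psi_rep j)) // wj.
  exact: Tr.
have := rep_mx_contractive opsys_alg cstar1 sigma_rep AT1 r0 T1r.
have -> // : (fun j k => sigma (T1 j k)) = fun j k => sigma (T j k).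
by apply: funext => p; apply: funext => q; rewrite (rep_comp sigma_rep) // ws.
Qed.

(* With e a rank-one projection onto a unit vector v of the block and sigma(e)
   xi = xi, the embedding is psi_i(a) v |-> sigma(a) xi. *)
Lemma block_embedding : sigma zeta <> 0 -> exists U : E i -> L,
  [/\ linear U, forall u w, hdot (U u) (U w) = hdot u w &
      forall a v, A a -> U (@psi i a v) = sigma a (U v)].
Proof.
move=> sz.
have [v v1] : exists v : E i, hdot v v = 1.
  have [_ [x /eqP x0] _] := psi_irr i.
  have n0 : hnorm x != 0 by rewrite hnorm_eq0.
  exists ((((hnorm x)^-1)%:C)%C *: x); rewrite hdotxx hnorm_scale cabs_real.
  by rewrite ger0_norm ?invr_ge0 ?hnorm_ge0 // mulVf // expr1n.
have l1 (z y : E i) : linear (fun x : E i => hdot x z *: y).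
  by move=> c x x'; rewrite hdotDl hdotZl scalerDl scalerA.
(* [b u] realizes <., v> u on the block; elements of the ideal are determined by their i-th block,
   so identities among them are checked there. *)
have h u : exists b, block_ideal i b /\ @psi i b = fun x => hdot x v *: u.
  by have [b Jb bE] := full (l1 v u); exists b.
have [b Hb] := choice h.
have Jb u : block_ideal i (b u) by have [] := Hb u.
have Ab u : A (b u) by have [] := Jb u.
have bE u x : @psi i (b u) x = hdot x v *: u by have [_ ->] := Hb u.
pose e := b v; have Ae : A e := Ab v.
have be u : b u \o e = b u.
  apply: block_ideal_inj (block_idealMl (Ab u) (Jb v)) (Jb u) _; apply: funext => x.
  by rewrite (rep_comp (psi_rep i)) //= !bE hdotZl v1 mulr1.
(* zeta is a sum of products b_k g_k with b_k = b_k e, so sigma(e) = 0 would give sigma(zeta) =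
   0. *)
have se : sigma e <> 0.
  move=> se0; apply: sz.
  have sb u : sigma (b u) = 0.
    rewrite -(be u) (rep_comp sigma_rep) // se0; apply: funext => x /=.
    exact: (lin_op0 (rep_bd sigma_rep (Ab u)).1).
  have hg k : exists g, block_ideal i g /\ @psi i g = fun x => hdot x (delta_mx 0 k : E i) *: v.
    by have [g Jg gE] := full (l1 (delta_mx 0 k : E i) v); exists g.
  have [g Hg] := choice hg.
  have Ag k : A (g k) by have [[]] := Hg k.
  have Abg k : A (b (delta_mx 0 k) \o g k) := alg_comp opsys_alg (Ab _) (Ag k).
  have zE : zeta = \sum_k (b (delta_mx 0 k) \o g k).
    apply: block_ideal_inj Jzeta _ _.
      split; first exact: (alg_sum opsys_alg).
      move=> j ji; rewrite (rep_sum opsys_alg (psi_rep j)) // big1 // => k _.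
      have [[_ gj] _] := Hg k; have [_ bj] := Jb (delta_mx 0 k).
      by rewrite (rep_comp (psi_rep j)) // bj.
    apply: funext => x; rewrite psi_zeta (rep_sum opsys_alg (psi_rep i)) // fct_sumE.
    rewrite {1}[x]row_sum_delta; apply: eq_bigr => k _.
    rewrite (rep_comp (psi_rep i)) //= bE; have [_ ->] := Hg k.
    by rewrite hdotZl v1 mulr1 hdot_delta.
  rewrite zE (rep_sum opsys_alg sigma_rep) // big1 // => k _.
  by rewrite (rep_comp sigma_rep) // sb.
have [xi [xi1 exi]] : exists xi, hdot xi xi = 1 /\ sigma e xi = xi.
  have [x0 ex0] : exists x0, sigma e x0 != 0.
    apply: contrapT => no; apply: se; apply: funext => x.
    by apply/eqP/negPn/negP => ex; apply: no; exists x.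
  have n0 : hnorm (sigma e x0) != 0 by rewrite hnorm_eq0.
  exists ((((hnorm (sigma e x0))^-1)%:C)%C *: sigma e x0); split.
    rewrite hdotxx hnorm_scale cabs_real.
    by rewrite ger0_norm ?invr_ge0 ?hnorm_ge0 // mulVf // expr1n.
  rewrite (lin_opZ (rep_bd sigma_rep (Ab v)).1); congr (_ *: _).
  by have := congr1 (fun t => sigma t x0) (be v); rewrite (rep_comp sigma_rep).
exists (fun u => sigma (b u) xi); split.
- move=> c u w; have -> : b (c *: u + w) = c *: b u + b w.
    apply: block_ideal_inj (Jb _) (block_ideal_lincomb _ (Jb u) (Jb w)) _.
    apply: funext => x; rewrite (rep_lincomb (psi_rep i)) // !fctE !bE.
    by rewrite scalerDr !scalerA mulrC.
  by rewrite (rep_lincomb sigma_rep).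
- move=> u w; have [b' Ab' bb'] := alg_adj opsys_alg (Ab w).
  have sbb := adjoint_sym (rep_adj sigma_rep (Ab w) Ab' bb').
  rewrite -(sbb _ xi).
  have b'u : @psi i b' u = hdot u w *: v.
    apply: hdot_inj => y; rewrite (adjoint_sym (rep_adj (psi_rep i) (Ab w) Ab' bb')).
    by rewrite bE hdotZr hdotZl -(hdotC v y); move: (hdot v y) (hdot u w) => p q; rewrite mulrC.
  (* Applied to xi, which sigma(e) fixes, this yields <U u, U w> = <u, w> <xi, xi>. *)
  have E1 : b' \o b u = hdot u w *: e.
    apply: block_ideal_inj (block_idealMl Ab' (Jb u)) _ _.
      rewrite -[_ *: _]addr0; exact: block_ideal_lincomb (Jb v) (block_ideal0 i).
    apply: funext => x; rewrite (rep_comp (psi_rep i)) //= bE.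
    rewrite (lin_opZ (@psi_linear i _ Ab')) b'u (repZ opsys_alg (psi_rep i) _ Ae).
    rewrite -[RHS]/(hdot u w *: @psi i e x) (bE v x).
    by move: (hdot x v) (hdot u w) => p q; rewrite !scalerA (mulrC p).
  have : sigma (b' \o b u) xi = sigma (hdot u w *: e) xi by rewrite E1.
  rewrite (rep_comp sigma_rep Ab' (Ab u)) (repZ opsys_alg sigma_rep _ Ae) => E2.
  apply: etrans (congr1 (hdot^~ xi) E2) _; rewrite -[X in hdot X xi]/(hdot u w *: sigma e xi) exi.
  by rewrite hdotZl xi1 mulr1.
- move=> a u Aa; have -> : b (@psi i a u) = a \o b u.
    apply: block_ideal_inj (Jb _) (block_idealMl Aa (Jb u)) _; apply: funext => x.
    by rewrite (rep_comp (psi_rep i)) //= !bE (lin_opZ (@psi_linear i _ Aa)).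
  by rewrite (rep_comp sigma_rep).
Qed.

End FullBlock.

Section MapNorm.
Variables (K L M : hilbert R) (m : nat) (f : (K -> K) -> L -> M) (T : 'M[K -> K]_m).

Let mapE : (fun a b => map_mx f T a b) = fun a b => f (T a b).
Proof. by apply: funext => a; apply: funext => b; rewrite mxE. Qed.

Lemma mxnorm_map_le c : 0 <= c -> opbd (opmx (fun a b => f (T a b))) c ->
  mxnorm (map_mx f T) <= c.
Proof. by move=> c0 Tc; apply: mxnorm_le c0 _; rewrite mapE; exact: Tc. Qed.

Lemma mxnorm_map_bd : (forall a b, bounded_op (f (T a b))) ->
  opbd (opmx (fun a b => f (T a b))) (mxnorm (map_mx f T)).
Proof. by move=> fT; rewrite -mapE; apply: mxnorm_bd => a b; rewrite mxE. Qed.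

Lemma mxnorm_map_ge0 : (forall a b, bounded_op (f (T a b))) -> 0 <= mxnorm (map_mx f T).
Proof. by move=> fT; apply: mxnorm_ge0 => a b; rewrite mxE. Qed.
End MapNorm.

(** * Omitting one block *)

Section Omission.
Variable i : I.
Local Notation others :=
  (direct_sum_rep (fun j : {j : I | j != i} => @psi (val j))).

Lemma others_opbd (J K : finType) (T : J -> K -> H -> H) c :
  (forall p q, A (T p q)) -> 0 <= c ->
  opbd (opmx (fun p q => others (T p q))) c <->
  forall j, j != i -> opbd (psimx j T) c.
Proof.
move=> T_A c0.
have h := @direct_sum_mx_opbd R {j : I | j != i} (fun j => E (val j)) H A
  (fun j => @psi (val j)) opsys_alg cstar1 (fun j => psi_rep (val j)) J K T c T_A c0.
split=> [/h Tc j ji|Tc]; first exact: (Tc (exist _ j ji)).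
by apply/h => j; exact: Tc (valP j).
Qed.

Lemma others_bd a : A a -> bounded_op (others a).
Proof.
exact: (@direct_sum_rep_bd R {j : I | j != i} (fun j => E (val j)) H A
  (fun j => @psi (val j)) opsys_alg cstar1 (fun j => psi_rep (val j))).
Qed.

(** r is the norm of a witness T over the other blocks. Were psi_i T bounded by r as well, every
    block would be, and omitting block i would not change the norm of T. *)
Lemma not_isometric_peaks : ~ completely_isometric S others ->
  exists m (T : 'M[H -> H]_m) r, [/\ entries_in S T, 0 <= r,
    forall j, j != i -> opbd (psimx j (fun a b => T a b)) r &
    exists x, r * hnorm x < hnorm (psimx i (fun a b => T a b) x)].
Proof.
move=> nci.
have [m [T [ST nT]]] : exists m (T : 'M[H -> H]_m), entries_in S T /\
    mxnorm (map_mx others T) <> mxnorm T.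
  apply: contrapT => no; apply: nci => m T ST; apply: contrapT => nT.
  by apply: no; exists m, T.
have AT a b : A (T a b) := opsys_sub (ST a b).
have bT a b : bounded_op (T a b) := opsys_bd (ST a b).
have boT a b : bounded_op (others (T a b)) := others_bd (AT a b).
exists m, T, (mxnorm (map_mx others T)).
have r0 := mxnorm_map_ge0 boT.
have Tr := (others_opbd AT r0).1 (mxnorm_map_bd boT).
split=> //; apply: contrapT => no; apply: nT; apply/eqP; rewrite eq_le; apply/andP; split.
  apply: mxnorm_map_le (mxnorm_ge0 bT) _; apply/(others_opbd AT (mxnorm_ge0 bT)) => j _.
  exact: ((blocks_opbd blocks psi_rep AT (mxnorm_ge0 bT)).1 (mxnorm_bd bT) j).
apply: (mxnorm_le r0); apply/(blocks_opbd blocks psi_rep AT r0) => j.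
have [->|ji] := eqVneq j i; last exact: Tr.
by move=> x; rewrite leNgt; apply/negP => h; apply: no; exists x.
Qed.

Lemma minimal_not_isometric : minimal S -> ~ completely_isometric S others.
Proof.
move=> minS ci.
pose G : set H := [set x | pr i x = 0].
have lpr : linear (pr i) := @pr_lin _ _ _ _ _ _ _ _ blocks i.
have linc : linear (@inc i) := @inc_lin _ _ _ _ _ _ _ _ blocks i.
have [_ [v v0] _] := psi_irr i.
pose P x := x - inc (pr i x).
have pP x : pr i (P x) = 0 by rewrite (lin_opB lpr) (pr_inc blocks) subrr.
have perp y w : G y -> hdot (inc (w : E i)) y = 0.
  by move=> Gy; rewrite (hdot_inc blocks) Gy hdot0r.
have G_proj : orthogonal_projection G P.
  move=> x; split=> [|y Gy]; first exact: pP.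
  by rewrite /P opprB addrC subrK perp.
have lP : linear P.
  by move=> a x y; rewrite /P lpr linc scalerBr opprD addrACA.
have pr_le x : hnorm (pr i x) <= hnorm x.
  have [->|n0] := eqVneq (pr i x) 0; first by rewrite hnorm0 hnorm_ge0.
  have n1 : 0 < hnorm (pr i x) by rewrite hnorm_gt0.
  have := Re_hdot_le (inc (pr i x)) x.
  by rewrite (hdot_inc blocks) hdotxx (hnorm_inc blocks) /= expr2 ler_pM2l.
have G_sub : closed_subspace G.
  split=> [|a x y Gx Gy|x h]; rewrite /G /=; first exact: (lin_op0 lpr).
    by rewrite lpr Gx Gy scaler0 addr0.
  apply: (@hnorm_le0_eq R (E i) (pr i x) 1) => // e e0; have [y Gy xy] := h e e0.
  rewrite -[pr i x]subr0 -Gy -(lin_opB lpr) mul1r.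
  exact: le_trans (pr_le _) (ltW xy).
have G_inv : Defs.invariant S G.
  move=> s x Ss Gx; rewrite /G /= (pr_act blocks) ?Gx; last exact: opsys_sub.
  exact: (lin_op0 (@psi_linear i _ (opsys_sub Ss))).
apply: (minS G G_sub).
- move=> GT; apply: v0; rewrite -(pr_inc blocks v).
  by have : G (inc v) by rewrite GT.
- split=> // s x Ss xG y Gy; have [s' Ss' ss'] := opsys_adj Ss.
  by rewrite ss' xG //; exact: G_inv.
exists P => // m T ST.
have AT a b : A (T a b) := opsys_sub (ST a b).
have bT a b : bounded_op (T a b) := opsys_bd (ST a b).
have G0 : G 0 := lin_op0 lpr.
have GZ a x : G x -> G (a *: x).
  by move=> Gx; rewrite /G /= (lin_opZ lpr) Gx scaler0.
have Pb : bounded_op P := proj_bd G_sub G_proj.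
have bPT a b : bounded_op (map_mx (fun s : H -> H => P \o s) T a b).
  by rewrite mxE; exact: bounded_op_comp.
have mapE : (fun a b => map_mx (fun s : H -> H => P \o s) T a b) = fun a b => P \o T a b.
  by apply: funext => a; apply: funext => b; rewrite mxE.
apply/eqP; rewrite eq_le; apply/andP; split.
  apply: (mxnorm_on_le G0 (mxnorm_ge0 bT)) => x Gx; rewrite mapE.
  exact: le_trans (opmx_proj_le G_sub G_proj _ _) (mxnorm_bd bT x).
(* The blocks other than i lie in G, where compressing T changes nothing, so the norm over them is
   at most that of the compression. *)
rewrite -(ci m T ST).
have c0 := mxnorm_on_ge0 G0 bPT; set c := mxnorm_on _ _ in c0 *.
apply: (mxnorm_map_le c0); apply/(others_opbd AT c0) => j ji w.
have Gw a : G (incn inc w a).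
  by rewrite /G /=; apply: (pr_inc_neq blocks); rewrite eq_sym.
have := mxnorm_on_bd G0 GZ bPT Gw; rewrite -/c (hnorm_incn blocks) mapE.
suff -> : opmx (fun a b => P \o T a b) (incn inc w) = incn inc (psimx j (fun a b => T a b) w).
  by rewrite (hnorm_incn blocks).
apply: hpowP => a; rewrite -(opmx_incn blocks psi_rep AT) !opmxE.
apply: eq_bigr => b _; rewrite /= /P (pr_act blocks) // Gw.
by rewrite (lin_op0 (@psi_linear i _ (AT a b))) (lin_op0 linc) subr0.
Qed.
End Omission.

(** * Peaking matrices and strongly peaking representations *)

Lemma isometry_closed (V W : hilbert R) (U : V -> W) : linear U ->
  (forall x, hnorm (U x) = hnorm x) -> closed_subspace (range U).
Proof.
move=> lU nU; split=> [|a _ _ [x _ <-] [y _ <-]|y h].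
- by exists 0 => //; exact: lin_op0.
- by exists (a *: x + y) => //; rewrite lU.
have h' k : exists x, hnorm (y - U x) < k.+1%:R^-1.
  by have [_ [x _ <-] xy] := h _ (natSinv_gt0 R k); exists x.
have [u Hu] := choice h'.
have [e e0|x ux] := @hilbert_complete R V u.
  have e2 : 0 < e / 2 by rewrite divr_gt0.
  have [N HN] := natSinv_small e2; exists N => a b Na Nb.
  rewrite -[X in X < _]/(hnorm (u a - u b)) -nU (lin_opB lU) -(subrKA y).
  apply: le_lt_trans (hnorm_triangle _ _) _; rewrite (splitr e); apply: ltrD.
    by rewrite hnormBC; apply: lt_le_trans (Hu a) (HN a Na).
  exact: lt_le_trans (Hu b) (HN b Nb).
exists x => //; apply/eqP; rewrite -subr_eq0; apply/eqP.
apply: (@hnorm_le0_eq R W _ 2) => // e e0.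
have [N1 HN1] := ux e e0; have [N2 HN2] := natSinv_small e0.
pose k := maxn N1 N2.
rewrite -(subrKA (U (u k))); apply: le_trans (hnorm_triangle _ _) _.
rewrite mulr_natl mulr2n; apply: lerD.
  by rewrite -(lin_opB lU) nU hnormBC; apply/ltW/HN1/leq_maxl.
by rewrite hnormBC; apply: le_trans (ltW (Hu k)) (HN2 k (leq_maxr _ _)).
Qed.

(** The range of U is closed, invariant and nonzero, hence everything since sigma is irreducible;
    the equivalence is the inverse of U. *)
Lemma embedding_equivalent i (L : hilbert R) (sigma : (H -> H) -> (L -> L)) (U : E i -> L) :
  irreducible_rep A sigma -> linear U -> (forall u w, hdot (U u) (U w) = hdot u w) ->
  (forall a v, A a -> U (@psi i a v) = sigma a (U v)) ->
  unitarily_equivalent A sigma (@psi i).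
Proof.
move=> [s_rep _ s_irr] lU dU Ua.
have nU x : hnorm (U x) = hnorm x by apply: eq_hnorm; exact: dU.
have Uinj x y : U x = U y -> x = y.
  move=> xy; apply/eqP; rewrite -subr_eq0 -hnorm_eq0 -nU (lin_opB lU) xy subrr.
  by rewrite hnorm0.
have Usurj : range U = setT.
  have [||//] := s_irr (range U) (isometry_closed lU nU).
    by move=> _ _ [a Aa <-] [v _ <-]; exists (@psi i a v) => //; exact: Ua.
  move=> U0; have [_ [v v0] _] := psi_irr i; exfalso; apply: v0.
  have : range U (U v) by exists v.
  rewrite U0 /= => Uv; apply: Uinj; rewrite Uv (lin_op0 lU) //.
have h y : exists x, U x = y.
  by have : range U y by [rewrite Usurj|]; case=> x _ <-; exists x.
have [V UV] := choice h.
have VU : cancel U V by move=> x; apply: Uinj; rewrite UV.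
exists V.
  split; last by move=> x y; rewrite -dU !UV.
    by move=> a x y; apply: Uinj; rewrite lU !UV.
  by exists U.
move=> a Aa; apply: funext => x /=; apply: Uinj.
by rewrite UV Ua // UV.
Qed.

Lemma irreducible_bound i (J : finType) (T : J -> J -> H -> H) r
    (L : hilbert R) (sigma : (H -> H) -> (L -> L)) :
  (forall p q, S (T p q)) -> 0 <= r -> (forall j, j != i -> opbd (psimx j T) r) ->
  (exists x, r * hnorm x < hnorm (psimx i T x)) ->
  irreducible_rep A sigma -> ~ unitarily_equivalent A sigma (@psi i) ->
  opbd (opmx (fun p q => sigma (T p q))) r.
Proof.
move=> ST r0 Tr xr s_irr neq; have [s_rep _ _] := s_irr.
have full : full_block i by apply: (peak_full_block ST); exists r.
have [z Jz zE] := full idfun (fun _ _ _ => erefl).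
have AT p q : A (T p q) := opsys_sub (ST p q).
apply: (rep_vanish_bound s_rep Jz zE AT r0 Tr).
apply: contrapT => sz; apply: neq.
have [U [lU dU Ua]] := block_embedding full s_rep Jz zE sz.
exact: embedding_equivalent s_irr lU dU Ua.
Qed.

Lemma peaks_strongly i m (T : 'M[H -> H]_m) r : entries_in S T -> 0 <= r ->
  (forall j, j != i -> opbd (psimx j (fun a b => T a b)) r) ->
  (exists x, r * hnorm x < hnorm (psimx i (fun a b => T a b) x)) ->
  strongly_peaking S (@psi i).
Proof.
move=> ST r0 Tr xr; split; first exact: psi_irr.
exists m, T; split=> //.
have AT a b : A (T a b) := opsys_sub (ST a b).
have rT : r < mxnorm (map_mx (@psi i) T).
  have bpT a b : bounded_op (@psi i (T a b)) := rep_bd (psi_rep i) (AT a b).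
  have [x xl] := xr; rewrite ltNge; apply/negP => h; move: xl; rewrite ltNge => /negP; apply.
  exact: le_trans (mxnorm_map_bd bpT x) (ler_wpM2r (hnorm_ge0 _) h).
apply: le_lt_trans rT; set Q := [set _ | _].
(* If every irreducible representation is equivalent to psi_i, the supremum is 0, which is still at
   most r. *)
have [->|/set0P Q0] := eqVneq Q set0; first by rewrite sup0.
apply: (sup_le_ub Q0) => _ [L [sigma [s_irr neq ->]]].
apply: (mxnorm_map_le r0).
exact: (irreducible_bound ST r0 Tr xr s_irr neq).
Qed.

(** The supremum over inequivalent representations serves as r, since every psi_j with j <> i is one
    of them by the second hypothesis. Complete contractivity bounds the set by the norm of T, so
    that the supremum is meaningful. *)
Lemma strongly_peaks i : strongly_peaking S (@psi i) ->
  (forall j, unitarily_equivalent A (@psi j) (@psi i) -> j = i) ->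
  exists m (T : 'M[H -> H]_m), entries_in S T /\ peaks_at i (fun a b => T a b).
Proof.
move=> [_ [m [T [ST]]]]; set Q := [set _ | _] => QT neq.
have AT a b : A (T a b) := opsys_sub (ST a b).
have bT a b : bounded_op (T a b) := opsys_bd (ST a b).
have bpT (L : hilbert R) (sigma : (H -> H) -> (L -> L)) (s_rep : representation A sigma)
    a b : bounded_op (sigma (T a b)) := rep_bd s_rep (AT a b).
have Qub : has_ubound Q.
  exists (mxnorm T) => _ [L [sigma [[s_rep _ _] _ ->]]].
  apply: (mxnorm_map_le (mxnorm_ge0 bT)).
  exact: rep_mx_contractive opsys_alg cstar1 s_rep AT (mxnorm_ge0 bT) (mxnorm_bd bT).
have Qj j : j != i -> mxnorm (map_mx (@psi j) T) <= sup Q.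
  move=> /eqP ji; apply: (ub_le_sup Qub).
  by exists (E j), (@psi j); split=> [||] //; move/neq.
have Q0 : 0 <= sup Q.
  have [->|/set0P [q Qq]] := eqVneq Q set0; first by rewrite sup0.
  have [L [sigma [[s_rep _ _] _ qE]]] := Qq.
  apply: (le_trans _ (ub_le_sup Qub Qq)); rewrite qE.
  exact: (mxnorm_map_ge0 (bpT L sigma s_rep)).
exists m, T; split=> //; exists (sup Q); split=> //.
  move=> j ji; apply: opbdW (Qj j ji) _.
  exact: (mxnorm_map_bd (bpT _ _ (psi_rep j))).
apply: contrapT => no; move: QT; rewrite ltNge => /negP; apply.
apply: (mxnorm_map_le Q0) => x; rewrite leNgt; apply/negP => h; apply: no.
by exists x.
Qed.

(** Equivalent blocks satisfy the same bounds, so no matrix can peak at a block equivalent to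
    another one; this gives the multiplicity-free part of the third condition. *)
Lemma equivalent_opbd i j (J K : finType) (T : J -> K -> H -> H) r :
  (forall p q, S (T p q)) -> unitarily_equivalent A (@psi i) (@psi j) ->
  opbd (psimx j T) r -> opbd (psimx i T) r.
Proof.
move=> ST [U [lU _ dU] Ua] Tr x.
have nU (P : finType) (y : hpow P (E i)) : hnorm (hvec (fun p => U (y p))) = hnorm y.
  apply: eq_hnorm; apply: etrans (hdot_hpow _ _) _; apply: etrans _ (esym (hdot_hpow _ _)).
  by apply: eq_bigr => p _; exact: dU.
rewrite -(nU J) -(nU K).
suff -> : hvec (fun p => U (psimx i T x p)) = psimx j T (hvec (fun q => U (x q))) by exact: Tr.
apply: hpowP => p; rewrite /psimx opmxE; apply: etrans (lin_op_sum lU _ _ _) _.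
apply: eq_bigr => q _; have := Ua _ (opsys_sub (ST p q)).
by move=> /(congr1 (fun f => f (x q))).
Qed.

Lemma strongly_peaking_fully_compressed :
  (forall i, strongly_peaking S (@psi i)) ->
  (forall i j, unitarily_equivalent A (@psi i) (@psi j) -> i = j) ->
  fully_compressed S.
Proof.
move=> sp neq G G_sub GT [P G_proj ci]; apply: GT.
have Ginc i (u : E i) : G (inc u).
  have [m [T [ST pT]]] := strongly_peaks (sp i) (fun j => neq j i).
  (* For d = 0 any peaking matrix will do; at d = n i the components of every attaining vector span
     the block. *)
  have rank d : (d <= n i)%N -> peak_rank i d.
    elim: d => [|d IH] dn; last exact: (peak_step dn (IH (ltnW dn))).
    by exists 'I_m, 'I_m, (fun a b => T a b).
  have [J [K [T' [ST' pT' full]]]] := rank _ (leqnn _).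
  have [v [/full vn Gv]] := peak_attained ST' G_sub G_proj ci pT'.
  have : ((u : 'rV_(n i)) <= vmx v)%MS.
    by apply: submx_full; rewrite /row_full eqn_leq rank_leq_col.
  move=> /submxP[D ->]; rewrite mulmx_sum_row.
  rewrite (lin_op_sum (@inc_lin _ _ _ _ _ _ _ _ blocks i)).
  have [G0 _ _] := G_sub.
  elim/big_ind: _ => [//|x y|k _]; first exact: (subspaceD G_sub).
  rewrite (lin_opZ (@inc_lin _ _ _ _ _ _ _ _ blocks i)) rowK.
  exact: (subspaceZ G_sub).
(* G contains every block, so x - P x, being orthogonal to G, has component 0 in each of them. *)
apply/seteqP; split=> // x _; have [GP xG] := G_proj x.
suff -> : x = P x by [].
apply/eqP; rewrite -subr_eq0; apply/eqP; apply: (pr_inj blocks) => i.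
rewrite (lin_op0 (@pr_lin _ _ _ _ _ _ _ _ blocks i)); apply: hdot_inj => w.
rewrite hdot0l hdotC -(hdot_inc blocks) hdotC xG ?conjC0 //.
Qed.

(** * The C*-envelope *)

Lemma blocks_op_opbd a c : A a -> 0 <= c -> (forall i, opbd (@psi i a) c) -> opbd a c.
Proof.
move=> Aa c0 hc x.
(* [pr_bound] speaks of finite powers; a power over [unit] is the space itself. *)
have n1 (V : hilbert R) (y : V) : hnorm (hvec (fun _ : unit => y)) = hnorm y.
  by apply: eq_hnorm; rewrite (hdot_hpow (hvec _)) (bigD1 tt) // big1 ?Monoid.mulm1 //; case.
rewrite -(n1 H x) -(n1 H (a x)); apply: (pr_bound blocks) => // i.
have h1 : hnorm (pr i (a x)) <= c * hnorm (pr i x) by rewrite (pr_act blocks) //; exact: hc.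
by rewrite -(n1 _ (pr i (a x))) -(n1 _ (pr i x)) in h1.
Qed.

Section Envelope.
Variables (L : hilbert R) (iota : (H -> H) -> (L -> L)) (rho : (H -> H) -> (L -> L)).
Hypothesis peaks : forall i, exists m (T : 'M[H -> H]_m) r, [/\ entries_in S T, 0 <= r,
  forall j, j != i -> opbd (psimx j (fun a b => T a b)) r &
  exists x, r * hnorm x < hnorm (psimx i (fun a b => T a b) x)].
Hypotheses (rho_rep : representation A rho) (rhoS : forall s, S s -> rho s = iota s).
Hypothesis iota_ci : completely_isometric S iota.

(** If rho killed the ideal of block i, a matrix peaking there would be bounded by r under [iota],
    hence also before it by complete isometry, against the peak. So [block_embedding] puts an
    isometric copy of psi_i inside rho. *)
Lemma psi_opbd_of_rho i a c : A a -> opbd (rho a) c -> opbd (@psi i a) c.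
Proof.
move=> Aa ac; have [m [T [r [ST r0 Tr xr]]]] := peaks i.
have AT p q : A (T p q) := opsys_sub (ST p q).
have full : full_block i by apply: (peak_full_block ST); exists r.
have [z Jz zE] := full idfun (fun _ _ _ => erefl).
have sz : rho z <> 0.
  move=> z0; have := rep_vanish_bound rho_rep Jz zE AT r0 Tr z0.
  have -> : (fun p q => rho (T p q)) = fun p q => iota (T p q).
    by apply: funext => p; apply: funext => q; exact: rhoS.
  have ciT : mxnorm (map_mx iota T) = mxnorm T := iota_ci ST.
  move=> /(mxnorm_map_le r0); rewrite ciT => Tr'.
  have Tb : opbd (opmx (fun a b => T a b)) r.
    exact: opbdW Tr' (mxnorm_bd (fun p q => opsys_bd (ST p q))).
  have [x] := xr; rewrite ltNge => /negP; apply.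
  exact: ((blocks_opbd blocks psi_rep AT r0).1 Tb i).
have [U [lU dU Ua]] := block_embedding full rho_rep Jz zE sz.
have nU x : hnorm (U x) = hnorm x by apply: eq_hnorm; exact: dU.
by move=> v; rewrite -nU Ua // -(nU v); exact: ac.
Qed.

Lemma rho_expanding a c : A a -> 0 <= c -> opbd (rho a) c -> opbd a c.
Proof.
by move=> Aa c0 ac; apply: blocks_op_opbd => // i; exact: psi_opbd_of_rho.
Qed.

Lemma rho_inj a b : A a -> A b -> rho a = rho b -> a = b.
Proof.
move=> Aa Ab ab; have : opbd (a - b) 0.
  apply: rho_expanding => //; first exact: (algB opsys_alg).
  by rewrite (repB rho_rep) // ab subrr => x; rewrite hnorm0 mul0r.
move=> h; apply: funext => x; apply/eqP; rewrite -subr_eq0 -hnorm_eq0.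
by rewrite eq_le hnorm_ge0 andbT; have := h x; rewrite mul0r.
Qed.

(** By [rho_expanding], the preimages of a convergent sequence are Cauchy. *)
Lemma rho_image_closed : norm_closed (rho @` A).
Proof.
move=> T bT h.
have h' k : exists a, A a /\ opbd (T - rho a) k.+1%:R^-1.
  have [_ [a Aa <-] Ta] := h _ (natSinv_gt0 R k); exists a; split=> //.
  apply: opbdW (ltW Ta) (opnorm_bd _); apply: bounded_opB bT _.
  exact: (rep_bd rho_rep Aa).
have [u Hu] := choice h'.
have Au k : A (u k) by have [] := Hu k.
have [e e0|a ba ua] := op_complete (fun k => alg_bd opsys_alg (Au k)).
  have e2 : 0 < e / 2 by rewrite divr_gt0.
  have [N HN] := natSinv_small e2; exists N => p q Np Nq.
  apply: rho_expanding (ltW e0) _; first exact: (algB opsys_alg).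
  rewrite (repB rho_rep) // => x; rewrite -[X in hnorm X](subrKA (T x)).
  apply: le_trans (hnorm_triangle _ _) _; rewrite (splitr e) mulrDl; apply: lerD.
    rewrite hnormBC; have [_ hp] := Hu p; apply: le_trans (hp x) _.
    exact: ler_wpM2r (hnorm_ge0 _) _ _ (HN p Np).
  have [_ hq] := Hu q; apply: le_trans (hq x) _.
  exact: ler_wpM2r (hnorm_ge0 _) _ _ (HN q Nq).
have Aa : A a.
  apply: cstar_closed opsys_alg ba _ => e /ua[N HN]; exists (u N) => // x.
  by rewrite hnormBC; exact: (HN N (leqnn N) x).
exists a => //; apply: funext => x; apply/eqP; rewrite -subr_eq0; apply/eqP.
apply: (@hnorm_le0_eq R L _ (2 * hnorm x)); first by rewrite mulr_ge0 ?hnorm_ge0.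
move=> e e0; have [N1 HN1] := natSinv_small e0; have [N2 HN2] := ua e e0.
pose k := maxn N1 N2; rewrite -(subrKA (rho (u k) x)).
apply: le_trans (hnorm_triangle _ _) _.
have -> : 2 * hnorm x * e = e * hnorm x + e * hnorm x by ring.
apply: lerD; rewrite hnormBC.
  have := rep_contractive opsys_alg cstar1 rho_rep (algB opsys_alg (Au k) Aa) (ltW e0)
    (HN2 k (leq_maxr _ _)) x.
  by rewrite (repB rho_rep).
have [_ hk] := Hu k; apply: le_trans (hk x) _.
exact: ler_wpM2r (hnorm_ge0 _) _ _ (HN1 k (leq_maxl _ _)).
Qed.

Lemma rho_image_cstar : cstar_subalgebra (rho @` A).
Proof.
split; last exact: rho_image_closed.
- split=> [_ [a Aa <-]||c _ _ [a Aa <-] [b Ab <-]]; first exact: (rep_bd rho_rep Aa).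
    by exists 0; [exact: (alg0 opsys_alg)|exact: (rep0 opsys_alg rho_rep)].
  exists (c *: a + b); first exact: (alg_lincomb opsys_alg).
  exact: (rep_lincomb rho_rep).
- move=> _ _ [a Aa <-] [b Ab <-]; exists (a \o b); first exact: (alg_comp opsys_alg).
  exact: (rep_comp rho_rep).
- move=> _ [a Aa <-]; have [a' Aa' aa'] := alg_adj opsys_alg Aa.
  by exists (rho a'); [exists a'|exact: (rep_adj rho_rep)].
Qed.

(** For surjectivity, the image of rho is a C*-subalgebra containing the image of S under [iota],
    hence all that the latter generates. *)
Lemma rho_bij : (forall a, A a -> cstar (iota @` S) (rho a)) ->
  set_bij A (cstar (iota @` S)) rho.
Proof.
move=> rho_in; split=> [a Aa|a b|T hT].
- exact: rho_in.
- by rewrite !inE => Aa Ab; exact: rho_inj.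
- apply: hT rho_image_cstar _ => _ [s Ss <-]; exists s; first exact: opsys_sub.
  exact: rhoS.
Qed.

End Envelope.

(** The canonical map is the one that the universal property assigns to the cover [id]. *)
Lemma peaks_envelope :
  (forall i, exists m (T : 'M[H -> H]_m) r, [/\ entries_in S T, 0 <= r,
    forall j, j != i -> opbd (psimx j (fun a b => T a b)) r &
    exists x, r * hnorm x < hnorm (psimx i (fun a b => T a b) x)]) ->
  cstar_is_envelope S.
Proof.
move=> peaks L iota [[_ _ _ iota_ci] univ].
have [|rho [rho_rep rho_in] rhoS] := univ H id.
  split=> //; first exact: opsys_bd.
  move=> m T ST; rewrite /mxnorm; congr (mxnorm_on setT _).
  by apply/matrixP => a b; rewrite mxE.
rewrite image_id in rho_rep rho_in.
exists rho; split=> //.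
exact: rho_bij peaks rho_rep rhoS iota_ci rho_in.
Qed.

End BlockDiagonal.

Theorem theorem3p9 (R : realType) (H : hilbert R) (S : set (H -> H))
    (Lambda : choiceType) (n : Lambda -> nat)
    (psi : forall i : Lambda,
       (H -> H) -> (euclidean R (n i) -> euclidean R (n i)))
    (H_neq0 : exists x : H, x <> 0)
    (S_opsys : operator_system S)
    (S_sep : norm_separable S)
    (psi_irr : forall i, irreducible_rep (cstar S) (psi i))
    (block_diagonal :
       unitarily_equivalent (cstar S) (fun a => a) (direct_sum_rep psi)) :
  [<-> minimal S;
       forall i : Lambda, ~ completely_isometric S
         (direct_sum_rep (fun j : {j : Lambda | j != i} => psi (val j)));
       (forall i, strongly_peaking S (psi i)) /\
       (forall i j, unitarily_equivalent (cstar S) (psi i) (psi j) -> i = j);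
       fully_compressed S]
  /\ (minimal S -> cstar_is_envelope S).
Proof.
have psi_rep i : representation (cstar S) (psi i) by have [h _ _] := psi_irr i; exact: h.
have [pr [inc blocks]] := block_decomposition_exists (opsys_alg S_opsys) (cstar1 S_opsys)
  psi_rep block_diagonal.
have min_peaks : minimal S -> forall i, ~ completely_isometric S
    (direct_sum_rep (fun j : {j : Lambda | j != i} => psi (val j))).
  by move=> minS i; exact: (minimal_not_isometric S_opsys psi_irr blocks minS).
have peaks i := @not_isometric_peaks R H S Lambda n psi pr inc S_opsys psi_irr blocks i.
split; last first.
  move=> minS; apply: (peaks_envelope S_opsys psi_irr blocks) => i.
  exact: peaks (min_peaks minS i).
tfae.
- exact: min_peaks.
- move=> nci; split=> [i|i j ij].
    have [m [T [r [ST r0 Tr xr]]]] := peaks i (nci i).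
    exact: (peaks_strongly S_opsys psi_irr blocks ST r0 Tr xr).
  apply: contrapT => /eqP nij; have [m [T [r [ST r0 Tr [x xr]]]]] := peaks i (nci i).
  have Tj := Tr j; rewrite eq_sym in Tj.
  have := equivalent_opbd ST ij (Tj nij) x.
  by rewrite leNgt xr.
- move=> [sp neq]; exact: (strongly_peaking_fully_compressed S_opsys psi_irr blocks sp neq).
- by move=> fc G G_sub GT _; exact: fc.
Qed.
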